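(* Consider the following homogeneous ideal in $R = K[x,y,z,t]$: $$J = \left(xy,\ x^2A + xhF,\ y^2B + yhG,\ xAG + yBF + hFG\right),$$ where $h, F, G \in K[z,t]$, $F, G \notin K$, $A \in K[x,z,t]$, $B \in K[y,z,t]$ are homogeneous polynomials, and $AB \neq 0$ in case $h = 0$. Denote by $d_F, d_G, d_h$ the degrees of $F$, $G$, and $h$, respectively. Then $J$ defines a $1$-dimensional subscheme $C \subset \mathbb{P}^3$ of degree $d = 2d_h + d_F + d_G$. Moreover, $J$ has the following minimal free graded resolution: $$0 \to F_3 \xrightarrow{\phi_3} F_2 \xrightarrow{\phi_2} F_1 \xrightarrow{\phi_1} J \to 0,$$ where \begin{align*} F_1 &= R(-2) \oplus R(-d_F-d_h-1) \oplus R(-d_G-d_h-1) \oplus R(-d_F-d_G-d_h), \\ F_2 &= R(-d_F-d_h-2) \oplus R(-d_G-d_h-2) \oplus R(-d_F-d_G-d_h-1)^2, \\ F_3 &= R(-d_F-d_G-d_h-2), \end{align*} and, identifying the maps with their matrices, $$\phi_1 = \begin{bmatrix} xy & x^2A+xhF & y^2B+yhG & xAG+yBF+hFG \end{bmatrix},$$ $$\phi_2 = \begin{bmatrix} xA+hF & yB+hG & AG & BF \\ -y & 0 & 0 & G \\ 0 & -x & F & 0 \\ 0 & 0 & -y & -x \end{bmatrix}, \qquad \phi_3 = \begin{bmatrix} G \\ -F \\ -x \\ y \end{bmatrix}.$$ Hence, $C$ is a curve if and only if $x, y, F, G$ is a regular sequence.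
   Context: $K$ is an algebraically closed field and $R = K[x,y,z,t]$ is the homogeneous coordinate ring of $\mathbb{P}^3 = \mathbb{P}^3_K$. A curve is a pure one-dimensional locally Cohen-Macaulay closed subscheme of $\mathbb{P}^3$. The displayed generators of $J$ are assumed homogeneous. If $h = 0$, then $d_h$ denotes the formal degree forced by homogeneity, i.e. $d_h = \deg A + 1 - d_F = \deg B + 1 - d_G$ (possibly negative). *)

(* Defs.v *)
From HB Require Import structures.
From mathcomp Require Import all_boot all_order all_algebra.
From mathcomp Require Import fraction mpoly.
From mathcomp Require Import boolp.

Set Implicit Arguments.
Unset Strict Implicit.
Unset Printing Implicit Defensive.

Import GRing.Theory.
Local Open Scope ring_scope.

(* Ideals are Prop-valued predicates.  Properties of a quotient ring L / I are *)
(* expressed in L, relatively to the ideal I.                                  *)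

Definition sub_ideal (T : Type) (I J : T -> Prop) := forall a, I a -> J a.

(* strictly increasing chains p 0 < ... < p n of members of the family Q *)
Definition has_chain (T : Type) (Q : (T -> Prop) -> Prop) (n : nat) :=
  exists p : nat -> T -> Prop,
    (forall i, (i <= n)%N -> Q (p i)) /\
    (forall i, (i < n)%N -> sub_ideal (p i) (p i.+1) /\
                            ~ sub_ideal (p i.+1) (p i)).

(* n is the supremum of the lengths of such chains *)
Definition has_dim (T : Type) (Q : (T -> Prop) -> Prop) (n : nat) :=
  has_chain Q n /\ ~ has_chain Q n.+1.

Section CommutativeAlgebra.
Variable L : comNzRingType.
Implicit Types (I P : L -> Prop) (s : seq L).

Definition is_ideal I :=
  [/\ I 0, forall a b, I a -> I b -> I (a + b) & forall a b, I b -> I (a * b)].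

Definition prime_ideal P :=
  [/\ is_ideal P, ~ P 1 & forall a b, P (a * b) -> P a \/ P b].

Definition zero_ideal : L -> Prop := fun a => a = 0.

Definition idgen s : L -> Prop :=
  fun a => exists c : nat -> L, a = \sum_(i < size s) c i * s`_i.

(* the ideal I + (s) *)
Definition idadd I s : L -> Prop := fun a => exists2 q, I q & idgen s (a - q).

(* s is a regular sequence on L / I *)
Definition regular_seq I s :=
  (forall i, (i < size s)%N -> forall a,
     idadd I (take i s) (s`_i * a) -> idadd I (take i s) a) /\
  ~ idadd I s 1.

Definition krull_dim I n :=
  has_dim (fun P => prime_ideal P /\ sub_ideal I P) n.

(* For L local, the condition ~ idadd I s 1 in regular_seq puts the members of *)
(* s in the maximal ideal; as prefixes of regular sequences are regular, n is  *)
(* the maximal length of a regular sequence.                                   *)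
Definition depth I n :=
  (exists2 s, size s = n & regular_seq I s) /\
  ~ (exists2 s, size s = n.+1 & regular_seq I s).

(* for L noetherian and local *)
Definition cohen_macaulay I := exists n, krull_dim I n /\ depth I n.

End CommutativeAlgebra.

Section ProjectiveSpace.
Variable K : fieldType.
Local Notation R := {mpoly K[4]}.
Local Notation "x %:F" := (@FracField.tofrac R x).
Implicit Types (I J : R -> Prop) (p : R).

Definition ix : 'I_4 := @Ordinal 4 0 isT.
Definition iy : 'I_4 := @Ordinal 4 1 isT.
Definition iz : 'I_4 := @Ordinal 4 2 isT.
Definition it : 'I_4 := @Ordinal 4 3 isT.

(* p lies in the polynomial subring on the variables other than 'X_i *)
Definition free_of (i : 'I_4) p := forall m, m \in msupp p -> m i = 0%N.

Definition deg p : int := (msize p).-1%:Z.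

Definition irrelevant : R -> Prop := idgen [:: 'X_ix; 'X_iy; 'X_iz; 'X_it].

Definition homog_ideal I := forall p d, I p -> I (pihomog mdeg d p).

(* the points of the scheme P^3 *)
Definition is_projpt (P : R -> Prop) :=
  [/\ prime_ideal P, homog_ideal P & ~ sub_ideal irrelevant P].

Record projpt := ProjPt { projpt_ideal :> R -> Prop;
                          projptP : is_projpt projpt_ideal }.

(* the points of the closed subscheme Proj (R / J) *)
Definition on_proj J (P : R -> Prop) := is_projpt P /\ sub_ideal J P.

Definition proj_dim J n := has_dim (on_proj J) n.

(* The local ring of P^3 at P, as the subring of the fractions a / s with      *)
(* a and s homogeneous of the same degree and s not in P.                      *)
Definition stalk_pred (P : projpt) : {pred {fraction R}} :=
  fun f => `[< exists a s : R, exists d : nat,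
    [/\ a \is d.-homog, s \is d.-homog, ~ P s & f = a%:F / s%:F] >].

Lemma projpt_neq0 (P : projpt) (s : R) : ~ P s -> s%:F != 0.
Proof.
move=> Ps; rewrite tofrac_eq0; apply/eqP => s0; apply: Ps.
by rewrite s0; case: (projptP P) => [[[]]].
Qed.

Lemma projptM (P : projpt) (s t : R) : ~ P s -> ~ P t -> ~ P (s * t).
Proof. by case: (projptP P) => [[_ _ h] _ _] Ps Pt /h []. Qed.

Lemma stalk_subring (P : projpt) : subring_closed (stalk_pred P).
Proof.
split.
- apply/asboolP; exists 1, 1, 0%N; split; rewrite ?dhomog1 ?divr1 //.
  by case: (projptP P) => [[]].
- move=> _ _ /asboolP[a [s [d [ha hs Ps ->]]]] /asboolP[b [t [e [hb ht Pt ->]]]].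
  apply/asboolP; exists (a * t - b * s), (s * t), (d + e)%N; split.
  + by apply: rpredB; [exact: dhomogM | rewrite addnC; exact: dhomogM].
  + exact: dhomogM.
  + exact: projptM.
  + rewrite !(rmorphB, rmorphM) /= -[in LHS]mulNr addf_div ?mulNr //.
      exact: projpt_neq0 Ps.
    exact: projpt_neq0 Pt.
- move=> _ _ /asboolP[a [s [d [ha hs Ps ->]]]] /asboolP[b [t [e [hb ht Pt ->]]]].
  apply/asboolP; exists (a * b), (s * t), (d + e)%N; split.
  + exact: dhomogM.
  + exact: dhomogM.
  + exact: projptM.
  + by rewrite !rmorphM /= mulf_div.
Qed.

HB.instance Definition _ (P : projpt) :=
  GRing.isSubringClosed.Build {fraction R} (stalk_pred P) (stalk_subring P).

Record stalk (P : projpt) :=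
  Stalk { stalk_val :> {fraction R}; _ : stalk_val \in stalk_pred P }.

HB.instance Definition _ (P : projpt) := [isSub for @stalk_val P].
HB.instance Definition _ (P : projpt) := [Choice of stalk P by <:].
HB.instance Definition _ (P : projpt) :=
  [SubChoice_isSubComNzRing of stalk P by <:].

(* The stalk at P of the ideal sheaf of J (J homogeneous): the local ring of   *)
(* Proj (R / J) at P is stalk P / stalk_ideal J P.                             *)
Definition stalk_ideal J (P : projpt) : stalk P -> Prop :=
  fun f => exists a s : R, exists d : nat,
    [/\ J a, a \is d.-homog, s \is d.-homog, ~ P s & val f = a%:F / s%:F].

Definition locally_cohen_macaulay J :=
  forall P : projpt, sub_ideal J P -> cohen_macaulay (@stalk_ideal J P).

(* P is the generic point of an irreducible component of Proj (R / J) *)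
Definition proj_component J P :=
  on_proj J P /\ forall Q, on_proj J Q -> sub_ideal Q P -> sub_ideal P Q.

Definition pure_dim J n :=
  proj_dim J n /\ forall P, proj_component J P -> proj_dim P n.

Definition is_curve J := pure_dim J 1 /\ locally_cohen_macaulay J.

(* k is the dimension of the degree d part of R / J: it has a basis, induced   *)
(* by the family b                                                             *)
Definition hilbert_fun J (d k : nat) :=
  exists b : 'I_k -> R,
    [/\ forall i, b i \is d.-homog,
        forall c : 'I_k -> K, J (\sum_i c i *: b i) -> forall i, c i = 0 &
        forall p, p \is d.-homog ->
          exists c : 'I_k -> K, J (p - \sum_i c i *: b i)].

Definition hilbert_poly J (H : {poly rat}) :=
  exists n0 : nat, forall n : nat, (n0 <= n)%N ->
    exists2 k : nat, hilbert_fun J n k & H.[n%:R] = k%:R.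

(* degree of Proj (R / J): r! times the leading coefficient of the Hilbert     *)
(* polynomial, r being its degree                                              *)
Definition proj_degree J (e : int) :=
  exists2 H, hilbert_poly J H & (size H).-1`!%:R * lead_coef H = e%:~R.

Definition mx_of_rows (m n : nat) (s : seq (seq R)) : 'M[R]_(m, n) :=
  \matrix_(i, j) (nth [::] s i)`_j.

(* p lies in the degree d part of R, which is 0 for d < 0 *)
Definition in_degree (d : int) p :=
  forall m, m \in msupp p -> (mdeg m)%:Z = d.

(* v lies in the degree d part of the direct sum of the R(- a_i) *)
Definition free_in_degree n (a : n.-tuple int) (d : int) (v : 'cV[R]_n) :=
  forall i, in_degree (d - tnth a i) (v i 0).

(* M maps the direct sum of the R(- a_j) to the direct sum of the R(- b_i),    *)
(* preserving degrees                                                          *)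
Definition graded_map m n (b : m.-tuple int) (a : n.-tuple int)
    (M : 'M[R]_(m, n)) :=
  forall d v, free_in_degree a d v -> free_in_degree b d (M *m v).

(* the image of M lies in irrelevant * R^m *)
Definition minimal_map m n (M : 'M[R]_(m, n)) :=
  forall (v : 'cV[R]_n) i, irrelevant ((M *m v) i 0).

(* 0 -> F_3 -> F_2 -> F_1 -> J -> 0 is a minimal free graded resolution, where *)
(* F_k is the direct sum of the R(- a), a in ak, and Mk is the matrix of the   *)
(* map out of F_k                                                              *)
Definition minimal_free_graded_resolution J n1 n2 n3
    (a1 : n1.-tuple int) (a2 : n2.-tuple int) (a3 : n3.-tuple int)
    (M1 : 'M[R]_(1, n1)) (M2 : 'M[R]_(n1, n2)) (M3 : 'M[R]_(n2, n3)) :=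
  [/\ [/\ graded_map [tuple 0] a1 M1, graded_map a1 a2 M2 & graded_map a2 a3 M3],
      [/\ forall p, J p <-> exists v : 'cV_n1, M1 *m v = p%:M,
          forall v : 'cV_n1, M1 *m v = 0 <-> exists w, v = M2 *m w,
          forall v : 'cV_n2, M2 *m v = 0 <-> exists w, v = M3 *m w &
          forall v : 'cV_n3, M3 *m v = 0 -> v = 0] &
      minimal_map M2 /\ minimal_map M3].

End ProjectiveSpace.

(* Main.v *)
Require Import Defs.
From HB Require Import structures.
From mathcomp Require Import all_boot all_order all_algebra.
From mathcomp Require Import ring zify.
From mathcomp Require Import fraction mpoly.
From mathcomp Require Import boolp.
From mathcomp Require classical_sets.

Set Implicit Arguments.
Unset Strict Implicit.
Unset Printing Implicit Defensive.

Import GRing.Theory.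
Local Open Scope ring_scope.

(** Put U = y B + h G and V = x A + h F. The generators of J are xy, xV, yU and
    x A G + F U = y B F + G V, so that J is contained in the ideals (x, U) and
    (y, V) of two plane curves. The situation is symmetric under the exchange of
    (x, A, F) and (y, B, G).

    Resolution. A syzygy of the generators is reduced modulo x, then modulo y,
    using only that (x, y), (x, U) and (y, V) are regular sequences and that F is
    regular modulo (x, y): [syzygy1] and [syzygy2].

    Degree. The same computation gives J : x = (y, V), while J + (x) is filtered by
    (x, U) and (x, y, F). Additivity of Hilbert functions, [hf_exact], then shows
    that the Hilbert polynomial of J is linear with leading coefficient
    deg U + deg V = 2 d_h + d_F + d_G: [hf_ev_double].

    Dimension. It is controlled by the growth of Hilbert functions. If P < Q are
    homogeneous primes, a form of degree e in Q but not in P gives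
    hf P n + hf Q (e + n) <= hf P (e + n), so that linear growth excludes chains of
    three points: [no_chain2]. If hf P is unbounded, P + (v) has a point for any
    variable v outside P, so that P is not closed: [larger_point]. If hf P is
    bounded, any two linear forms have a linear combination in P, because binary
    forms split: [bounded_linear_form]. For a point P over J of this kind, a
    generic linear form a through P is a nonzerodivisor modulo (y, V) or (x, U),
    so that P is not minimal over J: [smaller_point]. Hence J always defines a
    scheme all of whose components have dimension 1, and being a curve is a
    matter of depth.

    Depth. Primes of the local ring at P correspond to homogeneous primes inside
    P, so the local rings have dimension 0 or 1, and depth is at most dimension by
    [regular_chain]. At a closed point where one of x, y, F, G is invertible, J is
    locally (y, V), or (x, U), or is generated by three of its four generators,
    and a generic linear form is a nonzerodivisor modulo J: [nonzerodivisor]. At a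
    point where x, y, F, G all vanish, F and G have a common linear factor L, and
    the last generator divided by L is a nonzero element killed by the maximal
    ideal: [socle_element]. So J is locally Cohen-Macaulay if and only if x, y, F, G
    have no common zero, that is, if and only if the binary forms F and G have no
    common factor, which is the regularity of x, y, F, G. *)

(** * Ideals, prime ideals and regular sequences *)

Lemma has_chain_cons (T : Type) (X : (T -> Prop) -> Prop) (n : nat)
    (p : nat -> T -> Prop) (q : T -> Prop) :
  (forall i, (i <= n)%N -> X (p i)) ->
  (forall i, (i < n)%N -> sub_ideal (p i) (p i.+1) /\ ~ sub_ideal (p i.+1) (p i)) ->
  X q -> sub_ideal q (p 0%N) -> ~ sub_ideal (p 0%N) q -> has_chain X n.+1.
Proof.
move=> pX pS Xq q0 nq0; exists (fun i => if i is j.+1 then p j else q); split.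
  by case=> // i; rewrite ltnS => /pX.
by case=> // i; rewrite ltnS; apply: pS.
Qed.

Section IdealTheory.
Variable L : comNzRingType.
Implicit Types (I P Q S : L -> Prop) (s : seq L) (a b c d e : L).

Lemma ideal_opp I a : is_ideal I -> I a -> I (- a).
Proof. by case=> _ _ iM Ia; rewrite -mulN1r; apply: iM. Qed.

Lemma ideal_sub I a b : is_ideal I -> I a -> I b -> I (a - b).
Proof. by move=> iI Ia Ib; case: (iI) => _ iD _; apply: iD => //; apply: ideal_opp. Qed.

Lemma ideal_mulr I a b : is_ideal I -> I a -> I (a * b).
Proof. by case=> _ _ iM Ia; rewrite mulrC; apply: iM. Qed.

Lemma ideal_subK I a b : is_ideal I -> I b -> I (a - b) -> I a.
Proof. by move=> [_ iD _] Ib Iab; rewrite -(subrK b a); apply: iD. Qed.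

Lemma ideal_sum I (T : Type) (r : seq T) (p : pred T) (F : T -> L) :
  is_ideal I -> (forall i, p i -> I (F i)) -> I (\sum_(i <- r | p i) F i).
Proof. by case=> i0 iD _ iF; elim/big_rec: _ => // i a pi; apply: iD; apply: iF. Qed.

Lemma idgen_ideal s : is_ideal (idgen s).
Proof.
split.
- by exists (fun=> 0); rewrite big1 // => i _; rewrite mul0r.
- move=> a b [c ->] [d ->]; exists (fun i => c i + d i).
  by rewrite -big_split; apply: eq_bigr => i _; rewrite mulrDl.
- move=> a b [c ->]; exists (fun i => a * c i).
  by rewrite mulr_sumr; apply: eq_bigr => i _; rewrite mulrA.
Qed.

Lemma idgen_nil a : idgen [::] a <-> a = 0 :> L.
Proof.
by split=> [[c ->]|->]; [rewrite big_ord0 | exists (fun=> 0); rewrite big_ord0].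
Qed.

Lemma idgen_cons b s a : idgen (b :: s) a <-> exists c, idgen s (a - c * b).
Proof.
split=> [[c ->]|[c0 [c eq_a]]].
  by exists (c 0%N); exists (fun i => c i.+1); rewrite big_ord_recl /= [_ * _ + _]addrC addrK.
exists (fun i => if i is j.+1 then c j else c0); rewrite big_ord_recl /=.
by apply/eqP; rewrite addrC -subr_eq eq_a.
Qed.

Lemma idgen_mem s b : b \in s -> idgen s b.
Proof.
elim: s => // a s IHs; rewrite inE => /orP[/eqP<-|/IHs sb]; apply/idgen_cons.
  by exists 1; rewrite mul1r subrr; case: (idgen_ideal s).
by exists 0; rewrite mul0r subr0.
Qed.

Lemma idgen_sub I s : is_ideal I -> (forall b, b \in s -> I b) -> sub_ideal (idgen s) I.
Proof.
move=> iI Is _ [c ->]; apply: ideal_sum => // i _.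
by case: iI => _ _; apply; apply: Is; apply: mem_nth.
Qed.

Lemma idgen1 b a : idgen [:: b] a <-> exists u, a = u * b.
Proof.
split=> [/idgen_cons[u /idgen_nil/eqP]|[u ->]].
  by rewrite subr_eq0 => /eqP; exists u.
by apply/idgen_cons; exists u; apply/idgen_nil; rewrite subrr.
Qed.

Lemma idgen2 b c a : idgen [:: b; c] a <-> exists u v, a = u * b + v * c.
Proof.
split=> [/idgen_cons[u /idgen1[v /eqP]]|[u [v ->]]].
  by rewrite subr_eq addrC => /eqP; exists u, v.
by apply/idgen_cons; exists u; apply/idgen1; exists v; rewrite addrC addKr.
Qed.

Lemma idgen3 b c d a :
  idgen [:: b; c; d] a <-> exists u v w, a = u * b + v * c + w * d.
Proof.
split=> [/idgen_cons[u /idgen2[v [w /eqP]]]|[u [v [w ->]]]].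
  by rewrite subr_eq addrC addrA => /eqP; exists u, v, w.
by apply/idgen_cons; exists u; apply/idgen2; exists v, w; ring.
Qed.

Lemma idgen4 b c d e a :
  idgen [:: b; c; d; e] a <-> exists u v w z, a = u * b + v * c + w * d + z * e.
Proof.
split=> [/idgen_cons[u /idgen3[v [w [z /eqP]]]]|[u [v [w [z ->]]]]].
  by rewrite subr_eq addrC !addrA => /eqP; exists u, v, w, z.
by apply/idgen_cons; exists u; apply/idgen3; exists v, w, z; ring.
Qed.

Lemma idadd_ideal I s : is_ideal I -> is_ideal (idadd I s).
Proof.
move=> iI; have [s0 sD sM] := idgen_ideal s; case: (iI) => i0 iD iM; split.
- by exists 0; rewrite ?subr0.
- by move=> a b [p Ip sp] [q Iq sq]; exists (p + q); [exact: iD | rewrite opprD addrACA; exact: sD].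
- by move=> a b [q Iq sq]; exists (a * q); [exact: iM | rewrite -mulrBr; exact: sM].
Qed.

Lemma idadd_l I s a : I a -> idadd I s a.
Proof. by move=> Ia; exists a => //; rewrite subrr; case: (idgen_ideal s). Qed.

Lemma idadd_r I s a : is_ideal I -> idgen s a -> idadd I s a.
Proof. by case=> i0 _ _ sa; exists 0; rewrite ?subr0. Qed.

Lemma idadd_sub I s Q : is_ideal Q -> sub_ideal I Q -> (forall b, b \in s -> Q b) ->
  sub_ideal (idadd I s) Q.
Proof.
by move=> iQ IQ sQ a [q /IQ Qq /(idgen_sub iQ sQ)]; apply: ideal_subK.
Qed.

Lemma idadd1 I b a : idadd I [:: b] a <-> exists u, I (a - u * b).
Proof.
split=> [[q Iq /idgen1[u eq_a]]|[u Iu]].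
  by exists u; rewrite -eq_a opprB addrC subrK.
by exists (a - u * b) => //; apply/idgen1; exists u; rewrite subKr.
Qed.

Lemma idadd_nil I a : is_ideal I -> idadd I [::] a <-> I a.
Proof.
move=> iI; split=> [[q Iq /idgen_nil/eqP]|]; last exact: idadd_l.
by rewrite subr_eq0 => /eqP->.
Qed.

Lemma idadd_cons I b s a :
  is_ideal I -> idadd I (b :: s) a <-> idadd (idadd I [:: b]) s a.
Proof.
move=> iI; split.
  case=> q Iq /idgen_cons[c sc]; exists (q + c * b); last by rewrite opprD addrA.
  by apply/idadd1; exists c; rewrite addrK.
case=> q /idadd1[c Iq] sq; exists (q - c * b) => //; apply/idgen_cons; exists c.
by have -> : a - (q - c * b) - c * b = a - q by ring.
Qed.

(** Among the ideals that contain I and are disjoint from S, one is maximal by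
    Zorn's lemma. It is prime: if it contained a product a b but neither factor,
    adding a, resp. b, would give ideals that meet S, and the product of two
    elements of S found there would lie in it. *)
Lemma prime_avoiding I S : is_ideal I -> S 1 ->
    (forall a b, S a -> S b -> S (a * b)) -> (forall a, I a -> ~ S a) ->
  exists Q, [/\ prime_ideal Q, sub_ideal I Q & forall a, Q a -> ~ S a].
Proof.
move=> iI S1 SM IS.
pose good Q := [/\ is_ideal Q, sub_ideal I Q & forall a, Q a -> ~ S a].
have gI : good I by split.
pose T := {Q | good Q}.
pose le (A B : T) := `[< sub_ideal (sval A) (sval B) >].
have [|||[M gM] maxM] := @classical_sets.ZL_preorder T (exist _ I gI) le.
- by move=> A; apply/asboolP.
- by move=> A B C /asboolP AB /asboolP BC; apply/asboolP => a /AB/BC.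
- move=> F totF; have [[A0 FA0]|noF] := pselect (exists A, F A); last first.
    by exists (exist _ I gI) => A FA; case: noF; exists A.
  pose U a := exists2 A, F A & sval A a.
  have gU : good U.
    split; [split | |].
    + by exists A0 => //; case: (svalP A0) => [[]].
    + move=> a b [A FA Aa] [B FB Bb].
      have [/asboolP AB|/asboolP BA] := totF _ _ FA FB.
        by exists B => //; case: (svalP B) => [[_ iD _] _ _]; apply: iD => //; apply: AB.
      by exists A => //; case: (svalP A) => [[_ iD _] _ _]; apply: iD => //; apply: BA.
    + by move=> a b [A FA Ab]; exists A => //; case: (svalP A) => [[_ _ iM] _ _]; apply: iM.
    + by move=> a Ia; exists A0 => //; case: (svalP A0) => [_ + _]; apply.
    + by move=> a [A FA Aa]; case: (svalP A) => [_ _]; apply.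
  by exists (exist _ U gU) => A FA; apply/asboolP => a Aa; exists A.
case: (gM) => iM IM MS; exists M; split=> //; split=> //; first by move=> /MS.
move=> a b Mab; apply: contrapT => nMab.
have Ma : ~ M a by move=> Ma; apply: nMab; left.
have Mb : ~ M b by move=> Mb; apply: nMab; right.
have meet c : ~ M c -> exists2 d, S d & idadd M [:: c] d.
  move=> Mc; apply: contrapT => noS; apply: Mc.
  have gMc : good (idadd M [:: c]).
    split; first exact: idadd_ideal.
      by move=> d /IM; apply: idadd_l.
    by move=> d Md Sd; apply: noS; exists d.
  have /(_ _)/asboolP := maxM (exist _ _ gMc); apply => /=.
    by apply/asboolP => d; apply: idadd_l.
  by apply/idadd1; exists 1; rewrite mul1r subrr; case: iM.
have [d Sd /idadd1[u Md]] := meet _ Ma; have [e Se /idadd1[v Me]] := meet _ Mb.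
apply: (MS _ _ (SM _ _ Sd Se)); case: (iM) => _ iDl iMl.
have -> : d * e = (d - u * a) * e + u * a * (e - v * b) + u * v * (a * b) by ring.
apply: (iDl); last exact: iMl.
by apply: iDl; [exact: ideal_mulr | exact: iMl].
Qed.

(** The elements b a^k with b outside P form a multiplicative set; a prime that
    avoids it lies inside P and misses a. The last hypothesis holds as soon as a
    is a nonzerodivisor modulo I. *)
Lemma prime_below I P a : is_ideal I -> prime_ideal P -> sub_ideal I P -> P a ->
    (forall b k, ~ P b -> ~ I (b * a ^+ k)) ->
  exists Q, [/\ prime_ideal Q, sub_ideal I Q, sub_ideal Q P & ~ Q a].
Proof.
move=> iI [iP P1 Pp] IP Pa nzd.
pose S b := exists (c : L) k, ~ P c /\ b = c * a ^+ k.
have S1 : S 1 by exists 1, 0%N; rewrite mulr1.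
have [||Q [pQ IQ QS]] := @prime_avoiding I S iI S1.
- move=> _ _ [s [k [Ps ->]]] [t [l [Pt ->]]]; exists (s * t), (k + l)%N; split.
    by case/Pp.
  by rewrite exprD; ring.
- by move=> b Ib [s [k [Ps eq_b]]]; move: Ib; rewrite eq_b; apply: nzd.
exists Q; split=> // [b Qb|Qa].
  apply: contrapT => Pb; apply: (QS b) => //; exists b, 0%N; split=> //.
  by rewrite mulr1.
by apply: (QS a) => //; exists 1, 1%N; rewrite mul1r expr1; split.
Qed.

Lemma regular_cons I a s : is_ideal I -> regular_seq I (a :: s) ->
  (forall b, I (a * b) -> I b) /\ regular_seq (idadd I [:: a]) s.
Proof.
move=> iI [reg non1]; split.
  by move=> b Iab; have := reg 0%N isT b; rewrite /= !idadd_nil //; apply.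
split=> [i lt_i b /(idadd_cons _ _ _ iI) Iab|/(idadd_cons _ _ _ iI)//].
by apply/(idadd_cons _ _ _ iI); apply: (reg i.+1).
Qed.

(** Depth is at most dimension: given a chain of primes over I + (a), with a a
    nonzerodivisor modulo I, its smallest member contains a prime over I that
    avoids a. *)
Lemma regular_chain I s : is_ideal I -> regular_seq I s ->
  has_chain (fun P => prime_ideal P /\ sub_ideal I P) (size s).
Proof.
elim: s I => [|a s IHs] I iI reg.
  have [||Q [pQ IQ _]] := @prime_avoiding I (fun a => a = 1) iI erefl.
  - by move=> _ _ -> ->; rewrite mulr1.
  - by move=> b Ib b1; case: reg => _; apply; apply: idadd_l; rewrite -b1.
  by exists (fun=> Q).
have [nzd regs] := regular_cons iI reg.
have [p [pP pS]] := IHs _ (idadd_ideal [:: a] iI) regs.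
have [pr0 sub0] := pP 0%N isT.
have I0 b : I b -> p 0%N b by move=> Ib; apply: sub0; apply: idadd_l.
have p0a : p 0%N a.
  apply: sub0; apply: idadd_r => //; exact: (idgen_mem (mem_head _ _)).
have [|Q [pQ IQ Qp Qa]] := @prime_below I (p 0%N) a iI pr0 I0 p0a.
  move=> t k nt; elim: k => [|k IHk]; first by rewrite mulr1 => /I0.
  by rewrite exprS mulrCA => /nzd.
apply: (@has_chain_cons _ _ _ p Q) => //.
- by move=> i /pP[pPi sPi]; split=> // b Ib; apply: sPi; apply: idadd_l.
- by move=> /(_ a p0a).
Qed.

End IdealTheory.

(** * Homogeneous ideals and substitutions *)

Section Homogeneous.
Variable K : fieldType.
Local Notation R := {mpoly K[4]}.
Implicit Types (I J P Q : R -> Prop) (p q a b f : R) (d e : nat) (s : seq R).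

Lemma pihomog_sum p : p = \sum_(d < msize p) pihomog mdeg d p.
Proof. exact: pihomog_partitionE. Qed.

Lemma pihomog_big n p : (msize p <= n)%N -> pihomog mdeg n p = 0.
Proof.
move=> le_pn; rewrite pihomogE big_seq_cond big_pred0 // => m.
apply/negP => /andP[/msize_mdeg_lt lt_m /eqP eq_m].
by move: lt_m; rewrite ltnNge eq_m le_pn.
Qed.

Lemma pihomogMl d b n a : b \is d.-homog ->
  pihomog mdeg n (b * a) = if (d <= n)%N then b * pihomog mdeg (n - d) a else 0.
Proof.
move=> hb; have hba i : b * pihomog mdeg i a \is (d + i).-homog.
  by apply: dhomogM => //; apply: pihomogP.
have -> : pihomog mdeg n (b * a) =
    \sum_(i < msize a) if (d + i == n)%N then b * pihomog mdeg i a else 0.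
  rewrite {1}[a]pihomog_sum mulr_sumr raddf_sum; apply: eq_bigr => i _.
  case: eqP => [<-|/eqP ne]; first exact: pihomog_dE.
  exact: pihomog_ne0 (hba i).
case: leqP => [le_dn|lt_nd]; last by rewrite big1 // => i _; case: eqP => //; lia.
have [lt_n|ge_n] := ltnP (n - d) (msize a).
  rewrite (bigD1 (Ordinal lt_n)) //= subnKC // eqxx big1 ?addr0 // => i.
  by rewrite -val_eqE /=; case: (_ =P n) => // <-; rewrite addKn eqxx.
rewrite big1 => [|i _]; last by case: eqP => // eq_n; move: (ltn_ord i); lia.
by rewrite pihomog_big // mulr0.
Qed.

Lemma pihomogM_homog d b n a :
  b \is d.-homog -> pihomog mdeg (d + n) (b * a) = b * pihomog mdeg n a.
Proof. by move=> hb; rewrite (pihomogMl _ _ hb) leq_addr addKn. Qed.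

Lemma homog_ideal_idgen s :
  (forall a, a \in s -> exists d, a \is d.-homog) -> homog_ideal (idgen s).
Proof.
move=> hs p n [c ->]; rewrite raddf_sum /=; have igs := idgen_ideal s.
apply: ideal_sum => // i _.
have mem_si := mem_nth 0 (ltn_ord i); have [d hsi] := hs _ mem_si.
rewrite mulrC (pihomogMl _ _ hsi); case: ifP => _; last by case: igs.
by apply: ideal_mulr => //; apply: idgen_mem.
Qed.

Lemma homog_ideal_idadd I s : homog_ideal I -> is_ideal I ->
  (forall a, a \in s -> exists d, a \is d.-homog) -> homog_ideal (idadd I s).
Proof.
move=> hI iI hs p n [q Iq sq]; exists (pihomog mdeg n q); first exact: hI.
by rewrite -raddfB; apply: homog_ideal_idgen.
Qed.

Lemma ideal_homogP I p :
  is_ideal I -> (forall d, I (pihomog mdeg d p)) -> I p.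
Proof. by move=> iI Ip; rewrite [p]pihomog_sum; apply: ideal_sum. Qed.

Lemma homog_sub I Q : is_ideal Q -> homog_ideal I ->
  (forall d a, a \is d.-homog -> I a -> Q a) -> sub_ideal I Q.
Proof.
move=> iQ hI IQ a Ia; apply: ideal_homogP => // d.
by apply: (IQ d); [apply: pihomogP | apply: hI].
Qed.

(** The largest homogeneous ideal contained in the ideal I. *)
Definition homcore I : R -> Prop := fun p => forall d, I (pihomog mdeg d p).

Lemma homcoreE I d a : is_ideal I -> a \is d.-homog -> homcore I a <-> I a.
Proof.
move=> [i0 _ _] ha; split=> [/(_ d)|Ia e]; first by rewrite pihomog_dE.
have [<-|ne] := eqVneq d e; first by rewrite pihomog_dE.
by rewrite (pihomog_ne0 ne).
Qed.

Lemma homcore_ideal I : is_ideal I -> is_ideal (homcore I).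
Proof.
move=> iI; case: (iI) => i0 iD iM; split.
- by move=> d; rewrite raddf0.
- by move=> a b Ia Ib d; rewrite raddfD; apply: iD; [apply: Ia | apply: Ib].
- move=> a b Ib d; rewrite [a]pihomog_sum mulr_suml raddf_sum /=.
  by apply: ideal_sum => // i _; rewrite (pihomogMl _ _ (pihomogP _ _ _)); case: ifP => // _; apply: iM; apply: Ib.
Qed.

Lemma homcore_homog I : is_ideal I -> homog_ideal (homcore I).
Proof.
move=> [i0 _ _] p d Ip e; have hp := pihomogP mdeg d p.
have [<-|ne] := eqVneq d e; first by rewrite pihomog_dE.
by rewrite (pihomog_ne0 ne).
Qed.

Lemma homcore_sub I : is_ideal I -> sub_ideal (homcore I) I.
Proof. by move=> iI a; apply: ideal_homogP. Qed.

Lemma sub_homcore I J : homog_ideal J -> sub_ideal J I -> sub_ideal J (homcore I).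
Proof. by move=> hJ JI a Ja d; apply: JI; apply: hJ. Qed.

(** If neither a nor b is in the homogeneous core of a prime P, the product of
    their lowest homogeneous parts outside P is, up to P, a homogeneous part of
    a b. *)
Lemma homcore_prime P : prime_ideal P -> prime_ideal (homcore P).
Proof.
move=> [iP P1 Pp]; case: (iP) => p0 pD pM; split; first exact: homcore_ideal.
  by move/(homcore_sub iP).
move=> a b Pab; apply: contrapT => nab.
have low c : ~ homcore P c ->
    exists i, ~ P (pihomog mdeg i c) /\ forall j, (j < i)%N -> P (pihomog mdeg j c).
  move=> nc; have /asboolPn/existsp_asboolPn/= [i0 ni0] := nc.
  have ex : exists i, ~~ `[< P (pihomog mdeg i c) >] by exists i0; apply/asboolPn.
  exists (ex_minn ex); case: ex_minnP => i /asboolPn ni mini; split=> // j lt_ji.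
  by apply: contrapT => /asboolPn/mini; rewrite leqNgt lt_ji.
have [|i [nai lowa]] := low a; first by move=> ha; apply: nab; left.
have [|j [nbj lowb]] := low b; first by move=> hb; apply: nab; right.
have /Pp[] // : P (pihomog mdeg i a * pihomog mdeg j b).
have := Pab (i + j)%N; rewrite {1}[a]pihomog_sum mulr_suml raddf_sum /=.
under eq_bigr => k _ do rewrite (pihomogMl _ _ (pihomogP _ _ _)).
have [lt_i|ge_i] := ltnP i (msize a); last first.
  by case: nai; rewrite pihomog_big.
rewrite (bigD1 (Ordinal lt_i)) //= leq_addr addKn.
move=> Psum; rewrite -[X in P X](addrK (\sum_(k < msize a | k != Ordinal lt_i)
   (if (k <= i + j)%N then pihomog mdeg k a * pihomog mdeg (i + j - k) b else 0))).
apply: ideal_sub => //; apply: ideal_sum => // k; rewrite -val_eqE /= => ne_ki.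
case: ifP => // le_k; have [lt_ki|lt_ik] := ltnP k i.
  by apply: ideal_mulr => //; apply: lowa.
by apply: pM; apply: lowb; lia.
Qed.

(** Passing to the homogeneous core of the prime given by [prime_below] loses
    nothing, because J and a are homogeneous. *)
Lemma homog_prime_below J P a d : is_ideal J -> homog_ideal J -> is_projpt P ->
    sub_ideal J P -> a \is d.-homog -> P a ->
    (forall b k, ~ P b -> ~ J (b * a ^+ k)) ->
  exists Q, [/\ is_projpt Q, sub_ideal J Q, sub_ideal Q P & ~ Q a].
Proof.
move=> iJ hJ [pP hP rP] JP ha Pa nzd.
have [Q [pQ JQ QP Qa]] := prime_below iJ pP JP Pa nzd.
have iQ : is_ideal Q by case: pQ.
have QP' : sub_ideal (homcore Q) P by move=> b /(homcore_sub iQ)/QP.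
exists (homcore Q); split=> //.
- split; [exact: homcore_prime | exact: homcore_homog |].
  by move=> irrQ; apply: rP => b /irrQ/QP'.
- exact: sub_homcore.
- by move/(homcoreE iQ ha).
Qed.

End Homogeneous.

Section Substitution.
Variable K : fieldType.
Local Notation R := {mpoly K[4]}.
Implicit Types (I : R -> Prop) (p q a b : R) (s : seq R) (w : 4.-tuple R).

Lemma subst_congr I w p : is_ideal I -> (forall i, I ('X_i - tnth w i)) ->
  I (p - (p \mPo w)).
Proof.
move=> iI Iw; case: (iI) => i0 iD iM.
have congrM a b a' b' : I (a - a') -> I (b - b') -> I (a * b - a' * b').
  move=> Ia Ib; have -> : a * b - a' * b' = b * (a - a') + a' * (b - b') by ring.
  by apply: iD; apply: iM.
elim/mpolyind: p => [|c m p _ _ IHp]; first by rewrite raddf0 subrr.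
rewrite comp_mpolyD comp_mpolyZ opprD addrACA; apply: iD => //.
rewrite -scalerBr -mul_mpolyC; apply: iM.
rewrite comp_mpolyX [X in X - _]mpolyXE_id.
elim/big_ind2: _ => [|a a' b b' Ia Ib|i _]; [by rewrite subrr | exact: congrM |].
elim: (m i) => [|k IHk]; first by rewrite subrr.
by rewrite !exprS; apply: congrM.
Qed.

(** Modulo an ideal containing all X_i - w_i, a polynomial is congruent to its
    image under the substitution w. All the primes generated by linear forms
    below are recognized as kernels in this way. *)
Lemma idgen_kernel s w :
    (forall i, idgen s ('X_i - tnth w i)) -> (forall l, l \in s -> l \mPo w = 0) ->
  forall p, idgen s p <-> p \mPo w = 0.
Proof.
move=> sw w0 p; split=> [[c ->]|pw].
  rewrite raddf_sum /= big1 // => i _; rewrite rmorphM /= [s`_i \mPo w]w0 ?mulr0 //.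
  exact: mem_nth.
by have := subst_congr p (idgen_ideal s) sw; rewrite pw subr0.
Qed.

Lemma kernel_prime s w : (forall p, idgen s p <-> p \mPo w = 0) ->
  prime_ideal (idgen s).
Proof.
move=> kerw; split; first exact: idgen_ideal.
  by move/kerw/eqP; rewrite rmorph1 oner_eq0.
by move=> a b /kerw/eqP; rewrite rmorphM mulf_eq0 => /orP[]/eqP/kerw; [left|right].
Qed.

Lemma subst_free p w :
  (forall m i, m \in msupp p -> m i != 0%N -> tnth w i = 'X_i) -> p \mPo w = p.
Proof.
move=> pw; rewrite comp_mpolyEX [RHS]mpolyE big_seq [RHS]big_seq.
apply: eq_bigr => m pm; congr (_ *: _); rewrite comp_mpolyX mpolyXE_id.
apply: eq_bigr => i _; have [->//|mi] := eqVneq (m i) 0%N.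
by rewrite (pw m).
Qed.

End Substitution.

(** * Primes of the local rings of projective space *)

Section Stalk.
Variable K : fieldType.
Local Notation R := {mpoly K[4]}.
Local Notation "x %:F" := (@FracField.tofrac R x).
Implicit Types (I J Q : R -> Prop) (a b s t : R) (d e : nat) (P : projpt K).

Lemma irrelevant_sub I : is_ideal I -> (forall i, I 'X_i) -> sub_ideal (@irrelevant K) I.
Proof.
move=> iI Ivar; apply: idgen_sub => // b; rewrite !inE.
by do 3 ?[case/orP]; move/eqP->.
Qed.

Lemma irrelevant_var i : @irrelevant K 'X_i.
Proof.
apply: idgen_mem; rewrite !inE; case: i => -[|[|[|[|//]]]] lt4.
- by apply/orP; left; rewrite (_ : Ordinal lt4 = ix) //; apply: val_inj.
- by rewrite (_ : Ordinal lt4 = iy) ?eqxx ?orbT //; apply: val_inj.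
- by rewrite (_ : Ordinal lt4 = iz) ?eqxx ?orbT //; apply: val_inj.
- by rewrite (_ : Ordinal lt4 = it) ?eqxx ?orbT //; apply: val_inj.
Qed.

Lemma projpt_var Q : is_projpt Q -> exists v, ~ Q 'X_v.
Proof.
case=> [[iQ _ _] _ rQ]; apply: contrapT => nov; apply: rQ.
by apply: irrelevant_sub => // i; apply: contrapT => nQ; apply: nov; exists i.
Qed.

Lemma homog_var i : ('X_i : R) \is 1.-homog.
Proof. by rewrite dhomogX /= mdeg1. Qed.

Lemma homog_varX i d : ('X_i ^+ d : R) \is d.-homog.
Proof. by rewrite -[X in X.-homog]mul1n; apply: dhomogMn; apply: homog_var. Qed.

Lemma prime_exp (L : comNzRingType) (p : L -> Prop) (a : L) k :
  prime_ideal p -> ~ p a -> ~ p (a ^+ k).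
Proof.
by move=> [_ p1 pp] pa; elim: k => [|k IHk]; [rewrite expr0 | rewrite exprS => /pp[]].
Qed.

Lemma stalk_repr P (f : stalk P) : exists a s d,
  [/\ a \is d.-homog, s \is d.-homog, ~ P s & val f = a%:F / s%:F].
Proof. by have /asboolP := valP f. Qed.

Lemma stalk_exists P a s d : a \is d.-homog -> s \is d.-homog -> ~ P s ->
  exists f : stalk P, val f = a%:F / s%:F.
Proof.
move=> ha hs Ps; have mem : a%:F / s%:F \in stalk_pred P.
  by apply/asboolP; exists a, s, d.
by exists (Stalk mem).
Qed.

Lemma tofrac_div_eq a s b t : s%:F != 0 -> t%:F != 0 ->
  a%:F / s%:F = b%:F / t%:F -> a * t = b * s.
Proof.
move=> s0 t0 /eqP; rewrite (eqr_div _ _ s0 t0) => /eqP eq_at.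
apply/eqP; rewrite -tofrac_eq; apply/eqP.
by rewrite [LHS]tofracM [RHS]tofracM.
Qed.

Lemma stalk_idealE J P (f : stalk P) a s d : is_ideal J ->
    a \is d.-homog -> s \is d.-homog -> ~ P s -> val f = a%:F / s%:F ->
  stalk_ideal J f <-> exists t e, [/\ t \is e.-homog, ~ P t & J (t * a)].
Proof.
move=> iJ ha hs Ps eq_f; split=> [[b [t [e [Jb hb ht Pt]]]]|[t [e [ht Pt Jta]]]].
  rewrite eq_f => eq_ab; have eq_at := tofrac_div_eq (projpt_neq0 Ps) (projpt_neq0 Pt) eq_ab.
  exists t, e; split=> //; rewrite mulrC eq_at; exact: ideal_mulr.
exists (t * a), (t * s), (e + d)%N; split=> //; try exact: dhomogM.
  exact: projptM.
by rewrite eq_f !tofracM invfM mulrACA divff ?mul1r //; exact: projpt_neq0 Pt.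
Qed.

Lemma stalk_ideal_ideal J P : is_ideal J -> is_ideal (@stalk_ideal K J P).
Proof.
move=> iJ; case: (iJ) => J0 JD JM; split.
- exists 0, 1, 0%N; split; rewrite ?dhomog1 ?dhomog0 //.
    by case: (projptP P) => [[]].
  by rewrite tofrac0 mul0r.
- move=> f g [a [s [d [Ja ha hs Ps eq_f]]]] [b [t [e [Jb hb ht Pt eq_g]]]].
  exists (a * t + b * s), (s * t), (d + e)%N; split.
  + by apply: JD; apply: ideal_mulr.
  + by apply: rpredD; [exact: dhomogM | rewrite addnC; exact: dhomogM].
  + exact: dhomogM.
  + exact: projptM.
  + rewrite rmorphD /= eq_f eq_g !(rmorphD, rmorphM) /= addf_div //.
      exact: projpt_neq0 Ps.
    exact: projpt_neq0 Pt.
- move=> f g [b [t [e [Jb hb ht Pt eq_g]]]].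
  have [a [s [d [ha hs Ps eq_f]]]] := stalk_repr f.
  exists (a * b), (s * t), (d + e)%N; split.
  + exact: JM.
  + exact: dhomogM.
  + exact: dhomogM.
  + exact: projptM.
  + by rewrite rmorphM /= eq_f eq_g !rmorphM /= mulf_div.
Qed.

Lemma stalk_ideal_sub J Q P : sub_ideal J Q -> sub_ideal (@stalk_ideal K J P) (@stalk_ideal K Q P).
Proof.
by move=> JQ f [a [s [d [Ja ha hs Ps eq_f]]]]; exists a, s, d; split=> //; apply: JQ.
Qed.

Section Primes.
Variables (Q : R -> Prop) (P : projpt K).
Hypotheses (pQ : prime_ideal Q) (QP : sub_ideal Q P).

Lemma stalk_primeE (f : stalk P) a s d :
    a \is d.-homog -> s \is d.-homog -> ~ P s -> val f = a%:F / s%:F ->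
  stalk_ideal Q f <-> Q a.
Proof.
move=> ha hs Ps eq_f; case: (pQ) => iQ Q1 Qp.
rewrite (stalk_idealE iQ ha hs Ps eq_f); split=> [[t [e [_ Pt /Qp[]//]]]|Qa].
  by move/QP.
exists 1, 0%N; split; rewrite ?dhomog1 ?mul1r //.
by case: (projptP P) => [[]].
Qed.

Lemma stalk_prime : prime_ideal (@stalk_ideal K Q P).
Proof.
case: (pQ) => iQ Q1 Qp; case: (projptP P) => [[_ P1 _] _ _].
split; first exact: stalk_ideal_ideal.
  move/(stalk_primeE (dhomog1 _ _) (dhomog1 _ _) P1) => H; apply: Q1; apply: H.
  by rewrite tofrac1 divr1.
move=> f g; have [a [s [d [ha hs Ps eq_f]]]] := stalk_repr f.
have [b [t [e [hb ht Pt eq_g]]]] := stalk_repr g.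
rewrite (stalk_primeE ha hs Ps eq_f) (stalk_primeE hb ht Pt eq_g).
move/(stalk_primeE (dhomogM ha hb) (dhomogM hs ht) (projptM Ps Pt)) => H; apply: Qp.
by apply: H; rewrite rmorphM /= eq_f eq_g !tofracM mulf_div.
Qed.

End Primes.

Lemma stalk_prime_strict Q Q' P : prime_ideal Q -> prime_ideal Q' -> homog_ideal Q' ->
    sub_ideal Q P -> sub_ideal Q' P -> ~ sub_ideal Q' Q ->
  ~ sub_ideal (@stalk_ideal K Q' P) (@stalk_ideal K Q P).
Proof.
move=> pQ pQ' hQ' QP QP' ns sub; apply: ns.
have iQ : is_ideal Q by case: pQ.
apply: homog_sub => // d a ha Qa; have [v Pv] := projpt_var (projptP P).
have nPv : ~ P ('X_v ^+ d) by apply: prime_exp => //; case: (projptP P).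
have [f eq_f] := stalk_exists ha (homog_varX v d) nPv.
apply/(stalk_primeE pQ QP ha (homog_varX v d) nPv eq_f); apply: sub.
by apply/(stalk_primeE pQ' QP' ha (homog_varX v d) nPv eq_f).
Qed.

End Stalk.
Arguments homog_var {K} i.
Arguments homog_varX {K} i d.

(** The primes of the local ring at P come from homogeneous primes inside P:
    dividing by powers of a variable v that does not vanish at P gives a ring
    morphism from the polynomial ring to the local ring, along which primes are
    pulled back, then replaced by their homogeneous cores. *)
Section StalkContraction.
Variables (K : fieldType) (P : projpt K) (v : 'I_4).
Local Notation R := {mpoly K[4]}.
Local Notation "x %:F" := (@FracField.tofrac R x).
Hypothesis Pv : ~ P 'X_v.
Implicit Types (J : R -> Prop) (a b : R) (d : nat) (p q : stalk P -> Prop).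

Definition dehomog : R -> {fraction R} :=
  mmap (@FracField.tofrac R \o @mpolyC 4 K) (fun i : 'I_4 => ('X_i)%:F / ('X_v)%:F).

Let Pvd d : ~ P ('X_v ^+ d).
Proof. by apply: prime_exp => //; case: (projptP P). Qed.

Lemma dehomog_homog d a : a \is d.-homog -> dehomog a = a%:F / ('X_v ^+ d)%:F.
Proof.
move=> /dhomogP ha; rewrite /dehomog /mmap [in RHS](mpolyE a) rmorph_sum mulr_suml.
rewrite big_seq [RHS]big_seq; apply: eq_bigr => m am; have := ha m am => <-.
rewrite -mul_mpolyC rmorphM -mulrA /=; congr (_ * _).
rewrite /mmap1 [in RHS](mpolyXE_id _ m) mdegE -prodrXr !rmorph_prod /= -prodf_div.
by apply: eq_bigr => i _; rewrite expr_div_n !rmorphXn.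
Qed.

Lemma dehomog_stalk a : dehomog a \in stalk_pred P.
Proof.
rewrite [a]pihomog_sum /dehomog rmorph_sum /=; apply: rpred_sum => i _.
rewrite -/(dehomog _).
have ha := pihomogP mdeg i a; rewrite (dehomog_homog ha).
by apply/asboolP; exists (pihomog mdeg i a), ('X_v ^+ i), i; split=> //; apply: homog_varX.
Qed.

Definition to_stalk a : stalk P := Stalk (dehomog_stalk a).

Definition stalk_contr p : R -> Prop := homcore (fun a => p (to_stalk a)).

Lemma contr_prime p : prime_ideal p -> prime_ideal (fun a => p (to_stalk a)).
Proof.
move=> [[p0 pD pM] p1 pp]; split; first split.
- by rewrite (_ : to_stalk 0 = 0) //; apply: val_inj; rewrite /= /dehomog rmorph0.
- move=> a b pa pb; rewrite (_ : to_stalk (a + b) = to_stalk a + to_stalk b); first exact: pD.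
  by apply: val_inj; rewrite /= /dehomog rmorphD.
- move=> a b pb; rewrite (_ : to_stalk (a * b) = to_stalk a * to_stalk b); first exact: pM.
  by apply: val_inj; rewrite /= /dehomog rmorphM.
- by rewrite (_ : to_stalk 1 = 1) //; apply: val_inj; rewrite /= /dehomog rmorph1.
- move=> a b; rewrite (_ : to_stalk (a * b) = to_stalk a * to_stalk b); first exact: pp.
  by apply: val_inj; rewrite /= /dehomog rmorphM.
Qed.

Lemma stalk_contr_prime p : prime_ideal p -> prime_ideal (stalk_contr p).
Proof. by move/contr_prime/homcore_prime. Qed.

Lemma stalk_contrE p (f : stalk P) a s d : prime_ideal p ->
    a \is d.-homog -> s \is d.-homog -> ~ P s -> val f = a%:F / s%:F ->
  stalk_contr p a <-> p f.
Proof.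
move=> pp ha hs Ps eq_f; have [ip _ _] := contr_prime pp.
rewrite /stalk_contr (homcoreE ip ha); have [[_ _ pM] _ _] := pp.
have [g eq_g] := stalk_exists (homog_varX v d) hs Ps.
have [g' eq_g'] := stalk_exists hs (homog_varX v d) (@Pvd d).
have s0 := projpt_neq0 Ps; have v0 := projpt_neq0 (@Pvd d).
split=> [pa|pf].
  rewrite (_ : f = g * to_stalk a); first exact: pM.
  apply: val_inj; rewrite rmorphM /= (dehomog_homog ha) eq_f eq_g [RHS]mulrC.
  by rewrite mulrA (divfK v0).
rewrite (_ : to_stalk a = g' * f); first exact: pM.
apply: val_inj; rewrite rmorphM /= (dehomog_homog ha) eq_f eq_g' [RHS]mulrC.
by rewrite mulrA (divfK s0).
Qed.

Lemma stalk_contr_sub p : prime_ideal p -> sub_ideal (stalk_contr p) P.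
Proof.
move=> pp; have [_ p1 _] := pp; have [iP P1 Pp] : prime_ideal P by case: (projptP P).
apply: homog_sub => //; first by apply: homcore_homog; have [] := contr_prime pp.
move=> d a ha pa; apply: contrapT => Pa; apply: p1.
apply/(stalk_contrE pp ha ha Pa) => //.
by rewrite (divff (projpt_neq0 Pa)).
Qed.

Lemma stalk_contr_projpt p : prime_ideal p -> is_projpt (stalk_contr p).
Proof.
move=> pp; split; first exact: stalk_contr_prime.
  by apply: homcore_homog; have [] := contr_prime pp.
move=> irrp; have [_ _ irrP] := projptP P; apply: irrP => a /irrp.
exact: stalk_contr_sub.
Qed.

Lemma sub_stalk_contr J p : homog_ideal J -> prime_ideal p ->
  sub_ideal (@stalk_ideal K J P) p -> sub_ideal J (stalk_contr p).
Proof.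
move=> hJ pp Jp; apply: homog_sub => //; first by have [] := stalk_contr_prime pp.
move=> d a ha Ja; have [f eq_f] := stalk_exists ha (homog_varX v d) (@Pvd d).
apply/(stalk_contrE pp ha (homog_varX v d) (@Pvd d) eq_f); apply: Jp.
by exists a, ('X_v ^+ d), d; split=> //; apply: homog_varX.
Qed.

Lemma stalk_contr_le p q : prime_ideal p -> prime_ideal q ->
  sub_ideal (stalk_contr p) (stalk_contr q) <-> sub_ideal p q.
Proof.
move=> pp pq; split=> [pq' f pf|pq' a pa d].
  have [a [s [d [ha hs Ps eq_f]]]] := stalk_repr f.
  apply/(stalk_contrE pq ha hs Ps eq_f); apply: pq'.
  exact/(stalk_contrE pp ha hs Ps eq_f).
by apply: pq'; apply: pa.
Qed.

End StalkContraction.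

Section StalkDim.
Variables (K : fieldType) (P : projpt K) (J : {mpoly K[4]} -> Prop).
Hypotheses (iJ : is_ideal J) (hJ : homog_ideal J) (JP : sub_ideal J P).

(** Contraction preserves strict inclusions, because an element of the local
    ring is a unit times the image of its numerator. *)
Lemma stalk_chain n :
    has_chain (fun p => prime_ideal p /\ sub_ideal (@stalk_ideal K J P) p) n ->
  has_chain (fun Q => on_proj J Q /\ sub_ideal Q P) n.
Proof.
have [v Pv] := projpt_var (projptP P).
case=> p [pP pS]; exists (fun i => stalk_contr Pv (p i)); split=> i le_in.
  have [pi Ji] := pP i le_in; split; last exact: stalk_contr_sub.
  by split; [exact: stalk_contr_projpt | exact: sub_stalk_contr].
have [pi Ji] := pP i (ltnW le_in); have [pi1 Ji1] := pP _ le_in.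
have [sub nsub] := pS i le_in.
by split; [exact/stalk_contr_le | move/stalk_contr_le => H; apply: nsub; apply: H].
Qed.

Lemma stalk_chain0 :
  has_chain (fun p => prime_ideal p /\ sub_ideal (@stalk_ideal K J P) p) 0.
Proof.
exists (fun=> @stalk_ideal K P P); split=> // i _; split; last exact: stalk_ideal_sub.
by apply: stalk_prime => //; case: (projptP P).
Qed.

Lemma stalk_chain1 Q : on_proj J Q -> sub_ideal Q P -> ~ sub_ideal P Q ->
  has_chain (fun p => prime_ideal p /\ sub_ideal (@stalk_ideal K J P) p) 1.
Proof.
move=> [[pQ hQ rQ] JQ] QP nPQ; have [pP hP rP] := projptP P.
apply: (@has_chain_cons _ _ 0 (fun=> @stalk_ideal K P P) (@stalk_ideal K Q P)) => //.
- move=> i _; split; [exact: stalk_prime | exact: stalk_ideal_sub].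
- by split; [exact: stalk_prime | exact: stalk_ideal_sub].
- exact: stalk_ideal_sub.
- exact: stalk_prime_strict.
Qed.

(** Since depth never exceeds dimension, a regular sequence as long as the
    dimension is all that is needed. *)
Lemma stalk_cohen_macaulay n s : krull_dim (@stalk_ideal K J P) n -> size s = n ->
  regular_seq (@stalk_ideal K J P) s -> cohen_macaulay (@stalk_ideal K J P).
Proof.
move=> dim_n sz reg; exists n; split=> //; split; first by exists s.
case=> t szt regt; case: dim_n => _; apply; rewrite -szt.
by apply: regular_chain => //; apply: stalk_ideal_ideal.
Qed.

End StalkDim.

(** * Hilbert functions *)

Section HilbertFunction.
Variable K : fieldType.
Local Notation R := {mpoly K[4]}.
Local Notation V n := (dhomog 4 K n).
Implicit Types (I J P : R -> Prop) (p q a : R) (d e n : nat).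

Lemma ideal_scale I c p : is_ideal I -> I p -> I (c *: p).
Proof. by case=> _ _ IM Ip; rewrite -mul_mpolyC; apply: IM. Qed.

(** A subspace of maximal dimension among those contained in I is the degree n
    part of I: adding a further element of I would enlarge it. *)
Lemma ideal_piece I n : is_ideal I -> exists U : {vspace V n}, forall p : V n, p \in U <-> I (val p).
Proof.
move=> iI; case: (iI) => I0 ID IM.
pose sz k := `[< exists U : {vspace V n}, (forall p : V n, p \in U -> I (val p)) /\ \dim U = k >].
have ex_sz : exists k, sz k.
  exists 0%N; apply/asboolP; exists 0%VS; split; last exact: dimv0.
  by move=> p; rewrite memv0 => /eqP->.
have sz_le k : sz k -> (k <= dim (V n))%N.
  by move=> /asboolP[U [_ <-]]; rewrite -dimvf; apply/dimvS/subvf.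
case: (ex_maxnP ex_sz sz_le) => _ /asboolP[U [UI <-]] maxU.
exists U => p; split=> [/UI//|Ip].
have : sz (\dim (U + <[p]>)%VS).
  apply/asboolP; exists (U + <[p]>)%VS; split=> // q /memv_addP[u Uu [_ /vlineP[c ->] ->]].
  by rewrite raddfD /=; apply: ID; [apply: UI | apply: ideal_scale].
move=> /maxU le_dim; have /eqP-> : U == (U + <[p]>)%VS by rewrite eqEdim addvSl.
by rewrite -[p in p \in _]add0r memv_add ?mem0v ?memv_line.
Qed.

Definition piece I n : {vspace V n} :=
  if pselect (exists U : {vspace V n}, forall p : V n, p \in U <-> I (val p)) is left ex
  then projT1 (cid ex) else 0%VS.

(** The dimension of the degree n part of R/I. *)
Definition hf I n : nat := (dim (V n) - \dim (piece I n))%N.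

Lemma pieceP I n (p : V n) : is_ideal I -> p \in piece I n <-> I (val p).
Proof.
move=> iI; rewrite /piece; case: pselect => [ex|[]]; last exact: ideal_piece.
by case: (cid ex).
Qed.

Lemma hf_add I n : (hf I n + \dim (piece I n) = dim (V n))%N.
Proof. by rewrite /hf subnK // -dimvf; apply/dimvS/subvf. Qed.

Lemma dim_dhomog n : dim (V n) = 'C(n + 3, 3).
Proof. by rewrite -bin_sub ?leq_addl // addnK. Qed.

Lemma hf_ext I J n : (forall p, I p <-> J p) -> hf I n = hf J n.
Proof. by move=> eqIJ; congr hf; apply/funext => p; apply/propext. Qed.

Lemma hf_sub I J n : is_ideal I -> is_ideal J -> sub_ideal I J -> (hf J n <= hf I n)%N.
Proof.
move=> iI iJ IJ; apply: leq_sub2l; apply: dimvS; apply/subvP => p.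
by move/(pieceP _ iI)/IJ/(pieceP _ iJ).
Qed.

Lemma hf_gt0 I n a : is_ideal I -> a \is n.-homog -> ~ I a -> (0 < hf I n)%N.
Proof.
move=> iI ha Ia; rewrite lt0n; apply/eqP => hf0; apply: Ia.
suff: (DHomog ha : V n) \in piece I n by move/(pieceP _ iI).
have -> : piece I n = fullv; last exact: memvf.
by apply/eqP; rewrite eqEdim subvf dimvf -(hf_add I n) hf0 add0n leqnn.
Qed.

Section Multiplication.
Variables (a : R) (e : nat) (ha : a \is e.-homog) (n : nat).

Definition mulh (p : V n) : V (e + n) :=
  DHomog (dhomogM ha (dhomog_is_dhomog p)).

Lemma mulh_is_linear : linear mulh.
Proof.
move=> c p q; apply: val_inj => /=.
by rewrite -!mul_mpolyC mulrDr mulrCA.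
Qed.

HB.instance Definition _ := GRing.isLinear.Build K (V n) (V (e + n)) _ mulh mulh_is_linear.

(** Additivity along 0 -> R/(I:a)(-e) -> R/I -> R/(I+(a)) -> 0. *)
Lemma hf_exact I : is_ideal I -> homog_ideal I ->
  (hf I (e + n) = hf (fun p => I (a * p)%R) n + hf (idadd I [:: a]) (e + n))%N.
Proof.
move=> iI hI; case: (iI) => I0 ID IM; pose C p := I (a * p).
have iC : is_ideal C.
  split; first by rewrite /C mulr0.
    by move=> p q; rewrite /C mulrDr; apply: ID.
  by move=> p q; rewrite /C mulrCA; apply: IM.
have iIa : is_ideal (idadd I [:: a]) by apply: idadd_ideal.
pose m := linfun mulh; set U := piece I (e + n).
have eC : piece C n = (m @^-1: U)%VS.
  apply/vspaceP => p; apply/idP/idP.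
    by move/(pieceP _ iC) => Cp; rewrite -memv_preim lfunE; apply/(pieceP _ iI).
  by rewrite -memv_preim lfunE => /(pieceP _ iI) Cp; apply/(pieceP _ iC).
have eIa : piece (idadd I [:: a]) (e + n) = (U + limg m)%VS.
  apply/vspaceP => p; apply/idP/idP.
    move/(pieceP _ iIa)/idadd1 => [u Iu].
    pose u' : V n := DHomog (pihomogP mdeg n u).
    have Ip : I (val (p - mulh u')).
      have := hI _ (e + n)%N Iu; rewrite raddfB /= mulrC (pihomogM_homog _ _ ha).
      by rewrite pihomog_dE //; apply: dhomog_is_dhomog.
    rewrite -(subrK (mulh u') p); apply: memv_add; first exact/(pieceP _ iI).
    by rewrite -[mulh u'](lfunE mulh); apply/memv_img/memvf.
  case/memv_addP=> u /(pieceP _ iI) Iu [_ /memv_imgP[w _ ->] ->].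
  apply/(pieceP _ iIa)/idadd1; exists (val w); rewrite lfunE /=.
  by rewrite [val w * a]mulrC addrK.
have dU := hf_add I (e + n)%N; have dC := hf_add C n.
have dIa := hf_add (idadd I [:: a]) (e + n)%N.
have := dimv_sum_cap U (limg m); rewrite -eIa.
have dm : (\dim (lker m) + \dim (limg m) = dim (V n))%N.
  by rewrite -{1}[lker m]capfv (limg_ker_dim m fullv) dimvf.
have := limg_ker_dim m (piece C n).
have -> : (piece C n :&: lker m = lker m)%VS.
  apply/capv_idPr/subvP => p; rewrite memv_ker eC -memv_preim => /eqP->; exact: mem0v.
have -> : (m @: piece C n = U :&: limg m)%VS by rewrite eC -lpreim_cap_limg lpreimK // capvSr.
rewrite -/C; move: dm dU dC dIa; rewrite -/U.
have arith (k l D x u D' y pC z pIa c : nat) : (k + l = D -> x + u = D' ->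
  y + pC = D -> z + pIa = D' -> k + c = pC -> pIa + c = u + l -> x = y + z)%N by lia.
exact: arith.
Qed.

End Multiplication.
End HilbertFunction.

Section HilbertBasis.
Variable K : fieldType.
Local Notation R := {mpoly K[4]}.
Local Notation V n := (dhomog 4 K n).
Implicit Types (I : R -> Prop) (n : nat).

Lemma dim_piece_compl I n : \dim ((piece I n)^C)%VS = hf I n.
Proof. by rewrite /hf -dimvf dimv_compl. Qed.

(** The linear map from K^m to a complement of I in degree n is not injective,
    for dimension reasons. *)
Lemma hf_dependent I n m (f : 'I_m -> R) : is_ideal I ->
    (forall i, f i \is n.-homog) -> (hf I n < m)%N ->
  exists c : 'I_m -> K, (exists i, c i != 0) /\ I (\sum_i c i *: f i).
Proof.
move=> iI homf lt_m; set U := piece I n.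
pose g (c : 'rV[K]_m) : V n := \sum_i c 0 i *: DHomog (homf i).
have lin_g : linear g.
  move=> k c d; rewrite /g scaler_sumr -big_split; apply: eq_bigr => i _.
  by rewrite !mxE scalerDl scalerA.
pose gL : {linear 'rV[K]_m -> V n} := HB.pack g (GRing.isLinear.Build _ _ _ _ g lin_g).
pose phi := (daddv_pi (U^C)%VS U \o linfun gL)%VF.
have le_img : (\dim (limg phi) <= hf I n)%N.
  rewrite -dim_piece_compl; apply: dimvS; apply/subvP => _ /memv_imgP[c _ ->].
  by rewrite comp_lfunE memv_pi.
have dphi := limg_ker_dim phi fullv; rewrite capfv dimvf /= in dphi.
have ker_n0 : lker phi != 0%VS.
  have dimr : dim 'rV[K]_m = m by rewrite /dim /= mul1n.
  by rewrite -dimv_eq0; apply/eqP => ker0; move: dphi; rewrite ker0 dimr; lia.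
pose c := vpick (lker phi); exists (c 0); split.
  apply: contrapT => c0; move: ker_n0; rewrite -vpick0 => /eqP; apply.
  apply/rowP => i; rewrite mxE; apply/eqP; apply: contraT => ci.
  by case: c0; exists i.
have : phi c == 0 by rewrite -memv_ker memv_pick.
rewrite comp_lfunE lfunE /= => /eqP gc.
have gU : g c \in U.
  have capUC : (U :&: U^C)%VS = 0%VS by apply: capv_compl.
  have := daddv_pi_add (w := g c) capUC; rewrite addv_complf memvf => /(_ isT) <-.
  by rewrite gc addr0 memv_pi.
move: gU => /(pieceP _ iI); rewrite /g raddf_sum /=.
by [].
Qed.

Lemma hilbert_fun_hf I n : is_ideal I -> hilbert_fun I n (hf I n).
Proof.
move=> iI; rewrite -dim_piece_compl; set U := piece I n.
pose b := vbasis (U^C)%VS; exists (fun i => val (tnth b i)).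
have bC : basis_of (U^C)%VS b by apply: vbasisP.
have lin (c : 'I_(\dim (U^C)%VS) -> K) :
  \sum_i c i *: val (tnth b i) = val (\sum_i c i *: b`_i).
  by rewrite raddf_sum /=; apply: eq_bigr => i _; rewrite (tnth_nth 0).
split=> [i|c|p hp]; first exact: dhomog_is_dhomog.
  rewrite lin => /(pieceP _ iI) cU; apply/freeP; first exact: basis_free bC.
  apply/eqP; rewrite -memv0 -(capv_compl U) memv_cap cU /=.
  by apply: memv_suml => i _; apply: memvZ; apply: vbasis_mem; apply: mem_nth; rewrite size_tuple.
have : (DHomog hp : V n) \in (U + U^C)%VS by rewrite addv_complf memvf.
case/memv_addP => u Uu [w Cw eq_p]; exists (fun i => coord b i w).
rewrite lin -(coord_basis bC Cw).
have -> : p - val w = val u by have /(congr1 val)/= -> := eq_p; rewrite addrK.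
exact/(pieceP _ iI).
Qed.

End HilbertBasis.

(** * Binary forms *)

Section BinaryForms.
Variable K : closedFieldType.
Local Notation R := {mpoly K[4]}.
Implicit Types (l m : R) (p q : {poly K}) (e : nat).

(** The homogenization of p in degree e, evaluated at the pair (l, m). *)
Definition binary_form p e l m : R := \sum_(i < e.+1) p`_i *: (l ^+ i * m ^+ (e - i)).

(** The form splits because p does; each root r of p gives a factor l - r m, and
    the defect e - deg p is made up by factors m. *)
Lemma binary_form_split p e : p != 0 -> (size p <= e.+1)%N ->
  exists (c : K) (s : seq (K * K)), [/\ c != 0, size s = e,
    forall u, u \in s -> u != (0, 0) &
    forall l m, binary_form p e l m = c *: \prod_(u <- s) (u.1 *: l + u.2 *: m)].
Proof.
elim: e p => [|e IHe] p p0 szp.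
  exists p`_0, [::]; split=> // [|l m]; last first.
    by rewrite /binary_form big_ord1 big_nil !expr0 mulr1.
  by move: p0; rewrite {1}(size1_polyC szp) polyC_eq0.
have [le_p|gt_p] := leqP (size p) e.+1.
  have [c [s [c0 szs s0 eqs]]] := IHe p p0 le_p.
  exists c, ((0, 1) :: s); split=> //=; first by rewrite szs.
    by move=> u; rewrite inE => /orP[/eqP->|/s0//]; rewrite xpair_eqE oner_eq0 andbF.
  move=> l m; rewrite big_cons /= scale0r add0r scale1r scalerAr -eqs.
  rewrite /binary_form big_ord_recr /= nth_default // scale0r addr0 mulr_sumr.
  apply: eq_bigr => i _; rewrite -scalerAr; congr (_ *: _).
  by rewrite mulrCA -exprS subSn // -ltnS.
have [r /factor_theorem[q eq_p]] : exists r, root p r.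
  by apply/closed_rootP; rewrite gtn_eqF // (leq_trans _ gt_p).
have q0 : q != 0 by apply: contraNneq p0 => q0; rewrite eq_p q0 mul0r.
have szq : (size q <= e.+1)%N.
  by move: szp; rewrite eq_p size_Mmonic ?monicXsubC // size_XsubC addn2.
have [c [s [c0 szs s0 eqs]]] := IHe q q0 szq.
exists c, ((1, - r) :: s); split=> //=; first by rewrite szs.
  by move=> u; rewrite inE => /orP[/eqP->|/s0//]; rewrite xpair_eqE oner_eq0.
move=> l m; rewrite big_cons /= scale1r scalerAr -eqs /binary_form.
have coef_p i : p`_i = (if i is j.+1 then q`_j else 0) - r * q`_i.
  by rewrite eq_p mulrBr coefB coefMX coefMC mulrC; case: i.
under eq_bigr => i _ do rewrite coef_p scalerBl.
rewrite sumrB big_ord_recl /= scale0r add0r [X in _ - X]big_ord_recr /=.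
rewrite [q`_e.+1]nth_default // mulr0 scale0r addr0 mulrDl; congr (_ + _).
  rewrite mulr_sumr; apply: eq_bigr => i _.
  by rewrite /bump /= add1n subSS -scalerAr exprS mulrA.
rewrite scaleNr mulNr -scalerAl mulr_sumr scaler_sumr; congr (- _).
apply: eq_bigr => i _; rewrite -scalerAr scalerA; congr (_ *: _).
by rewrite mulrCA -exprS subSn // -ltnS.
Qed.

(** The N + 1 monomials of degree N in l and m are linearly dependent modulo P,
    so that a binary form in l and m lies in P, and one of its linear factors
    does. Thus P contains a linear form in any two given ones: it is a closed
    point. *)
Lemma bounded_linear_form P N l m : is_projpt P -> (forall n, (hf P n <= N)%N) ->
    l \is 1.-homog -> m \is 1.-homog ->
  exists u : K * K, u != (0, 0) /\ P (u.1 *: l + u.2 *: m).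
Proof.
move=> [pP hP rP] bP hl hm; have [iP P1 Pp] := pP.
pose f (i : 'I_N.+1) := l ^+ i * m ^+ (N - i).
have hf_ i : f i \is N.-homog.
  have eN : (1 * i + 1 * (N - i) = N)%N by rewrite !mul1n subnKC // -ltnS.
  by rewrite -[X in X.-homog]eN; apply: dhomogM; apply: dhomogMn.
have lt_hf : (hf P N < N.+1)%N by rewrite ltnS.
have [c [[i0 ci0] Pc]] := hf_dependent iP hf_ lt_hf.
pose p := \poly_(i < N.+1) c (inord i).
have coef_p (i : 'I_N.+1) : p`_i = c i by rewrite coef_poly ltn_ord inord_val.
have p0 : p != 0 by apply: contraNneq ci0 => p0; rewrite -coef_p p0 coef0.
have [k [s [k0 szs s0 eqs]]] := binary_form_split p0 (size_poly _ _).
have : P (binary_form p N l m).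
  by rewrite /binary_form; under eq_bigr => i _ do rewrite coef_p.
rewrite eqs => Pprod.
have {Pprod} : P (\prod_(u <- s) (u.1 *: l + u.2 *: m)).
  by rewrite -[X in P X]scale1r -(mulVf k0) -scalerA; apply: ideal_scale.
elim: s {szs eqs} s0 => [_|u s IHs s0]; first by rewrite big_nil.
rewrite big_cons => /Pp[Pu|]; first by exists u; split=> //; apply: s0; apply: mem_head.
by apply: IHs => v sv; apply: s0; rewrite inE sv orbT.
Qed.

End BinaryForms.

(** * Dimension from the growth of Hilbert functions *)

Section Dimension.
Variable K : fieldType.
Local Notation R := {mpoly K[4]}.
Implicit Types (J P Q : R -> Prop) (n e : nat).

(** A form a of degree e in Q but not in P is a nonzerodivisor modulo P, and
    P + (a) is contained in Q. *)
Lemma hf_strict P Q : prime_ideal P -> homog_ideal P -> is_ideal Q -> homog_ideal Q ->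
    sub_ideal P Q -> ~ sub_ideal Q P ->
  exists e, forall n, (hf P n + hf Q (e + n) <= hf P (e + n))%N.
Proof.
move=> [iP P1 Pp] hP iQ hQ PQ nQP.
have [e [a [ha Qa Pa]]] : exists e a, [/\ a \is e.-homog, Q a & ~ P a].
  apply: contrapT => noa; apply: nQP; apply: homog_sub => // d a ha Qa.
  by apply: contrapT => Pa; apply: noa; exists d, a.
exists e => n; rewrite (hf_exact ha n iP hP).
rewrite (@hf_ext _ (fun p => P (a * p)) P); last first.
  by move=> p; split=> [/Pp[]//|Pp']; case: iP => _ _; apply.
rewrite leq_add2l; apply: hf_sub => //; first exact: idadd_ideal.
by apply: idadd_sub => // b; rewrite inE => /eqP->.
Qed.

Lemma hf_mono P n m : is_projpt P -> (n <= m)%N -> (hf P n <= hf P m)%N.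
Proof.
move=> projP; have [[iP P1 Pp] hP _] := projP; have [v Pv] := projpt_var projP.
move=> /subnK<-; elim: (m - n)%N => // k IHk; apply: (leq_trans IHk).
rewrite addSn -add1n (hf_exact (homog_var v) _ iP hP).
rewrite (@hf_ext _ (fun p => P ('X_v * p)) P) ?leq_addr // => p.
by split=> [/Pp[]//|Pp']; case: iP => _ _; apply.
Qed.

Lemma hf_projpt_gt0 P n : is_projpt P -> (0 < hf P n)%N.
Proof.
move=> projP; have [pP hP _] := projP; have [v Pv] := projpt_var projP.
by apply: (hf_gt0 _ (homog_varX v n)); [case: pP | apply: prime_exp].
Qed.

(** By [hf_strict], a step P < Q of the chain forces
    hf P n + hf Q (e + n) <= hf P (e + n) for some e. As the Hilbert function of the last
    prime is positive, that of the middle one is unbounded, and that of the first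
    one grows faster than any linear function. *)
Lemma no_chain2 J D c n0 : is_ideal J -> (forall n, (n0 <= n)%N -> (hf J n <= D * n + c)%N) ->
  ~ has_chain (on_proj J) 2.
Proof.
move=> iJ hfJ [p [pP pS]].
have [[[pr0 h0 r0] J0] [[pr1 h1 r1] J1] [[pr2 h2 r2] J2]] := And3 (pP 0%N isT) (pP 1%N isT) (pP 2%N isT).
have [iQ0 _ _] := pr0; have [iQ1 _ _] := pr1; have [iQ2 _ _] := pr2.
have [s01 n01] := pS 0%N isT; have [s12 n12] := pS 1%N isT.
have [e he] := hf_strict pr0 h0 iQ1 h1 s01 n01.
have [e' he'] := hf_strict pr1 h1 iQ2 h2 s12 n12.
have p1_ge k : (k <= hf (p 1%N) (k * e'))%N.
  elim: k => // k IHk; rewrite mulSn; apply: leq_trans (he' _).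
  by rewrite -[X in (X <= _)%N]addn1 leq_add // hf_projpt_gt0.
pose B := (D * e).+1; pose n1 := (n0 + B * e')%N.
have p0_ge k : (k * B <= hf (p 0%N) (k * e + n1))%N.
  elim: k => // k IHk; rewrite !mulSn -addnA; apply: leq_trans (he _).
  rewrite addnC leq_add // (leq_trans (p1_ge B)) //; apply: hf_mono => //.
  by rewrite /n1; lia.
pose k := (D * n1 + c).+1.
have := leq_trans (p0_ge k) (hf_sub _ iJ iQ0 J0).
move=> /leq_trans/(_ (hfJ _ _)); rewrite /B /k; nia.
Qed.

End Dimension.

(** * The ideal J: syzygies, colon ideals and nonzerodivisors *)

(** With U = y B + h G and V = x A + h F, the last generator is both
    x A G + F U and y B F + G V. *)
Definition double_ideal (R : comNzRingType) (x y A B F G h : R) : R -> Prop :=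
  idgen [:: x * y; x * (x * A + h * F); y * (y * B + h * G);
            x * A * G + y * B * F + h * F * G].

Section Configuration.
Variable R : idomainType.
Implicit Types (x y A B F G h p q a : R) (P : R -> Prop).

(** What the algebra of J depends on. The list is stable under the exchange of
    (x, A, F) and (y, B, G), so that each lemma below has a mirror image. *)
Record config x y A B F G h : Prop := Config {
  cfg_x : prime_ideal (idgen [:: x]);
  cfg_y : prime_ideal (idgen [:: y]);
  cfg_xy : prime_ideal (idgen [:: x; y]);
  cfg_y_x : ~ idgen [:: x] y;
  cfg_x_y : ~ idgen [:: y] x;
  cfg_U : ~ idgen [:: x] (y * B + h * G);
  cfg_V : ~ idgen [:: y] (x * A + h * F);
  cfg_F : ~ idgen [:: x; y] F;
  cfg_G : ~ idgen [:: x; y] G }.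

Lemma idgen_swap x y p : idgen [:: x; y] p <-> idgen [:: y; x] p.
Proof. by split=> /idgen2[u [v ->]]; apply/idgen2; exists v, u; rewrite addrC. Qed.

Lemma config_sym x y A B F G h : config x y A B F G h -> config y x B A G F h.
Proof.
case=> px py [[i0 iD iM] p1 pp] yx xy U V nF nG; split=> //; try by move/idgen_swap.
split; first exact: idgen_ideal.
  by move/idgen_swap.
by move=> a b /idgen_swap/pp[]/idgen_swap; [left | right].
Qed.

Lemma double_ideal_sym x y A B F G h p :
  double_ideal x y A B F G h p <-> double_ideal y x B A G F h p.
Proof.
split=> /idgen4[c1 [c2 [c3 [c4 ->]]]]; apply/idgen4; exists c1, c3, c2, c4; ring.
Qed.

Section Cancel.
Variables (x y A B F G h : R).
Hypothesis cfg : config x y A B F G h.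
Local Notation U := (y * B + h * G).
Local Notation V := (x * A + h * F).
Local Notation J := (double_ideal x y A B F G h).

Lemma cfg_x0 : x != 0.
Proof. by apply/eqP => x0; case: cfg => _ _ _ _ + _ _ _ _; apply; rewrite x0; case: (idgen_ideal [:: y]). Qed.

Lemma cfg_y0 : y != 0.
Proof. by apply/eqP => y0; case: cfg => _ _ _ + _ _ _ _ _; apply; rewrite y0; case: (idgen_ideal [:: x]). Qed.

Lemma cancel_x p q r : ~ idgen [:: x] p -> p * q = x * r -> exists s, q = x * s.
Proof.
move=> xp eq_pq; have [_ _ pp] := cfg_x cfg.
have /pp[//|/idgen1[s ->]] : idgen [:: x] (p * q) by apply/idgen1; exists r; rewrite eq_pq mulrC.
by exists s; rewrite mulrC.
Qed.

Lemma cancel_y p q r : ~ idgen [:: y] p -> p * q = y * r -> exists s, q = y * s.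
Proof.
move=> yp eq_pq; have [_ _ pp] := cfg_y cfg.
have /pp[//|/idgen1[s ->]] : idgen [:: y] (p * q) by apply/idgen1; exists r; rewrite eq_pq mulrC.
by exists s; rewrite mulrC.
Qed.

Lemma cancel_F q r s : F * q = x * r + y * s -> exists r' s', q = x * r' + y * s'.
Proof.
move=> eq_q; have [_ _ pp] := cfg_xy cfg.
have /pp[/(cfg_F cfg)//|/idgen2[r' [s' ->]]] : idgen [:: x; y] (F * q).
  by apply/idgen2; exists r, s; rewrite eq_q; ring.
by exists r', s'; ring.
Qed.

(** Reducing a syzygy modulo x leaves U (c3 y + c4 F), so that c4 is in (x, y) and
    can be removed with the last two columns of the syzygy matrix; then c3 is
    divisible by x and is removed with the second column, and what remains is a
    syzygy of the regular sequence y, V, a multiple of the first column. *)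
Lemma syzygy1 c1 c2 c3 c4 :
    c1 * (x * y) + c2 * (x * V) + c3 * (y * U) + c4 * (x * A * G + y * B * F + h * F * G) = 0 ->
  exists w1 w2 w3 w4,
    [/\ c1 = V * w1 + U * w2 + A * G * w3 + B * F * w4, c2 = - y * w1 + G * w4,
        c3 = - x * w2 + F * w3 & c4 = - y * w3 - x * w4].
Proof.
move=> syz.
have [s eq_s] : exists s, c3 * y + c4 * F = x * s.
  apply: (@cancel_x U _ (- (c1 * y + c2 * V + c4 * A * G))); first exact: cfg_U cfg.
  by apply/eqP; rewrite -subr_eq0; apply/eqP; rewrite -[RHS]syz; ring.
have [r [r' eq_c4]] : exists r r', c4 = x * r + y * r'.
  apply: (@cancel_F c4 s (- c3)); rewrite mulrN -eq_s; ring.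
have [w2 eq_c3] : exists w2, c3 + F * r' = x * w2.
  apply: (@cancel_x y _ (s - r * F)); first exact: cfg_y_x cfg.
  have -> : y * (c3 + F * r') = (c3 * y + c4 * F) - x * (r * F) by rewrite eq_c4; ring.
  by rewrite eq_s; ring.
have e3 : c3 = x * w2 - F * r' by rewrite -eq_c3 addrK.
(* dividing the remaining syzygy by x *)
have eq12 : (c1 + B * F * r + U * w2 + A * G * r') * y + (c2 + G * r) * V = 0.
  apply: (mulfI cfg_x0); rewrite mulr0 -[RHS]syz e3 eq_c4; ring.
have [w1 eq_c2] : exists w1, c2 + G * r = y * w1.
  apply: (@cancel_y V _ (- (c1 + B * F * r + U * w2 + A * G * r'))); first exact: cfg_V cfg.
  by apply/eqP; rewrite -subr_eq0; apply/eqP; rewrite -[RHS]eq12; ring.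
have eq_c1 : c1 + B * F * r + U * w2 + A * G * r' + w1 * V = 0.
  by apply: (mulfI cfg_y0); rewrite mulr0 -[RHS]eq12 eq_c2; ring.
exists (- w1), (- w2), (- r'), (- r); split.
- by apply/eqP; rewrite -subr_eq0; apply/eqP; rewrite -[RHS]eq_c1; ring.
- by rewrite mulrNN -eq_c2; ring.
- by rewrite e3; ring.
- by rewrite eq_c4; ring.
Qed.

Lemma syzygy2 w1 w2 w3 w4 : - y * w1 + G * w4 = 0 -> - x * w2 + F * w3 = 0 ->
    - y * w3 - x * w4 = 0 ->
  exists q, [/\ w1 = G * q, w2 = - F * q, w3 = - x * q & w4 = y * q].
Proof.
move=> e1 e2 e3; have [q eq_w4] : exists q, w4 = y * q.
  apply: (@cancel_y x _ (- w3)); first exact: cfg_x_y cfg.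
  by apply/eqP; rewrite -subr_eq0 -[X in _ == X]oppr0 -[X in _ == - X]e3; apply/eqP; ring.
have eq_w3 : w3 = - x * q.
  by apply: (mulfI cfg_y0); apply/eqP; rewrite -subr_eq0 -[X in _ == X]oppr0 -[X in _ == - X]e3 eq_w4; apply/eqP; ring.
exists q; split=> //.
  by apply: (mulfI cfg_y0); apply/eqP; rewrite -subr_eq0 -[X in _ == X]oppr0 -[X in _ == - X]e1 eq_w4; apply/eqP; ring.
by apply: (mulfI cfg_x0); apply/eqP; rewrite -subr_eq0 -[X in _ == X]oppr0 -[X in _ == - X]e2 eq_w3; apply/eqP; ring.
Qed.

Lemma double_ideal_sub_yV : sub_ideal J (idgen [:: y; V]).
Proof.
move=> _ /idgen4[c1 [c2 [c3 [c4 ->]]]]; apply/idgen2.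
by exists (c1 * x + c3 * U + c4 * B * F), (c2 * x + c4 * G); ring.
Qed.

(** As in [syzygy1], the coefficients of x p on the last two generators are, up to
    multiples of x, those of a multiple of the syzygy (F, - y) of (y U, F U). *)
Lemma double_colon_x p : J (x * p) <-> idgen [:: y; V] p.
Proof.
split=> [/idgen4[c1 [c2 [c3 [c4 eq_p]]]]|/idgen2[u [v ->]]]; last first.
  by apply/idgen4; exists u, v, 0, 0; ring.
have [s eq_s] : exists s, c3 * y + c4 * F = x * s.
  apply: (@cancel_x U _ (p - (c1 * y + c2 * V + c4 * A * G))); first exact: cfg_U cfg.
  by rewrite [RHS]mulrBr eq_p; ring.
have [r [r' eq_c4]] : exists r r', c4 = x * r + y * r'.
  by apply: (@cancel_F c4 s (- c3)); rewrite mulrN -eq_s; ring.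
have eq_p' : p = c1 * y + c2 * V + U * s + c4 * A * G.
  apply: (mulfI cfg_x0); rewrite eq_p.
  have -> : x * (c1 * y + c2 * V + U * s + c4 * A * G) =
    x * (c1 * y + c2 * V + c4 * A * G) + U * (x * s) by ring.
  by rewrite -eq_s; ring.
have [w2 eq_c3] : exists w2, c3 + F * r' = x * w2.
  apply: (@cancel_x y _ (s - r * F)); first exact: cfg_y_x cfg.
  have -> : y * (c3 + F * r') = (c3 * y + c4 * F) - x * (r * F) by rewrite eq_c4; ring.
  by rewrite eq_s; ring.
have eq_s' : s = w2 * y + r * F.
  apply: (mulfI cfg_x0); rewrite -eq_s.
  have -> : c3 = x * w2 - F * r' by rewrite -eq_c3 addrK.
  by rewrite eq_c4; ring.
apply/idgen2; exists (c1 + U * w2 + r * B * F + r' * A * G), (c2 + r * G).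
by rewrite eq_p' eq_s' eq_c4; ring.
Qed.

Lemma double_add_x p : idadd J [:: x] p <-> idgen [:: x; y * U; F * U] p.
Proof.
split=> [/idadd1[u /idgen4[c1 [c2 [c3 [c4 /eqP]]]]]|/idgen3[u [v [w ->]]]].
  rewrite subr_eq => /eqP->; apply/idgen3.
  by exists (u + c1 * y + c2 * V + c4 * A * G), c3, c4; ring.
by apply/idadd1; exists (u - w * A * G); apply/idgen4; exists 0, 0, v, w; ring.
Qed.

Lemma add_x_colon_U p : idgen [:: x; y * U; F * U] (U * p) <-> idgen [:: x; y; F] p.
Proof.
split=> [/idgen3[u [v [w eq_p]]]|/idgen3[u [v [w ->]]]]; last first.
  by apply/idgen3; exists (U * u), v, w; ring.
have [s eq_s] : exists s, p - v * y - w * F = x * s.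
  apply: (@cancel_x U _ u); first exact: cfg_U cfg.
  have -> : U * (p - v * y - w * F) = U * p - v * (y * U) - w * (F * U) by ring.
  by rewrite eq_p; ring.
by apply/idgen3; exists s, v, w; rewrite [s * x]mulrC -eq_s; ring.
Qed.

Lemma add_x_U p : idadd (idgen [:: x; y * U; F * U]) [:: U] p <-> idgen [:: x; U] p.
Proof.
split=> [/idadd1[u /idgen3[v [w [r /eqP]]]]|/idgen2[u [v ->]]].
  by rewrite subr_eq => /eqP->; apply/idgen2; exists v, (w * y + r * F + u); ring.
by apply/idadd1; exists v; apply/idgen3; exists u, 0, 0; ring.
Qed.

Section Nonzerodivisor.
Variable a : R.
Hypotheses (a_y : ~ idgen [:: y] a) (pya : prime_ideal (idgen [:: y; a])).
Hypothesis Va : ~ idgen [:: y; a] V.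

Lemma nzd_yV p : idgen [:: y; V] (a * p) -> idgen [:: y; V] p.
Proof.
case/idgen2=> u [v eq_p]; have [_ _ pp] := pya.
have /pp[//|/idgen2[r [s eq_v]]] : idgen [:: y; a] (V * v).
  by apply/idgen2; exists (- u), p; rewrite [p * a]mulrC eq_p; ring.
have [w eq_w] : exists w, p - V * s = y * w.
  apply: (@cancel_y a _ (u + r * V)) => //.
  by rewrite mulrBr eq_p eq_v; ring.
by apply/idgen2; exists w, s; rewrite [w * y]mulrC -eq_w; ring.
Qed.

(** Where x is invertible, J coincides with (y, V), by [double_colon_x]. *)
Lemma double_nzd_x p : J (a * p) -> J (x * p).
Proof. by move=> /double_ideal_sub_yV/nzd_yV/double_colon_x. Qed.

Hypotheses (a_x : ~ idgen [:: x] a) (pxa : prime_ideal (idgen [:: x; a])).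
Hypotheses (Ua : ~ idgen [:: x; a] U) (Fa : ~ idgen [:: x; a] F).

(** Where F is invertible, the generator y U is redundant. Modulo a, the
    coefficient of the last generator is then divisible by x, which reduces the
    claim to the ideal (y, V). *)
Lemma double_nzd_F p : J (a * p) -> J (F * p).
Proof.
case/idgen4=> c1 [c2 [c3 [c4 eq_p]]]; have [_ _ pp] := pxa.
(* F (y U) = y (x A G + F U) - A G (x y) *)
pose d1 := c1 * F - c3 * A * G; pose d2 := c2 * F; pose d4 := c4 * F + c3 * y.
have eq_Fp : a * (F * p) = d1 * (x * y) + d2 * (x * V) + d4 * (x * A * G + F * U).
  by rewrite mulrCA eq_p /d1 /d2 /d4; ring.
have : idgen [:: x; a] (F * (U * d4)).
  apply/idgen2; exists (- (d1 * y + d2 * V + d4 * A * G)), (F * p).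
  by rewrite [F * p * a]mulrC eq_Fp; ring.
move=> /pp[//|/pp[//|/idgen2[e [e' eq_d4]]]].
have [k eq_k] : exists k, F * p - e' * (x * A * G + F * U) = x * k.
  apply: (@cancel_x a _ (d1 * y + d2 * V + e * (x * A * G + F * U))) => //.
  by rewrite mulrBr eq_Fp eq_d4; ring.
have /double_colon_x : idgen [:: y; V] k.
  apply: nzd_yV; apply/idgen2; exists (d1 + e * B * F), (d2 + e * G).
  apply: (mulfI cfg_x0); rewrite mulrCA -eq_k mulrBr eq_Fp eq_d4; ring.
rewrite -eq_k => /idgen4[b1 [b2 [b3 [b4 eq_b]]]].
apply/idgen4; exists b1, b2, b3, (b4 + e').
have -> : F * p = F * p - e' * (x * A * G + F * U) + e' * (x * A * G + F * U) by ring.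
by rewrite eq_b; ring.
Qed.

End Nonzerodivisor.

(** If L divides both F and G, dividing the last generator by L gives an element
    w killed by x, y and L modulo J. If s w is in J, multiplying by L gives a
    syzygy whose last coefficient is congruent to - s modulo L; it lies in (x, y),
    as the last row of the syzygy matrix does. *)
Lemma socle_element L F' G' : L != 0 -> F = L * F' -> G = L * G' ->
  let w := x * A * G' + y * B * F' + h * F' * G in
  [/\ J (x * w), J (y * w), J (L * w) & forall s, J (s * w) -> idgen [:: x; y; L] s].
Proof.
move=> L0 eF eG w; split.
- by apply/idgen4; exists (B * F'), G', 0, 0; rewrite /w eF eG; ring.
- by apply/idgen4; exists (A * G'), 0, F', 0; rewrite /w eG; ring.
- by apply/idgen4; exists 0, 0, 0, 1; rewrite /w eF eG; ring.
- move=> s /idgen4[c1 [c2 [c3 [c4 eq_s]]]].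
  have [|w1 [w2 [w3 [w4 [_ _ _ e4]]]]] := @syzygy1 (L * c1) (L * c2) (L * c3) (L * c4 - s).
    have -> : (L * c4 - s) * (x * A * G + y * B * F + h * F * G) =
      L * (c4 * (x * A * G + y * B * F + h * F * G)) - L * (s * w) by rewrite /w eF eG; ring.
    by rewrite eq_s; ring.
  apply/idgen3; exists w4, w3, c4.
  have -> : s = L * c4 - (L * c4 - s) by ring.
  by rewrite e4; ring.
Qed.

End Cancel.
End Configuration.

(** * Homogeneous primes above a given one *)

Section LargerPoint.
Variable K : fieldType.
Local Notation R := {mpoly K[4]}.
Implicit Types (I P Q : R -> Prop) (n : nat).

(** A monomial of large degree is divisible by a large power of some variable. *)
Lemma mem_all_forms I : is_ideal I -> (forall i, exists n, I ('X_i ^+ n)) ->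
  exists N, forall n a, (N <= n)%N -> a \is n.-homog -> I a.
Proof.
move=> iI /boolp.choice[k Ik]; exists (\sum_i k i).+1 => n a le_n /dhomogP ha.
rewrite [a]mpolyE big_seq; apply: ideal_sum => // m am; apply: ideal_scale => //.
have em : mdeg m = n := ha m am.
have [i le_i] : exists i, (k i <= m i)%N.
  apply: contrapT => nle; move: le_n; rewrite -em mdegE ltnNge => /negP; apply.
  apply: leq_sum => i _; apply: ltnW; rewrite ltnNge; apply/negP => le.
  by apply: nle; exists i.
rewrite mpolyXE_id (bigD1 i) //= -(subnKC le_i) exprD -mulrA.
exact: ideal_mulr.
Qed.

(** If every variable were nilpotent modulo P + (v), with v a variable outside P,
    then R/(P + (v)) would vanish in high degree and multiplication by v on R/P
    would be bijective there, so that hf P would be eventually constant. Hence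
    some prime over P + (v) misses a variable. *)
Lemma larger_point P : is_projpt P -> ~ (exists N, forall n, (hf P n <= N)%N) ->
  exists Q, [/\ is_projpt Q, sub_ideal P Q & ~ sub_ideal Q P].
Proof.
move=> projP unb; have [[iP P1 Pp] hP rP] := projP; have [v Pv] := projpt_var projP.
pose I := idadd P [:: 'X_v]; have iI : is_ideal I by apply: idadd_ideal.
have hI : homog_ideal I.
  by apply: homog_ideal_idadd => // a; rewrite inE => /eqP->; exists 1%N; apply: homog_var.
have [v' Iv'] : exists v', forall n, ~ I ('X_v' ^+ n).
  apply: contrapT => nov; apply: unb.
  have [|N allI] := mem_all_forms iI.
    move=> i; apply: contrapT => noi; apply: nov; exists i => n Iin.
    by apply: noi; exists n.
  exists (hf P N) => n; have [/hf_mono->//|/ltnW le_Nn] := leqP n N.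
  rewrite -(subnK le_Nn); elim: (n - N)%N => // m IHm; apply: leq_trans IHm.
  rewrite addSn -add1n (hf_exact (homog_var v) _ iP hP).
  rewrite (@hf_ext _ (fun p => P ('X_v * p)) P); last first.
    by move=> p; split=> [/Pp[]//|Pp']; case: iP => _ _; apply.
  have [->|] := posnP (hf (idadd P [:: 'X_v]) (1 + (m + N))); first by rewrite addn0.
  move=> gt0; suff : hf I (1 + (m + N)) = 0%N by move/eqP; rewrite (gtn_eqF gt0).
  rewrite /hf; apply/eqP; rewrite subn_eq0 -dimvf; apply: dimvS; apply/subvP => p _.
  apply/(pieceP _ iI); apply: (allI (1 + (m + N))%N); first by rewrite addnA leq_addl.
  exact: dhomog_is_dhomog.
pose S a := exists n, a = 'X_v' ^+ n :> R.
have S1 : S 1 by exists 0%N.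
have [||Q [pQ IQ QS]] := prime_avoiding iI S1.
- by move=> _ _ [m ->] [n ->]; exists (m + n)%N; rewrite exprD.
- by move=> a Ia [n eq_a]; apply: (Iv' n); rewrite -eq_a.
have iQ : is_ideal Q by case: pQ.
exists (homcore Q); split.
- split; [exact: homcore_prime | exact: homcore_homog |].
  move/(_ _ (irrelevant_var K v'))/(homcore_sub iQ)/QS; apply.
  by exists 1%N.
- by apply: sub_homcore => // a Pa; apply: IQ; apply: idadd_l.
- move=> QP; apply: Pv; apply: QP; apply: (sub_homcore hI IQ).
  by apply: idadd_r => //; apply: idgen_mem; apply: mem_head.
Qed.

End LargerPoint.

(** * Linear forms in general position *)

Section FixedPolynomials.
Variable K : fieldType.
Local Notation R := {mpoly K[4]}.
Implicit Types (p q : R) (s : seq 'I_4) (w : 4.-tuple R).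

(** Not involving the variables in s, phrased through substitutions because it is
    then evidently preserved by the ring operations. *)
Definition fixed_off s p :=
  forall w, (forall i, i \notin s -> tnth w i = 'X_i) -> p \mPo w = p.

Lemma substX i w : ('X_i : R) \mPo w = tnth w i.
Proof. by rewrite comp_mpolyXU -tnth_nth. Qed.

Lemma fixed_var s i : i \notin s -> fixed_off s 'X_i.
Proof. by move=> si w /(_ i si) wi; rewrite substX. Qed.

Lemma fixedD s p q : fixed_off s p -> fixed_off s q -> fixed_off s (p + q).
Proof. by move=> fp fq w ws; rewrite rmorphD /= fp ?fq. Qed.

Lemma fixedM s p q : fixed_off s p -> fixed_off s q -> fixed_off s (p * q).
Proof. by move=> fp fq w ws; rewrite rmorphM /= fp ?fq. Qed.

Lemma fixedZ s (c : K) p : fixed_off s p -> fixed_off s (c *: p).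
Proof. by move=> fp w ws; rewrite comp_mpolyZ fp. Qed.

Lemma fixed0 s : fixed_off s 0.
Proof. by move=> w _; rewrite raddf0. Qed.

Lemma fixed_weaken s s' p : {subset s <= s'} -> fixed_off s' p -> fixed_off s p.
Proof.
move=> ss fp w ws; apply: fp => i si; apply: ws; apply: contra si; exact: ss.
Qed.

Lemma free_fixed s p : (forall i, i \in s -> free_of i p) -> fixed_off s p.
Proof.
move=> fp w ws; apply: subst_free => m i pm mi; apply: ws; apply/negP => /fp/(_ m pm).
by apply/eqP.
Qed.

Definition subst2 (j k : 'I_4) (g : R) : 4.-tuple R :=
  [tuple if i == j then 0 else if i == k then g else 'X_i | i < 4].

Lemma subst2E j k g i :
  tnth (subst2 j k g) i = if i == j then 0 else if i == k then g else 'X_i.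
Proof. by rewrite tnth_mktuple. Qed.

Lemma fixed_subst2 j k g p : fixed_off [:: j; k] p -> p \mPo subst2 j k g = p.
Proof.
apply=> i; rewrite !inE negb_or subst2E => /andP[/negPf-> /negPf->].
by [].
Qed.

Lemma kernel2 j k g p : j != k -> fixed_off [:: j; k] g ->
  idgen [:: 'X_j; 'X_k - g] p <-> p \mPo subst2 j k g = 0.
Proof.
move=> jk fg; apply: idgen_kernel => [i|l].
  rewrite subst2E; case: eqP => [->|_]; first by rewrite subr0; apply: idgen_mem; rewrite mem_head.
  case: eqP => [->|_]; first by apply: idgen_mem; rewrite !inE eqxx orbT.
  by rewrite subrr; case: (idgen_ideal [:: 'X_j; 'X_k - g]).
rewrite !inE => /orP[]/eqP->; first by rewrite substX subst2E eqxx.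
rewrite rmorphB /= substX subst2E eq_sym (negPf jk) eqxx fixed_subst2 //.
exact: subrr.
Qed.

Lemma prime2 j k g : j != k -> fixed_off [:: j; k] g ->
  prime_ideal (idgen [:: 'X_j; 'X_k - g]).
Proof. by move=> jk fg; apply: (@kernel_prime _ _ (subst2 j k g)) => p; apply: kernel2. Qed.

Definition subst1 (j : 'I_4) : 4.-tuple R := [tuple if i == j then 0 else 'X_i | i < 4].

Lemma fixed_subst1 j p : fixed_off [:: j] p -> p \mPo subst1 j = p.
Proof. by apply=> i; rewrite !inE tnth_mktuple => /negPf->. Qed.

Lemma kernel1 j p : idgen [:: 'X_j] p <-> p \mPo subst1 j = 0.
Proof.
apply: idgen_kernel => [i|l]; last first.
  by rewrite inE => /eqP->; rewrite substX tnth_mktuple eqxx.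
rewrite tnth_mktuple; case: eqP => [->|_]; first by rewrite subr0; apply: idgen_mem; rewrite mem_head.
by rewrite subrr; case: (idgen_ideal [:: 'X_j : R]).
Qed.

Lemma prime1 j : prime_ideal (idgen [:: 'X_j : R]).
Proof. by apply: (@kernel_prime _ _ (subst1 j)) => p; apply: kernel1. Qed.

Lemma mpolyX_neq0 (i : 'I_4) : ('X_i : R) != 0.
Proof. by rewrite -msize_poly_eq0 msizeX. Qed.

Lemma fixed1_neq0 j p : fixed_off [:: j] p -> idgen [:: 'X_j] p -> p = 0.
Proof. by move=> fp /kernel1; rewrite fixed_subst1. Qed.

Lemma msize_homog d p : p \is d.-homog -> p != 0 -> msize p = d.+1.
Proof.
move=> /dhomogP hp p0; rewrite -mlead_deg // -[in RHS](hp _ (mlead_supp p0)).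
by [].
Qed.

(** The linear forms X_k - g - c l, for different c, are prime and pairwise coprime
    modulo X_j; dividing f by one of them lowers its degree, so that only finitely
    many can divide f. *)
Lemma generic_avoid j k g l f : j != k -> fixed_off [:: j; k] g -> fixed_off [:: j; k] l ->
    g \is 1.-homog -> l \is 1.-homog -> l != 0 -> ~ idgen [:: 'X_j] f ->
  exists bad : seq K, forall c, c \notin bad ->
    ~ idgen [:: 'X_j; 'X_k - (g + c *: l)] f.
Proof.
move=> jk fg fl hg hl l0 /kernel1.
have [n] := ubnP (msize (f \mPo subst1 j)); elim: n f => // n IHn f lt_n f0.
have fgl c : fixed_off [:: j; k] (g + c *: l) by apply: fixedD => //; apply: fixedZ.
have [[c0 fc0]|noc] := pselect (exists c, idgen [:: 'X_j; 'X_k - (g + c *: l)] f); last first.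
  by exists [::] => c _ fc; apply: noc; exists c.
have [u [q eq_f]] := (idgen2 _ _ _).1 fc0.
set b := 'X_k - (g + c0 *: l) in eq_f.
have fb : b \mPo subst1 j = b.
  rewrite rmorphB /= substX tnth_mktuple eq_sym (negPf jk) fixed_subst1 //.
  by apply: fixed_weaken (fgl c0) => i; rewrite !inE => ->.
have eq_f1 : f \mPo subst1 j = (q \mPo subst1 j) * b.
  by rewrite eq_f rmorphD !rmorphM /= fb substX tnth_mktuple eqxx mulr0 add0r.
have b0 : b != 0 by apply/eqP => b0; apply: f0; rewrite eq_f1 b0 mulr0.
have hb : b \is 1.-homog.
  by apply: rpredB; [exact: homog_var | apply: rpredD => //; apply: dhomogZ].
have q0 : q \mPo subst1 j != 0 by apply/eqP => q0; apply: f0; rewrite eq_f1 q0 mul0r.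
have [||bad badP] := IHn q; [|exact/eqP|]; last first.
  exists (c0 :: bad) => c; rewrite inE negb_or => /andP[ne_c /badP qc] fc.
  have [_ _ pp] := prime2 jk (fgl c).
  have /pp[//|bc] : idgen [:: 'X_j; 'X_k - (g + c *: l)] (q * b).
    have -> : q * b = f - u * 'X_j by rewrite eq_f addrC addKr.
    apply: (ideal_sub (idgen_ideal _) fc); apply/idgen2; exists u, 0.
    by rewrite mul0r addr0.
  move: bc => /(kernel2 _ jk (fgl c)); rewrite /b rmorphB /= substX subst2E eq_sym (negPf jk) eqxx.
  rewrite (fixed_subst2 _ (fgl c0)) opprD addrACA subrr add0r -scalerBl => /eqP.
  by rewrite scaler_eq0 (negPf l0) orbF subr_eq0 (negPf ne_c).
by move: lt_n; rewrite eq_f1 msizeM // (msize_homog hb b0) addn2 /= ltnS.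
Qed.

End FixedPolynomials.

(** A root of 1 + X (X - b_1) ... (X - b_n) is none of the b_i. *)
Lemma closed_field_fresh (K : closedFieldType) (bad : seq K) : exists c, c \notin bad.
Proof.
pose q := \prod_(b <- 0 :: bad) ('X - b%:P).
have szq : size q = (size bad).+2 by rewrite size_prod_XsubC.
have [c] : exists c, root (q + 1) c.
  by apply/closed_rootP; rewrite size_polyDl szq ?size_poly1.
rewrite /root hornerD hornerC => rc; exists c; apply/negP => bc; move: rc.
have -> : q.[c] = 0 by apply/eqP; rewrite [_ == _]root_prod_XsubC inE bc orbT.
by rewrite add0r oner_eq0.
Qed.

Lemma prime_ext (L : comNzRingType) (I I' : L -> Prop) :
  (forall p, I p <-> I' p) -> prime_ideal I -> prime_ideal I'.
Proof. by move=> eqI; rewrite (_ : I = I') //; apply/funext => p; apply/propext. Qed.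

Section LinearForms.
Variable K : fieldType.
Local Notation R := {mpoly K[4]}.
Implicit Types (u : K * K).

Definition lin u : R := u.1 *: 'X_iz + u.2 *: 'X_it.

Lemma lin_homog u : lin u \is 1.-homog.
Proof. by apply: rpredD; apply: dhomogZ; apply: homog_var. Qed.

Lemma lin_fixed s u : iz \notin s -> it \notin s -> fixed_off s (lin u).
Proof. by move=> sz st; apply: fixedD; apply: fixedZ; apply: fixed_var. Qed.

Lemma lin_neq0 u : u != (0, 0) -> lin u != 0.
Proof.
apply: contraNneq => u0.
have u1 : u.1 = 0.
  have := congr1 (comp_mpoly (subst1 K it)) u0.
  rewrite raddf0 rmorphD /= !comp_mpolyZ !substX !tnth_mktuple /= scaler0 addr0 => /eqP.
  by rewrite scaler_eq0 (negPf (mpolyX_neq0 K iz)) orbF => /eqP.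
have /eqP := u0; rewrite /lin u1 scale0r add0r scaler_eq0 (negPf (mpolyX_neq0 K it)) orbF.
by move=> /eqP u2; rewrite [u]surjective_pairing u1 u2.
Qed.

End LinearForms.

(** On the surface y = 0, the zero locus of a is an integral curve on which f does
    not vanish identically. *)
Definition transverse (R : comNzRingType) (y a f : R) : Prop :=
  [/\ ~ idgen [:: y] a, prime_ideal (idgen [:: y; a]) & ~ idgen [:: y; a] f].

Lemma idgen2_shift (R : comNzRingType) (y b p : R) :
  idgen [:: y; b + y] p <-> idgen [:: y; b] p.
Proof.
split=> /idgen2[u [v ->]]; apply/idgen2; first by exists (u + v), v; ring.
by exists (u - v), v; ring.
Qed.

Section TransversalForms.
Variable K : closedFieldType.
Local Notation R := {mpoly K[4]}.
Implicit Types (f g l : R) (P : R -> Prop).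

Lemma transversal_generic j k g l f : j != k ->
    fixed_off [:: j; k] g -> fixed_off [:: j; k] l ->
    g \is 1.-homog -> l \is 1.-homog -> l != 0 -> ~ idgen [:: 'X_j] f ->
  exists bad : seq K, forall c, c \notin bad ->
    transverse 'X_j ('X_k - (g + c *: l)) f.
Proof.
move=> jk fg fl hg hl l0 fj; have [bad badP] := generic_avoid jk fg fl hg hl l0 fj.
exists bad => c cP; have fgl : fixed_off [:: j; k] (g + c *: l).
  by apply: fixedD => //; apply: fixedZ.
split; [|exact: prime2|exact: badP].
move/kernel1; rewrite rmorphB /= substX tnth_mktuple eq_sym (negPf jk).
rewrite fixed_subst1; last first.
  by apply: fixed_weaken fgl => i; rewrite !inE => ->.
move/eqP; rewrite subr_eq0 => /eqP eq_k.
have := congr1 (comp_mpoly (subst2 j k 0)) eq_k; rewrite (fixed_subst2 _ fgl) substX subst2E.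
rewrite eq_sym (negPf jk) eqxx -eq_k => /esym/eqP.
by rewrite (negPf (mpolyX_neq0 K k)).
Qed.

Variables (i j : 'I_4).
Hypotheses (ij : i != j) (ijz : iz \notin [:: i; j]) (ijt : it \notin [:: i; j]).

(** With L = lin u, the form x + y - c L vanishes at P and restricts to the planes
    x = 0 and y = 0 as y - c L and x - c L, which are generic for all but finitely
    many c. *)
Lemma transversal_on_line P u f f' : is_ideal P -> P 'X_i -> P 'X_j -> P (lin u) ->
    u != (0, 0) -> ~ idgen [:: 'X_j] f -> ~ idgen [:: 'X_i] f' ->
  exists a, [/\ a \is 1.-homog, P a, transverse 'X_j a f & transverse 'X_i a f'].
Proof.
move=> iP Pi Pj Pu u0 fj fi; case: (iP) => _ PD _; have hu := lin_homog u.
have l0 := lin_neq0 u0; have h0 : (0 : R) \is 1.-homog by apply: dhomog0.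
have fu := lin_fixed u ijz ijt.
have fu' : fixed_off [:: j; i] (lin u).
  by apply: fixed_weaken fu => k; rewrite !inE orbC.
have ji : j != i by rewrite eq_sym.
have [bad badP] := transversal_generic ji (@fixed0 K _) fu' h0 hu l0 fj.
have [bad' badP'] := transversal_generic ij (@fixed0 K _) fu h0 hu l0 fi.
have [c] := closed_field_fresh (bad ++ bad').
rewrite mem_cat negb_or => /andP[/badP[nj pj Vj] /badP'[ni pi Vi]].
exists ('X_i - (0 + c *: lin u) + 'X_j); split.
- by rewrite add0r rpredD ?rpredB ?homog_var ?dhomogZ.
- apply: (PD) => //; apply: ideal_sub => //; rewrite add0r; exact: ideal_scale.
- split; [|by apply: prime_ext pj => p; apply: iff_sym; apply: idgen2_shift|by move/idgen2_shift].
  move=> /idgen1[r eq_r]; apply: nj; apply/idgen1; exists (r - 1).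
  by rewrite mulrBl mul1r -eq_r addrK.
have -> : 'X_i - (0 + c *: lin u) + 'X_j = 'X_j - (0 + c *: lin u) + 'X_i.
  by rewrite addrAC [RHS]addrAC ['X_i + _]addrC.
split; [|by apply: prime_ext pi => p; apply: iff_sym; apply: idgen2_shift|by move/idgen2_shift].
move=> /idgen1[r eq_r]; apply: ni; apply/idgen1; exists (r - 1).
by rewrite mulrBl mul1r -eq_r addrK.
Qed.

(** P contains z - al x and t - be x for some scalars al and be, and a generic
    combination of these two linear forms will do. *)
Lemma transversal_off_line P f : is_projpt P -> (exists N, forall n, (hf P n <= N)%N) ->
    ~ P 'X_i -> P 'X_j -> ~ idgen [:: 'X_j] f ->
  exists a, [/\ a \is 1.-homog, P a & transverse 'X_j a f].
Proof.
move=> projP [N bP] Pi Pj fj; have [[iP P1 Pp] _ _] := projP; case: (iP) => _ PD _.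
have form k : exists c : K, P ('X_k - c *: 'X_i).
  have [u [u0 Pu]] := bounded_linear_form projP bP (homog_var k) (homog_var i).
  have u1 : u.1 != 0.
    apply: contra_notN Pi => /eqP u1; rewrite u1 scale0r add0r in Pu.
    have u2 : u.2 != 0.
      by apply: contraNneq u0 => u2; rewrite [u]surjective_pairing u1 u2.
    by rewrite -['X_i]scale1r -(mulVf u2) -scalerA; apply: ideal_scale.
  exists (- (u.1^-1 * u.2)); rewrite scaleNr opprK.
  by rewrite -['X_k]scale1r -(mulVf u1) -!scalerA -scalerDr; apply: ideal_scale.
have [[al Pal] [be Pbe]] := (form iz, form it).
move: ijz ijt; rewrite !inE !negb_or => /andP[zi zj] /andP[ti tj].
have iv : i \notin [:: j; iz] by rewrite !inE negb_or ij eq_sym.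
have fg : fixed_off [:: j; iz] (al *: 'X_i : R) by apply: fixedZ; apply: fixed_var.
have fl : fixed_off [:: j; iz] ('X_it - be *: 'X_i : R).
  rewrite -scaleNr; apply: fixedD; last by apply: fixedZ; apply: fixed_var.
  by apply: fixed_var; rewrite !inE negb_or tj.
have hg : (al *: 'X_i : R) \is 1.-homog by rewrite dhomogZ ?homog_var.
have hl : ('X_it - be *: 'X_i : R) \is 1.-homog by rewrite rpredB ?dhomogZ ?homog_var.
have l0 : ('X_it - be *: 'X_i : R) != 0.
  apply/eqP => /(congr1 (comp_mpoly (subst1 K i))).
  rewrite raddf0 rmorphB /= comp_mpolyZ !substX !tnth_mktuple eqxx (negPf ti) scaler0 subr0.
  by move/eqP; rewrite (negPf (mpolyX_neq0 K it)).
have jz : j != iz by rewrite eq_sym.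
have [bad badP] := transversal_generic jz fg fl hg hl l0 fj.
have [c /badP trc] := closed_field_fresh bad.
exists ('X_iz - (al *: 'X_i + c *: ('X_it - be *: 'X_i))); split=> //.
  by apply: rpredB; [exact: homog_var | apply: rpredD hg _; exact: dhomogZ].
rewrite opprD addrA; apply: ideal_sub => //; exact: ideal_scale.
Qed.

End TransversalForms.

(** * Closed points over J *)

Record graded_config (K : fieldType) (i j : 'I_4) (A B F G h : {mpoly K[4]})
    (du dv df dg d4 : nat) : Prop := GradedConfig {
  gc_ij : i != j;
  gc_z : iz \notin [:: i; j];
  gc_t : it \notin [:: i; j];
  gc_cfg : config 'X_i 'X_j A B F G h;
  gc_U : 'X_j * B + h * G \is du.-homog;
  gc_V : 'X_i * A + h * F \is dv.-homog;
  gc_F : F \is df.-homog;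
  gc_G : G \is dg.-homog;
  gc_last : 'X_i * A * G + 'X_j * B * F + h * F * G \is d4.-homog }.

Lemma graded_config_sym (K : fieldType) i j (A B F G h : {mpoly K[4]}) du dv df dg d4 :
  graded_config i j A B F G h du dv df dg d4 -> graded_config j i B A G F h dv du dg df d4.
Proof.
case=> ij jz jt cfg hU hV hF hG h4; split=> //.
- by rewrite eq_sym.
- by apply: contra jz; rewrite !inE orbC.
- by apply: contra jt; rewrite !inE orbC.
- exact: config_sym.
- have -> // : 'X_j * B * F + 'X_i * A * G + h * G * F =
    'X_i * A * G + 'X_j * B * F + h * F * G by ring.
Qed.

Section OneSide.
Variable K : closedFieldType.
Local Notation R := {mpoly K[4]}.
Variables (i j : 'I_4) (A B F G h : R) (du dv df dg d4 : nat).
Hypothesis gc : graded_config i j A B F G h du dv df dg d4.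
Local Notation x := ('X_i : R).
Local Notation y := ('X_j : R).
Local Notation U := (y * B + h * G).
Local Notation V := (x * A + h * F).
Local Notation J := (double_ideal x y A B F G h).
Implicit Types (P Q : R -> Prop) (p : R).

Lemma double_is_ideal : is_ideal J.
Proof. exact: idgen_ideal. Qed.

Lemma double_homog : homog_ideal J.
Proof.
apply: homog_ideal_idgen => b; rewrite !inE => /or4P[]/eqP->.
- by exists 2%N; apply: (@dhomogM _ _ _ 1 _ 1); apply: homog_var.
- by exists (1 + dv)%N; apply: dhomogM; [exact: homog_var | exact: gc_V gc].
- by exists (1 + du)%N; apply: dhomogM; [exact: homog_var | exact: gc_U gc].
- by exists d4; exact: gc_last gc.
Qed.

(** The form a is a nonzerodivisor modulo (y, V), so that P is not minimal over
    (y, V), which contains J. *)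
Lemma smaller_transversal P a : is_projpt P -> P y -> P V -> a \is 1.-homog -> P a ->
  transverse y a V -> exists Q, [/\ on_proj J Q, sub_ideal Q P & ~ sub_ideal P Q].
Proof.
move=> projP Py PV ha Pa [ya pya Va]; have [[iP P1 Pp] _ _] := projP.
pose I := idgen [:: y; V]; have iI : is_ideal I by apply: idgen_ideal.
have hI : homog_ideal I.
  apply: homog_ideal_idgen => b; rewrite !inE => /orP[]/eqP->; first by exists 1%N; apply: homog_var.
  by exists dv; exact: gc_V gc.
have IP : sub_ideal I P by apply: idgen_sub => // b; rewrite !inE => /orP[]/eqP->.
have [|Q [projQ IQ QP Qa]] := homog_prime_below iI hI projP IP ha Pa.
  move=> b k Pb; elim: k => [|k IHk]; first by rewrite mulr1 => /IP.
  by rewrite exprS mulrCA => /(nzd_yV (gc_cfg gc) ya pya Va).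
exists Q; split=> //; last by move=> PQ; apply: Qa; apply: PQ.
by split=> // b /double_ideal_sub_yV; apply: IQ.
Qed.

Lemma smaller_off_line P : on_proj J P -> (exists N, forall n, (hf P n <= N)%N) ->
  ~ P x -> exists Q, [/\ on_proj J Q, sub_ideal Q P & ~ sub_ideal P Q].
Proof.
move=> [projP JP] bP Px; have [[iP P1 Pp] _ _] := projP.
have Py : P y.
  have /Pp[] // : P (x * y) by apply: JP; apply: idgen_mem; apply: mem_head.
have PV : P V.
  have /Pp[] // : P (x * V) by apply: JP; apply: idgen_mem; rewrite !inE eqxx orbT.
have [a [ha Pa tra]] := transversal_off_line (gc_ij gc) (gc_z gc) (gc_t gc) projP bP Px Py (cfg_V (gc_cfg gc)).
exact: smaller_transversal tra.
Qed.

Lemma nonzerodivisor_off_line P : on_proj J P -> (exists N, forall n, (hf P n <= N)%N) ->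
  ~ P x -> exists a, [/\ a \is 1.-homog, P a & forall p, J (a * p) -> J (x * p)].
Proof.
move=> [projP JP] bP Px; have [[iP P1 Pp] _ _] := projP.
have Py : P y.
  have /Pp[] // : P (x * y) by apply: JP; apply: idgen_mem; apply: mem_head.
have [a [ha Pa [ya pya Va]]] := transversal_off_line (gc_ij gc) (gc_z gc) (gc_t gc) projP bP Px Py (cfg_V (gc_cfg gc)).
by exists a; split=> // p; apply: (double_nzd_x (gc_cfg gc) ya pya Va).
Qed.

End OneSide.

Section BothSides.
Variable K : closedFieldType.
Local Notation R := {mpoly K[4]}.
Variables (i j : 'I_4) (A B F G h : R) (du dv df dg d4 : nat).
Hypothesis gc : graded_config i j A B F G h du dv df dg d4.
Local Notation x := ('X_i : R).
Local Notation y := ('X_j : R).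
Local Notation U := (y * B + h * G).
Local Notation V := (x * A + h * F).
Local Notation J := (double_ideal x y A B F G h).
Implicit Types (P Q : R -> Prop) (p : R).

Let gc' := graded_config_sym gc.

Lemma on_proj_sym P : on_proj (double_ideal y x B A G F h) P <-> on_proj J P.
Proof.
split=> -[projP JP]; (split; first exact: projP) => p Jp; apply: JP;
  exact/double_ideal_sym.
Qed.

(** On the line x = y = 0, F U is congruent to the last generator of J, and V
    vanishes with F; so U or V vanishes at P. *)
Lemma smaller_on_line P u : on_proj J P -> P x -> P y -> P (lin u) -> u != (0, 0) ->
  exists Q, [/\ on_proj J Q, sub_ideal Q P & ~ sub_ideal P Q].
Proof.
move=> JP Px Py Pu u0; have [projP subJP] := JP; have [[iP P1 Pp] _ _] := projP.
case: (iP) => _ PD PM; have cfg := gc_cfg gc.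
have [a [ha Pa try trx]] :=
  transversal_on_line (gc_ij gc) (gc_z gc) (gc_t gc) iP Px Py Pu u0 (cfg_V cfg) (cfg_U cfg).
have [PV|nPV] := pselect (P V); first exact: (smaller_transversal gc) try.
have PU : P U.
  have /Pp[|//] : P (F * U).
    have -> : F * U = x * A * G + y * B * F + h * F * G - A * G * x by ring.
    apply: ideal_sub => //; last exact: PM.
    by apply: subJP; apply: idgen_mem; rewrite !inE eqxx !orbT.
  move=> PF; case: nPV; apply: PD; last exact: PM.
  exact: ideal_mulr.
have [Q [JQ QP nPQ]] := smaller_transversal gc' projP Px PU ha Pa trx.
by exists Q; split; [exact/on_proj_sym | exact: QP | exact: nPQ].
Qed.

(** A point with bounded Hilbert function is closed, hence contains the linear
    forms needed to find a smaller prime over (y, V) or (x, U). *)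
Lemma smaller_point P : on_proj J P -> (exists N, forall n, (hf P n <= N)%N) ->
  exists Q, [/\ on_proj J Q, sub_ideal Q P & ~ sub_ideal P Q].
Proof.
move=> JP bP; have [Px|Px] := pselect (P x); last exact: smaller_off_line gc _ JP bP Px.
have [Py|Py] := pselect (P y); last first.
  have [Q [JQ QP nPQ]] := smaller_off_line gc' ((on_proj_sym P).2 JP) bP Py.
  by exists Q; split; [exact/on_proj_sym | exact: QP | exact: nPQ].
case: bP => N bP; have [u [u0 Pu]] := bounded_linear_form JP.1 bP (homog_var iz) (homog_var it).
exact: smaller_on_line Pu u0.
Qed.

(** One of x, y, F and G is invertible at P, and a generic linear form through P
    is then a nonzerodivisor modulo J, by the local form of J there. *)
Lemma nonzerodivisor P : on_proj J P -> (exists N, forall n, (hf P n <= N)%N) ->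
    ~ [/\ P x, P y, P F & P G] ->
  exists a r e, [/\ a \is 1.-homog, P a, r \is e.-homog, ~ P r & forall p, J (a * p) -> J (r * p)].
Proof.
move=> JP bP nP; have [Px|Px] := pselect (P x); last first.
  have [a [ha Pa nzd]] := nonzerodivisor_off_line gc JP bP Px.
  by exists a, x, 1%N; split=> //; apply: homog_var.
have [Py|Py] := pselect (P y); last first.
  have [a [ha Pa nzd]] := nonzerodivisor_off_line gc' ((on_proj_sym P).2 JP) bP Py.
  exists a, y, 1%N; split; [exact: ha | exact: Pa | exact: homog_var | exact: Py |].
  by move=> p /double_ideal_sym/nzd/double_ideal_sym.
have [[iP _ _] _ _] := JP.1.
case: bP => N bP; have [u [u0 Pu]] := bounded_linear_form JP.1 bP (homog_var iz) (homog_var it).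
have cfg := gc_cfg gc; have cfg' := gc_cfg gc'.
have [a [ha Pa [ya pya Va] [xa pxa Ua]]] :=
  transversal_on_line (gc_ij gc) (gc_z gc) (gc_t gc) iP Px Py Pu u0 (cfg_V cfg) (cfg_U cfg).
have sub b : P b -> sub_ideal (idgen [:: b; a]) P.
  by move=> Pb; apply: idgen_sub => // c; rewrite !inE => /orP[]/eqP->.
have [PF|PF] := pselect (P F); last first.
  exists a, F, df; split=> //; first exact: gc_F gc.
  by move=> p; apply: (double_nzd_F cfg ya pya Va xa pxa Ua) => /(sub _ Px).
have PG : ~ P G by move=> PG; apply: nP.
exists a, G, dg; split=> //; first exact: gc_G gc.
move=> p /double_ideal_sym Jp; apply/double_ideal_sym.
by apply: (double_nzd_F cfg' xa pxa Ua ya pya Va) Jp => /(sub _ Py).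
Qed.

End BothSides.

(** * The Hilbert polynomial of J *)

Section EventualHilbert.
Variable K : fieldType.
Local Notation R := {mpoly K[4]}.
Implicit Types (I : R -> Prop) (f p : R) (e n : nat) (g : nat -> rat) (s : seq R).

Definition hf_ev I g := exists n0, forall n, (n0 <= n)%N -> (hf I n)%:R = g n.

Lemma hf_ev_ext I I' g : (forall p, I p <-> I' p) -> hf_ev I g -> hf_ev I' g.
Proof.
by move=> eqI [n0 gE]; exists n0 => n le_n; rewrite -gE // (hf_ext _ eqI).
Qed.

Lemma hf_ev_quot I f e g : is_ideal I -> homog_ideal I -> f \is e.-homog ->
    (forall p, I (f * p) -> I p) -> hf_ev I g ->
  hf_ev (idadd I [:: f]) (fun n => g n - g (n - e)%N).
Proof.
move=> iI hI hf_e nzd [n0 gE]; exists (n0 + e)%N => n le_n.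
rewrite -gE; last by lia.
rewrite -gE; last by lia.
have eq_n : (e + (n - e) = n)%N by lia.
have := hf_exact hf_e (n - e)%N iI hI; rewrite eq_n.
rewrite (@hf_ext _ (fun p => I (f * p)) I) => [->|p]; last first.
  by split=> [/nzd//|Ip]; case: iI => _ _; apply.
by rewrite natrD [X in _ = X - _]addrC addrK.
Qed.

Lemma hf_ev_add I f e g g' : is_ideal I -> homog_ideal I -> f \is e.-homog ->
    hf_ev (fun p => I (f * p)) g -> hf_ev (idadd I [:: f]) g' ->
  hf_ev I (fun n => g (n - e)%N + g' n).
Proof.
move=> iI hI hf_e [n0 gE] [n1 gE']; exists (n0 + n1 + e)%N => n le_n.
rewrite -gE; last by lia.
rewrite -gE'; last by lia.
have eq_n : (e + (n - e) = n)%N by lia.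
by rewrite -natrD -[in RHS]eq_n addKn -(hf_exact hf_e (n - e)%N iI hI) eq_n.
Qed.

Lemma idadd_idgen s f p : idadd (idgen s) [:: f] p <-> idgen (f :: s) p.
Proof. by rewrite idadd1; split=> [[u su]|/idgen_cons//]; apply/idgen_cons; exists u. Qed.

Lemma hf_polynomial_ring n : hf (idgen [::] : R -> Prop) n = 'C(n + 3, 3).
Proof.
rewrite /hf dim_dhomog (_ : piece _ n = 0%VS) ?dimv0 ?subn0 //.
apply/vspaceP => p; rewrite memv0; apply/idP/eqP => [|->]; last exact: mem0v.
move/(pieceP _ (idgen_ideal _))/idgen_nil => p0; exact: val_inj.
Qed.

Lemma hf_plane i n : (0 < n)%N -> hf (idgen [:: 'X_i : R]) n = 'C(n + 2, 2).
Proof.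
case: n => // n _; have i0 := idgen_ideal ([::] : seq R).
have h0 : homog_ideal (idgen ([::] : seq R)) by apply: homog_ideal_idgen.
have := hf_exact (homog_var i) n i0 h0; rewrite !hf_polynomial_ring add1n.
rewrite (@hf_ext _ (fun p => idgen [::] ('X_i * p)) (idgen [::])); last first.
  move=> p; split=> /idgen_nil; last by move=> ->; rewrite mulr0; apply/idgen_nil.
  by move/eqP; rewrite mulf_eq0 (negPf (mpolyX_neq0 K i)) => /eqP; move/idgen_nil.
rewrite (@hf_ext _ (idadd _ _) (idgen [:: 'X_i])); last exact: idadd_idgen.
rewrite hf_polynomial_ring [(n.+1 + 3)%N]addSn binS => /addnI <-.
by rewrite addSn addnS.
Qed.

Lemma hf_ev_plane i : hf_ev (idgen [:: 'X_i : R])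
  (fun n => (n%:R + 2) * (n%:R + 1) / 2).
Proof.
exists 1%N => n n_gt0; rewrite hf_plane //.
have := mul_bin_diag (n + 2) 1; rewrite addn2 /= bin1 => /(congr1 (fun m : nat => m%:R : rat)).
rewrite !natrM -[n.+2]addn2 -[n.+1]addn1 !natrD => eq_n.
by rewrite eq_n mulrC mulKf.
Qed.

Lemma homog_ideal_plane i : homog_ideal (idgen [:: 'X_i : R]).
Proof. by apply: homog_ideal_idgen => a; rewrite inE => /eqP->; exists 1%N; apply: homog_var. Qed.

Lemma hf_ev_plane_curve i f e : f \is e.-homog -> ~ idgen [:: 'X_i] f ->
  exists n0, forall n, (n0 <= n)%N ->
    (hf (idgen [:: 'X_i; f]) n)%:R = e%:R * n%:R + e%:R * (3 - e%:R) / 2 :> rat.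
Proof.
move=> hf_e fi; have [_ _ pp] := @prime1 K i.
have [|n0 gE] := hf_ev_quot (idgen_ideal _) (@homog_ideal_plane i) hf_e _ (hf_ev_plane i).
  by move=> p /pp[].
exists (n0 + e)%N => n le_n.
rewrite -(@hf_ext _ (idadd (idgen [:: 'X_i]) [:: f])); last first.
  by move=> p; rewrite idadd_idgen idgen_swap.
rewrite gE; last by lia.
rewrite natrB; last by lia.
by field.
Qed.

Lemma hf_ev_points i j f e : prime_ideal (idgen [:: 'X_i : R; 'X_j]) ->
    ~ idgen [:: 'X_i] ('X_j : R) -> f \is e.-homog -> ~ idgen [:: 'X_i; 'X_j] f ->
  hf_ev (idgen [:: 'X_i; 'X_j; f]) (fun=> e%:R).
Proof.
move=> [_ _ pp] ji hf_e fij.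
have [n0 gE] := hf_ev_plane_curve (homog_var j) ji.
have hij : homog_ideal (idgen [:: 'X_i : R; 'X_j]).
  by apply: homog_ideal_idgen => a; rewrite !inE => /orP[]/eqP->; exists 1%N; apply: homog_var.
have [|n1 gE'] := hf_ev_quot (idgen_ideal _) hij hf_e _ (ex_intro _ n0 gE).
  by move=> p /pp[].
exists (n1 + e)%N => n le_n.
rewrite -(@hf_ext _ (idadd (idgen [:: 'X_i; 'X_j]) [:: f])); last first.
  move=> p; rewrite idadd_idgen; split=> /idgen3[u [v [w ->]]]; apply/idgen3.
    by exists v, w, u; ring.
  by exists w, u, v; ring.
rewrite gE'; last by lia.
rewrite natrB; last by lia.
by field.
Qed.

End EventualHilbert.

Section DoubleHilbert.
Variable K : closedFieldType.
Local Notation R := {mpoly K[4]}.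
Variables (i j : 'I_4) (A B F G h : R) (du dv df dg d4 : nat).
Hypothesis gc : graded_config i j A B F G h du dv df dg d4.
Local Notation x := ('X_i : R).
Local Notation y := ('X_j : R).
Local Notation U := (y * B + h * G).
Local Notation V := (x * A + h * F).
Local Notation J := (double_ideal x y A B F G h).

(** Two applications of [hf_exact]: J : x is the ideal (y, V) of a plane curve of
    degree dv; and J + (x), which is generated by x, y U and F U, is filtered by
    the plane curve (x, U), of degree du, and the finite scheme (x, y, F). *)
Lemma hf_ev_double : exists c : rat, hf_ev J (fun n => (du + dv)%:R * n%:R + c).
Proof.
have cfg := gc_cfg gc; have hU := gc_U gc.
have hJ := double_homog gc; have iJ := double_is_ideal i j A B F G h.
have [nV gV] := hf_ev_plane_curve (gc_V gc) (cfg_V cfg).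
have [nU gU] := hf_ev_plane_curve hU (cfg_U cfg).
have gF := hf_ev_points (cfg_xy cfg) (cfg_y_x cfg) (gc_F gc) (cfg_F cfg).
pose I1 := idgen [:: x; y * U; F * U].
have h1 : homog_ideal I1.
  apply: homog_ideal_idgen => a; rewrite !inE => /or3P[]/eqP->.
  - by exists 1%N; apply: homog_var.
  - by exists (1 + du)%N; apply: dhomogM hU; apply: homog_var.
  - by exists (df + du)%N; apply: dhomogM hU; apply: gc_F gc.
have g1 := hf_ev_add (idgen_ideal _) h1 hU
  (hf_ev_ext (fun p => iff_sym (add_x_colon_U cfg p)) gF)
  (hf_ev_ext (fun p => iff_sym (add_x_U x y B F G h p)) (ex_intro _ nU gU)).
have [n0 gJ] := hf_ev_add iJ hJ (homog_var i)
  (hf_ev_ext (fun p => iff_sym (double_colon_x cfg p)) (ex_intro _ nV gV))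
  (hf_ev_ext (fun p => iff_sym (double_add_x x y A B F G h p)) g1).
exists (dv%:R * (3 - dv%:R) / 2 + du%:R * (3 - du%:R) / 2 + df%:R - dv%:R).
exists n0.+1 => n le_n; rewrite gJ; last by lia.
by rewrite natrB ?natrD; [field | lia].
Qed.

End DoubleHilbert.

(** * Common zeros of F and G on the line x = y = 0 *)

Section AxisPoints.
Variable K : closedFieldType.
Local Notation R := {mpoly K[4]}.
Local Notation x := ('X_ix : R).
Local Notation y := ('X_iy : R).
Implicit Types (F G a p : R) (u : K * K) (P : R -> Prop).

(** The closed point of the line x = y = 0 where lin u vanishes, if u is nonzero. *)
Definition axis_pt u : R -> Prop := idgen [:: x; y; lin u].

Lemma axis_x u : axis_pt u x.
Proof. by apply: idgen_mem; rewrite mem_head. Qed.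

Lemma axis_y u : axis_pt u y.
Proof. by apply: idgen_mem; rewrite !inE eqxx orbT. Qed.

Lemma axis_lin u : axis_pt u (lin u).
Proof. by apply: idgen_mem; rewrite !inE eqxx !orbT. Qed.

(** With m such that lin u and lin m form a basis, of determinant 1, of the linear
    forms in z and t, the ideal of the point is the kernel of the substitution
    that kills x, y and lin u and fixes lin m. *)
Lemma axis_kernel u : u != (0, 0) -> exists (w : 4.-tuple R) (m : K * K),
  [/\ forall p, axis_pt u p <-> p \mPo w = 0, (lin m : R) \mPo w = lin m & lin m != 0 :> R].
Proof.
move=> u0; have [m um] : exists m : K * K, u.1 * m.2 - u.2 * m.1 = 1.
  have [u1|u1] := eqVneq u.1 0.
    have u2 : u.2 != 0 by apply: contraNneq u0 => u2; rewrite [u]surjective_pairing u1 u2.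
    by exists (- u.2^-1, 0); rewrite /= u1 mul0r sub0r mulrN opprK mulfV.
  by exists (0, u.1^-1); rewrite /= mulr0 subr0 mulfV.
have um' : u.1%:MP * m.2%:MP - u.2%:MP * m.1%:MP = 1 :> R.
  by rewrite -!mpolyCM -mpolyCB um.
pose M : R := lin m; pose w : 4.-tuple R := [tuple 0; 0; - u.2 *: M; u.1 *: M].
have wx : x \mPo w = 0 by rewrite substX.
have wy : y \mPo w = 0 by rewrite substX.
have wz : ('X_iz : R) \mPo w = - u.2 *: M by rewrite substX.
have wt : ('X_it : R) \mPo w = u.1 *: M by rewrite substX.
have eM : M \mPo w = M.
  rewrite /M /lin rmorphD /= !comp_mpolyZ wz wt !scalerA -scalerDl.
  by rewrite (_ : _ + _ = 1) ?scale1r // -um; ring.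
exists w, m; split=> //; last first.
  apply: lin_neq0; apply/eqP => m0; move: um; rewrite m0 /= !mulr0 subr0 => /eqP.
  by rewrite eq_sym oner_eq0.
apply: idgen_kernel => [i|l]; last first.
  rewrite !inE => /or3P[]/eqP-> //.
  by rewrite rmorphD /= !comp_mpolyZ wz wt !scalerA -scalerDl mulrN addrC mulrC subrr scale0r.
have lin_mul (c : K) (q : R) : q = c *: lin u -> axis_pt u q.
  by move=> ->; apply: ideal_scale; [exact: idgen_ideal | exact: axis_lin].
case: i => -[|[|[|[|//]]]] lt4.
- by rewrite (_ : Ordinal lt4 = ix) ?subr0; [exact: axis_x | exact: val_inj].
- by rewrite (_ : Ordinal lt4 = iy) ?subr0; [exact: axis_y | exact: val_inj].
- rewrite (_ : Ordinal lt4 = iz); last exact: val_inj.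
  apply: (lin_mul m.2); rewrite /M /lin /tnth /= -!mul_mpolyC -[X in X - _]mul1r -um'.
  by rewrite mpolyCN /M /lin -!mul_mpolyC; ring.
- rewrite (_ : Ordinal lt4 = it); last exact: val_inj.
  apply: (lin_mul (- m.1)); rewrite /M /lin /tnth /= -!mul_mpolyC -[X in X - _]mul1r -um'.
  by rewrite mpolyCN /M /lin -!mul_mpolyC; ring.
Qed.

Lemma axis_prime u : u != (0, 0) -> prime_ideal (axis_pt u).
Proof. by move/axis_kernel => [w [m [kerw _ _]]]; apply: kernel_prime kerw. Qed.

Lemma axis_projpt u : u != (0, 0) -> is_projpt (axis_pt u).
Proof.
move=> u0; split; first exact: axis_prime.
  apply: homog_ideal_idgen => a; rewrite !inE => /or3P[]/eqP->; exists 1%N.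
  - exact: homog_var.
  - exact: homog_var.
  - exact: lin_homog.
move=> irr; have [w [m [kerw eM M0]]] := axis_kernel u0.
have : axis_pt u (lin m).
  case: (idgen_ideal [:: x; y; lin u]) => _ sD _.
  by apply: sD; apply: ideal_scale; rewrite -/(axis_pt u);
    first [exact: idgen_ideal | apply: irr; apply: irrelevant_var].
by move/kerw; rewrite eM => /eqP; rewrite (negPf M0).
Qed.

Lemma axis_kernel_line p : idgen [:: x; y] p <-> p \mPo subst2 ix iy 0 = 0.
Proof. by rewrite -kernel2 ?subr0 //; apply: fixed0. Qed.

Lemma line_prime : prime_ideal (idgen [:: x; y]).
Proof. exact: kernel_prime axis_kernel_line. Qed.

Lemma fixed_line_neq0 p : fixed_off [:: ix; iy] p -> p != 0 -> ~ idgen [:: x; y] p.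
Proof. by move=> fp p0 /axis_kernel_line; rewrite fixed_subst2 // => /eqP; rewrite (negPf p0). Qed.

Lemma lin_fixed_line u : fixed_off [:: ix; iy] (lin u : R).
Proof. exact: lin_fixed. Qed.

Lemma lin_line u : u != (0, 0) -> ~ idgen [:: x; y] (lin u).
Proof. by move=> u0; apply: fixed_line_neq0; [exact: lin_fixed_line | exact: lin_neq0]. Qed.

Lemma axis_dvd F u : fixed_off [:: ix; iy] F -> u != (0, 0) -> axis_pt u F ->
  exists F', F = lin u * F' /\ F' \mPo subst2 ix iy 0 = F'.
Proof.
move=> fF u0 /idgen3[a [b [c eq_F]]]; set w := subst2 ix iy 0.
have eF : F = lin u * (c \mPo w).
  have /(congr1 (comp_mpoly w)) := eq_F.
  rewrite (fixed_subst2 _ fF) 2!rmorphD !rmorphM /= !substX !subst2E /= !mulr0 !add0r.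
  by rewrite (fixed_subst2 _ (lin_fixed_line u)) mulrC.
exists (c \mPo w); split=> //; apply: (mulfI (lin_neq0 u0)); rewrite -eF.
have /(congr1 (comp_mpoly w)) := eF.
by rewrite (fixed_subst2 _ fF) rmorphM /= (fixed_subst2 _ (lin_fixed_line u)).
Qed.

Lemma split_form F d : free_of ix F -> free_of iy F -> F \is d.-homog -> F != 0 ->
  exists (c : K) (s : seq (K * K)), [/\ c != 0, size s = d,
    forall u, u \in s -> u != (0, 0) & F = c *: \prod_(u <- s) lin u].
Proof.
move=> fx fy /dhomogP hF F0.
pose p := \sum_(m <- msupp F) F@_m *: 'X^(m iz) : {poly K}.
have mzt m : m \in msupp F -> (m iz + m it = d)%N.
  move=> Fm; have : mdeg m = d := hF m Fm; rewrite mdegE.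
  have -> : (\sum_(i < 4) m i = m ix + (m iy + (m iz + m it)))%N.
    rewrite !big_ord_recl big_ord0 addn0.
    by congr (m _ + (m _ + (m _ + m _)))%N; exact: val_inj.
  by rewrite fx ?fy.
have szp : (size p <= d.+1)%N.
  rewrite /p big_seq; apply: (big_ind (fun q : {poly K} => size q <= d.+1)%N) => [|q r|m Fm].
  - by rewrite size_poly0.
  - by move=> szq szr; apply: leq_trans (size_polyD _ _) _; rewrite geq_max szq.
  - by apply: leq_trans (size_scale_leq _ _) _; rewrite size_polyXn ltnS -(mzt m Fm) leq_addr.
have eF : F = binary_form p d 'X_iz 'X_it.
  rewrite /binary_form; under eq_bigr => k _ do rewrite /p coef_sum scaler_suml.
  rewrite exchange_big [LHS]mpolyE big_seq [RHS]big_seq; apply: eq_bigr => m Fm /=.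
  have lt_m : (m iz < d.+1)%N by rewrite ltnS -(mzt m Fm) leq_addr.
  rewrite (bigD1 (Ordinal lt_m)) //= coefZ coefXn eqxx mulr1 big1 ?addr0 => [|k].
    have -> : (d - m iz = m it)%N by rewrite -(mzt m Fm) addKn.
    congr (_ *: _); rewrite mpolyXE_id !big_ord_recl big_ord0 mulr1.
    rewrite (_ : m ord0 = 0%N); last by rewrite (_ : ord0 = ix) ?fx //; exact: val_inj.
    rewrite (_ : m (lift ord0 ord0) = 0%N); last first.
      by rewrite (_ : lift _ _ = iy) ?fy //; exact: val_inj.
    by rewrite !expr0 !mul1r; congr ('X_ _ ^+ m _ * 'X_ _ ^+ m _); exact: val_inj.
  by rewrite -val_eqE /= => /negPf ne; rewrite coefZ coefXn ne mulr0 scale0r.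
have p0 : p != 0.
  apply: contraNneq F0 => p0; rewrite eF p0 /binary_form big1 // => k _.
  by rewrite coef0 scale0r.
have [c [s [c0 szs s0 eqs]]] := binary_form_split p0 szp.
by exists c, s; split=> //; rewrite eF eqs.
Qed.

Lemma homog_gt0 F d : F \is d.-homog -> (forall c : K, F <> c%:MP) -> (0 < d)%N.
Proof.
case: d => // hF Fc; case: (Fc F@_0); apply: msize1_polyC.
have [->|F0] := eqVneq F 0; first by rewrite mmeasure0.
by rewrite (msize_homog hF F0).
Qed.

(** If the determinant of u and v were nonzero, z and t would be combinations of
    lin u and lin v, and all variables would vanish at P. *)
Lemma lin_proportional P u v : is_projpt P -> P x -> P y -> u != (0, 0) ->
  P (lin u) -> P (lin v) -> exists c : K, lin v = c *: lin u.
Proof.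
move=> [[iP P1 Pp] hP rP] Px Py u0 Pu Pv; case: (iP) => P0 PD PM.
pose D := u.1 * v.2 - u.2 * v.1.
have D0 : D = 0.
  apply: contrapT => /eqP D0; apply: rP; apply: irrelevant_sub => // i.
  have scaleP (q : R) : P (D *: q) -> P q.
    by move=> Pq; rewrite -[q]scale1r -(mulVf D0) -scalerA; apply: ideal_scale.
  case: i => -[|[|[|[|//]]]] lt4.
  - by rewrite (_ : Ordinal lt4 = ix) //; exact: val_inj.
  - by rewrite (_ : Ordinal lt4 = iy) //; exact: val_inj.
  - rewrite (_ : Ordinal lt4 = iz); last exact: val_inj.
    apply: scaleP; have -> : D *: 'X_iz = v.2 *: lin u - u.2 *: lin v :> R.
      by rewrite /lin /D -!mul_mpolyC mpolyCB !mpolyCM; ring.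
    by apply: ideal_sub => //; apply: ideal_scale.
  - rewrite (_ : Ordinal lt4 = it); last exact: val_inj.
    apply: scaleP; have -> : D *: 'X_it = u.1 *: lin v - v.1 *: lin u :> R.
      by rewrite /lin /D -!mul_mpolyC mpolyCB !mpolyCM; ring.
    by apply: ideal_sub => //; apply: ideal_scale.
have D0' : u.1 * v.2 = u.2 * v.1 by apply/eqP; rewrite -subr_eq0 -/D D0.
have [u1|u1] := eqVneq u.1 0.
  have u2 : u.2 != 0 by apply: contraNneq u0 => u2; rewrite [u]surjective_pairing u1 u2.
  exists (v.2 / u.2); rewrite /lin u1 scale0r add0r scalerA divfK //.
  move/eqP: D0'; rewrite u1 mul0r eq_sym mulf_eq0 (negPf u2) => /eqP->.
  by rewrite scale0r add0r.
exists (v.1 / u.1); rewrite /lin scalerDr !scalerA divfK //; congr (_ + _ *: _).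
by apply: (mulfI u1); rewrite D0'; field.
Qed.

Lemma idadd_zero s p : idadd (@zero_ideal R) s p <-> idgen s p.
Proof.
split=> [[q ->]|]; first by rewrite subr0.
by move=> sp; exists 0; rewrite ?subr0.
Qed.

Section CommonRoot.
Variables (F G : R) (df dg : nat).
Hypotheses (Fx : free_of ix F) (Fy : free_of iy F) (Gx : free_of ix G) (Gy : free_of iy G).
Hypotheses (hF : F \is df.-homog) (hG : G \is dg.-homog).
Hypotheses (Fc : forall c : K, F <> c%:MP) (Gc : forall c : K, G <> c%:MP).

Let F0 : F != 0. Proof. by apply/eqP => F0; apply: (@Fc 0); rewrite F0 mpolyC0. Qed.
Let G0 : G != 0. Proof. by apply/eqP => G0; apply: (@Gc 0); rewrite G0 mpolyC0. Qed.

Lemma free_fixed_line p : free_of ix p -> free_of iy p -> fixed_off [:: ix; iy] p.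
Proof. by move=> px py; apply: free_fixed => i; rewrite !inE => /orP[]/eqP->. Qed.

Let fF := free_fixed_line Fx Fy.
Let fG := free_fixed_line Gx Gy.

Lemma form_root P d f : prime_ideal P -> free_of ix f -> free_of iy f -> f \is d.-homog ->
  f != 0 -> P f -> exists2 u, u != (0, 0) & P (lin u) /\ axis_pt u f.
Proof.
move=> [iP P1 Pp] fx fy hf f0; have [c [s [c0 _ s0 ->]]] := split_form fx fy hf f0.
move=> Pf; have {Pf} : P (\prod_(u <- s) lin u).
  by rewrite -[X in P X]scale1r -(mulVf c0) -scalerA; apply: ideal_scale.
elim: s s0 => [_|u s IHs s0]; first by rewrite big_nil.
rewrite big_cons => /Pp[Pu|Ps].
  exists u; first by apply: s0; apply: mem_head.
  split=> //; apply: ideal_scale; first exact: idgen_ideal.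
  by apply: ideal_mulr; [exact: idgen_ideal | exact: axis_lin].
have [|u' u0 [Pu' fu']] := IHs _ Ps.
  by move=> v sv; apply: s0; rewrite inE sv orbT.
exists u' => //; split=> //; rewrite scalerAr mulrC.
by apply: ideal_mulr => //; exact: idgen_ideal.
Qed.

Lemma common_root P : is_projpt P -> P x -> P y -> P F -> P G ->
  exists2 u, u != (0, 0) & axis_pt u F /\ axis_pt u G.
Proof.
move=> projP Px Py PF PG; have [pP _ _] := projP.
have [u u0 [Pu uF]] := form_root pP Fx Fy hF F0 PF.
have [v v0 [Pv vG]] := form_root pP Gx Gy hG G0 PG.
exists u; [exact: u0 | split; first exact: uF].
have [c eq_v] := lin_proportional projP Px Py u0 Pu Pv.
move: vG; apply: idgen_sub; first exact: idgen_ideal.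
move=> b; rewrite !inE => /or3P[]/eqP->; [exact: axis_x | exact: axis_y |].
by rewrite eq_v; apply: ideal_scale; [exact: idgen_ideal | exact: axis_lin].
Qed.

(** If F = L F' and G = L G', then G F' = F G', so that regularity puts F' in
    (x, y, F). Setting x = y = 0 makes F' a multiple of F = L F', and L a unit. *)
Lemma regular_no_common_root u : regular_seq (@zero_ideal R) [:: x; y; F; G] ->
  u != (0, 0) -> axis_pt u F -> axis_pt u G -> False.
Proof.
move=> [reg _] u0 uF uG.
have [F' [eF fF']] := axis_dvd fF u0 uF; have [G' [eG _]] := axis_dvd fG u0 uG.
have /idadd_zero/idgen3[a [b [c eq_F']]] : idadd (@zero_ideal R) [:: x; y; F] F'.
  apply: (reg 3 isT) => /=; apply/idadd_zero/idgen3; exists 0, 0, G'.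
  by rewrite eG eF; ring.
have [_ pt1 _] := axis_prime u0; apply: pt1.
have F'0 : F' != 0 by apply: contraNneq F0 => F'0; rewrite eF F'0 mulr0.
set w := subst2 ix iy 0 in fF'.
have eq1 : F' = (c \mPo w) * (lin u * F').
  have /(congr1 (comp_mpoly w)) := eq_F'.
  rewrite fF' 2!rmorphD !rmorphM /= !substX !subst2E /= !mulr0 !add0r.
  by rewrite (fixed_subst2 _ fF) -eF.
have -> : 1 = (c \mPo w) * lin u by apply: (mulIf F'0); rewrite mul1r {1}eq1; ring.
by rewrite mulrC; apply: ideal_mulr; [exact: idgen_ideal | exact: axis_lin].
Qed.

Lemma irrelevantP p : @irrelevant K p <-> p@_0 = 0.
Proof.
split=> [/idgen4[a [b [c [d ->]]]]|p0].
  have m0 (q : R) i : (q * 'X_i)@_0 = 0.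
    by rewrite rmorphM /= mcoeffX mnm1_eq0 mulr0.
  by rewrite !mcoeffD !m0 !addr0.
rewrite [p]mpolyE big_seq; apply: ideal_sum; first exact: idgen_ideal.
move=> m pm; apply: ideal_scale; first exact: idgen_ideal.
have m0 : m != 0%MM by apply: contraTneq pm => ->; rewrite mcoeff_msupp p0 eqxx.
have [i mi] : exists i, m i != 0%N.
  by apply: contrapT => ni; case/eqP: m0; apply/mnmP => i; rewrite mnm0E; apply: contrapT => /eqP mi; apply: ni; exists i.
rewrite mpolyXE_id (bigD1 i) //= -(prednK (n := m i)) ?lt0n // exprS -mulrA.
by apply: ideal_mulr; [exact: idgen_ideal | exact: irrelevant_var].
Qed.

Lemma irrelevant_homog d p : p \is d.-homog -> (0 < d)%N -> @irrelevant K p.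
Proof.
move=> hp d0; apply/irrelevantP; apply: (dhomog_nemf_coeff hp).
by rewrite mf0 eq_sym -lt0n.
Qed.

(** Each linear factor L of F is a nonzerodivisor modulo (x, y), and G is one
    modulo (x, y, L); so G is cancelled by induction on the number of factors. *)
Lemma no_common_root_regular :
  (forall u, u != (0, 0) -> axis_pt u F -> axis_pt u G -> False) ->
  regular_seq (@zero_ideal R) [:: x; y; F; G].
Proof.
move=> noc; have [_ _ ppl] := line_prime; have [_ _ ppx] := @prime1 K ix.
split.
  case=> [|[|[|[|//]]]] _ a /=; rewrite !idadd_zero.
  - by move=> /idgen_nil/eqP; rewrite mulf_eq0 (negPf (mpolyX_neq0 _ _)) => /eqP/idgen_nil.
  - move=> /ppx[|//] /kernel1/eqP; rewrite substX tnth_mktuple /=.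
    by rewrite (negPf (mpolyX_neq0 _ _)).
  - by move=> /ppl[|//] /(fixed_line_neq0 fF F0).
  have [c [s [c0 _ s0 eF]]] := split_form Fx Fy hF F0.
  have Gs u : u \in s -> ~ axis_pt u G.
    move=> su uG; apply: (noc u) => //; first exact: s0.
    rewrite eF; apply: ideal_scale; first exact: idgen_ideal.
    rewrite (big_rem u) //=; apply: ideal_mulr; [exact: idgen_ideal | exact: axis_lin].
  pose I t := idgen [:: x; y; \prod_(u <- t) lin u].
  have IF p : idgen [:: x; y; F] p <-> I s p.
    split=> /idgen3[a' [b' [e' ->]]]; apply/idgen3.
      by exists a', b', (c *: e'); rewrite eF -scalerAr -scalerAl.
    exists a', b', (c^-1 *: e'); rewrite eF -scalerAr -scalerAl scalerA mulfV //.
    by rewrite scale1r.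
  rewrite !IF; elim: s s0 Gs a {eF IF} => [|u s IHs] s0 Gs a.
    by move=> _; apply/idgen3; exists 0, 0, a; rewrite big_nil; ring.
  case/idgen3=> p [q [r eq_a]]; rewrite big_cons in eq_a.
  have u0 : u != (0, 0) by apply: s0; apply: mem_head.
  have [_ _ ppu] := axis_prime u0.
  have /ppu[/Gs|] : axis_pt u (G * a).
  - by apply/idgen3; exists p, q, (r * \prod_(v <- s) lin v); rewrite eq_a; ring.
  - by case; apply: mem_head.
  case/idgen3=> p' [q' [a' eq_a']].
  have /IHs : I s (G * a').
    have : idgen [:: x; y] (lin u * (G * a' - r * \prod_(v <- s) lin v)).
      apply/idgen2; exists (p - G * p'), (q - G * q').
      have -> : lin u * (G * a' - r * \prod_(v <- s) lin v) =
        G * (a' * lin u) - r * (lin u * \prod_(v <- s) lin v) by ring.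
      have -> : a' * lin u = a - p' * x - q' * y by rewrite eq_a'; ring.
      by rewrite !mulrBr eq_a; ring.
    move=> /ppl[/(lin_line u0)//|/idgen2[p1 [q1 eq1]]].
    by apply/idgen3; exists p1, q1, r; rewrite -eq1; ring.
  move=> Isa'; have [v sv|v sv|p2 [q2 [r2 eq2]]] := (idgen3 _ _ _ _).1 (Isa' _ _).
  - by apply: s0; rewrite inE sv orbT.
  - by apply: Gs; rewrite inE sv orbT.
  apply/idgen3; exists (p' + lin u * p2), (q' + lin u * q2), r2.
  by rewrite eq_a' big_cons eq2; ring.
move=> /idadd_zero one; have : @irrelevant K 1.
  move: one; apply: idgen_sub; first exact: idgen_ideal.
  move=> b; rewrite !inE => /or4P[]/eqP->; try exact: irrelevant_var.
    by apply: (irrelevant_homog hF); apply: homog_gt0 hF Fc.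
  by apply: (irrelevant_homog hG); apply: homog_gt0 hG Gc.
by move/irrelevantP/eqP; rewrite mcoeff1 eqxx oner_eq0.
Qed.

End CommonRoot.
End AxisPoints.

(** * Dimension and depth at the points over J *)

Lemma homog_factor (K : fieldType) (l w : {mpoly K[4]}) d : l != 0 ->
  l \is 1.-homog -> l * w \is d.-homog -> w \is (d.-1).-homog.
Proof.
move=> l0 hl hlw; rewrite [w]pihomog_sum; apply: rpred_sum => i _.
have [eq_d|ne_d] := eqVneq d (1 + i)%N; first by rewrite eq_d add1n; apply: pihomogP.
suff -> : pihomog mdeg i w = 0 by apply: dhomog0.
by apply: (mulfI l0); rewrite mulr0 -(pihomogM_homog _ _ hl); apply: pihomog_ne0 hlw.
Qed.

Section Geometry.
Variable K : closedFieldType.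
Local Notation R := {mpoly K[4]}.
Variables (A B F G h : R) (du dv df dg d4 : nat).
Hypothesis gc : graded_config ix iy A B F G h du dv df dg d4.
Hypotheses (Fx : free_of ix F) (Fy : free_of iy F) (Gx : free_of ix G) (Gy : free_of iy G).
Hypotheses (Fc : forall c : K, F <> c%:MP) (Gc : forall c : K, G <> c%:MP).
Local Notation x := ('X_ix : R).
Local Notation y := ('X_iy : R).
Local Notation J := (double_ideal x y A B F G h).
Implicit Types (P Q : R -> Prop) (p : R).

Let iJ : is_ideal J := double_is_ideal ix iy A B F G h.
Let hJ : homog_ideal J := double_homog gc.
Let hF : F \is df.-homog := gc_F gc.
Let hG : G \is dg.-homog := gc_G gc.

Lemma double_no_chain2 : ~ has_chain (on_proj J) 2.
Proof.
have [c [n0 hfJ]] := hf_ev_double gc.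
apply: (@no_chain2 _ J (du + dv) (hf J n0) n0 iJ) => n le_n.
rewrite -(Num.Theory.ler_nat rat) natrD natrM hfJ // hfJ //.
by rewrite Num.Theory.lerD2l Num.Theory.lerDr -natrM Num.Theory.ler0n.
Qed.

Lemma axis_on_proj u : u != (0, 0) -> axis_pt u F -> on_proj J (axis_pt u).
Proof.
move=> u0 uF; split; first exact: axis_projpt.
have [i0 iD iM] := idgen_ideal [:: x; y; lin u].
apply: idgen_sub; first exact: idgen_ideal.
move=> b; rewrite !inE => /or4P[]/eqP->.
- by apply: iM; apply: axis_y.
- by apply: ideal_mulr; [exact: idgen_ideal | exact: axis_x].
- by apply: ideal_mulr; [exact: idgen_ideal | exact: axis_y].
- have -> : x * A * G + y * B * F + h * F * G = A * G * x + B * F * y + h * G * F by ring.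
  by apply: (iD); [apply: (iD); apply: (iM); [exact: axis_x | exact: axis_y] | apply: (iM)].
Qed.

Lemma double_point : exists P, on_proj J P.
Proof.
have F0 : F != 0 by apply/eqP => F0; apply: (@Fc 0); rewrite F0 mpolyC0.
have [c [s [c0 szs s0 eF]]] := split_form Fx Fy hF F0.
case: s szs s0 eF => [sz|u s _ s0 eF]; first by have := homog_gt0 hF Fc; rewrite -sz.
exists (axis_pt u); apply: axis_on_proj; first by apply: s0; apply: mem_head.
rewrite eF big_cons; apply: ideal_scale; first exact: idgen_ideal.
by apply: ideal_mulr; [exact: idgen_ideal | exact: axis_lin].
Qed.

Lemma on_proj_up P Q : on_proj J P -> is_projpt Q -> sub_ideal P Q -> on_proj J Q.
Proof. by move=> [_ JP] projQ PQ; split=> // a /JP/PQ. Qed.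

(** Downwards when P is a closed point, that is, when its Hilbert function is
    bounded, and upwards otherwise. *)
Lemma double_extend P : on_proj J P ->
  (exists Q, [/\ on_proj J Q, sub_ideal Q P & ~ sub_ideal P Q]) \/
  (exists Q, [/\ on_proj J Q, sub_ideal P Q & ~ sub_ideal Q P]).
Proof.
move=> JP; have [bP|unb] := pselect (exists N, forall n, (hf P n <= N)%N).
  by left; apply: (smaller_point gc).
right; have [Q [projQ PQ nQP]] := larger_point JP.1 unb.
by exists Q; split=> //; apply: on_proj_up PQ.
Qed.

Lemma chain_of2 (X : (R -> Prop) -> Prop) P Q : X P -> X Q ->
  sub_ideal P Q -> ~ sub_ideal Q P -> has_chain X 1.
Proof. by move=> XP XQ PQ nQP; apply: (@has_chain_cons _ _ 0 (fun=> Q) P). Qed.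

Lemma chain_of3 P Q T : on_proj J P -> on_proj J Q -> on_proj J T ->
  sub_ideal P Q -> ~ sub_ideal Q P -> sub_ideal Q T -> ~ sub_ideal T Q -> False.
Proof.
move=> JP JQ JT PQ nQP QT nTQ; apply: double_no_chain2.
by apply: (@has_chain_cons _ _ 1 (fun i => if i is 0 then Q else T) P) => // -[|[]].
Qed.

Lemma double_proj_dim : proj_dim J 1.
Proof.
split; last exact: double_no_chain2.
have [P JP] := double_point.
by have [[Q [JQ QP nPQ]]|[Q [JQ PQ nQP]]] := double_extend JP; [exact: chain_of2 nPQ | exact: chain_of2 nQP].
Qed.

Lemma double_pure : pure_dim J 1.
Proof.
split; first exact: double_proj_dim.
move=> P [JP minP]; split.
  have [[Q [JQ QP nPQ]]|[Q [JQ PQ nQP]]] := double_extend JP; first by case: nPQ; apply: minP.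
  by apply: (chain_of2 _ _ PQ nQP); split=> //; [case: JP | case: JQ].
case=> p [pP pS]; apply: double_no_chain2; exists p; split=> // i /pP[projp Pp].
exact: on_proj_up JP _ Pp.
Qed.

(** At a component, the local ring has dimension 0. At any other point P it has
    dimension 1, as chains of three points are excluded, and [nonzerodivisor]
    gives a regular element of its maximal ideal. *)
Lemma double_locally_cohen_macaulay :
  (forall P, is_projpt P -> ~ [/\ P x, P y, P F & P G]) -> locally_cohen_macaulay J.
Proof.
move=> nP P JP; have projP := projptP P; have onP : on_proj J P by [].
have i1 : is_ideal (@stalk_ideal K J P) by apply: stalk_ideal_ideal.
have pm : prime_ideal (@stalk_ideal K P P) by apply: stalk_prime => //; case: projP.
have Jm : sub_ideal (@stalk_ideal K J P) (@stalk_ideal K P P) by apply: stalk_ideal_sub.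
have [[Q [JQ QP nPQ]]|minP] := pselect (exists Q, [/\ on_proj J Q, sub_ideal Q P & ~ sub_ideal P Q]); last first.
  apply: (@stalk_cohen_macaulay _ _ _ iJ 0 [::]) => //.
    split; first exact: stalk_chain0.
    move/(stalk_chain hJ) => [p [pP pS]].
    have [JQ QP] := pP 0%N isT; have [JQ1 Q1P] := pP 1%N isT.
    have [_ nQ] := pS 0%N isT.
    by apply: minP; exists (p 0%N); split=> // PQ; apply: nQ => a /Q1P/PQ.
  split=> // /idadd_nil; move/(_ i1)/Jm; by case: pm.
have dim1 : krull_dim (@stalk_ideal K J P) 1.
  split; first exact: stalk_chain1 nPQ.
  move/(stalk_chain hJ) => [p [pP pS]]; apply: double_no_chain2.
  by exists p; split=> // i /pP[].
have bP : exists N, forall n, (hf P n <= N)%N.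
  apply: contrapT => unb; have [T [projT PT nTP]] := larger_point projP unb.
  exact: (chain_of3 JQ onP (on_proj_up onP projT PT) QP nPQ PT nTP).
have [a [r [e [ha Pa hr Pr nzd]]]] := nonzerodivisor gc onP bP (nP _ projP).
have [v Pv] := projpt_var projP.
have [f eq_f] := stalk_exists ha (homog_var v) Pv.
apply: (@stalk_cohen_macaulay _ _ _ iJ 1 [:: f]) => //; split.
  case=> // _ g /=; rewrite !(idadd_nil _ i1).
  have [b [s [d [hb hs Ps eq_g]]]] := stalk_repr g.
  have eq_fg : val (f * g) = (tofrac (a * b) / tofrac ('X_v * s)).
    by rewrite rmorphM /= eq_f eq_g !tofracM mulf_div.
  rewrite (stalk_idealE iJ (dhomogM ha hb) (dhomogM (homog_var v) hs) (projptM Pv Ps) eq_fg).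
  rewrite (stalk_idealE iJ hb hs Ps eq_g) => -[t [d' [ht Pt Jt]]].
  exists (r * t), (e + d')%N; split; [exact: dhomogM | exact: projptM |].
  by rewrite -mulrA; apply: nzd; rewrite mulrCA.
move/idadd1 => [g Jg]; case: (pm) => im m1 _; apply: m1.
apply: (ideal_subK im) (Jm _ Jg); case: (im) => _ _; apply.
by exists a, 'X_v, 1%N; split=> //; apply: homog_var.
Qed.

(** A common zero of F and G on the line x = y = 0 is an embedded point: every
    element of the maximal ideal of the local ring there kills the image of the
    nonzero class of [socle_element], so that the depth is 0; the dimension is
    not, by [smaller_on_line]. *)
Lemma common_root_not_cohen_macaulay u : u != (0, 0) -> axis_pt u F -> axis_pt u G ->
  ~ locally_cohen_macaulay J.
Proof.
move=> u0 uF uG cmJ; have onP := axis_on_proj u0 uF.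
pose P := ProjPt onP.1; have JP : sub_ideal J P := onP.2.
have [n [[chn nchn] [[s szs reg] _]]] := cmJ P JP.
have i1 : is_ideal (@stalk_ideal K J P) by apply: stalk_ideal_ideal.
have [Q [JQ QP nPQ]] : exists Q, [/\ on_proj J Q, sub_ideal Q P & ~ sub_ideal P Q].
  by apply: (smaller_on_line gc onP) u0; [exact: axis_x | exact: axis_y | exact: axis_lin].
case: s szs reg => [n0 _|f s _ /(regular_cons i1)[nzd [_ non1]]].
  by apply: nchn; rewrite -n0; apply: stalk_chain1 nPQ.
have [F' [eF _]] := axis_dvd (free_fixed_line Fx Fy) u0 uF.
have [G' [eG _]] := axis_dvd (free_fixed_line Gx Gy) u0 uG.
have [Jxw Jyw Jlw ndiv] := socle_element (gc_cfg gc) (lin_neq0 u0) eF eG.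
set w := x * A * G' + _ + _ in Jxw Jyw Jlw ndiv.
have socleE : lin u * w = x * A * G + y * B * F + h * F * G by rewrite /w eF eG; ring.
have Pw a : P a -> J (a * w).
  case/idgen3=> b [c [d ->]]; rewrite !mulrDl -!mulrA.
  by case: (iJ) => _ JD JM; apply: (JD); [apply: (JD) |]; apply: JM.
have hw : w \is (d4.-1).-homog.
  by apply: (homog_factor (lin_neq0 u0) (lin_homog u)); rewrite socleE; exact: gc_last gc.
have [v Pv] := projpt_var (projptP P); have [pP hP _] := projptP P.
have Pvd d : ~ P ('X_v ^+ d) by apply: prime_exp.
have [b [t [e [hb ht Pt eq_f]]]] := stalk_repr f.
have Pb : P b.
  apply: contrapT => Pb; apply: non1; apply: idadd_l.
  have [g eq_g] := stalk_exists ht hb Pb.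
  apply: idadd_r => //; apply/idgen1; exists g; apply: val_inj.
  rewrite rmorph1 rmorphM /= eq_f eq_g mulrA (divfK (projpt_neq0 Pb)).
  by rewrite (divff (projpt_neq0 Pt)).
have [g eq_g] := stalk_exists hw (homog_varX v d4.-1) (@Pvd _).
have Jg : stalk_ideal J g.
  apply: nzd; exists (b * w), (t * 'X_v ^+ d4.-1), (e + d4.-1)%N; split.
  - exact: Pw.
  - exact: dhomogM.
  - by apply: dhomogM ht _; apply: homog_varX.
  - exact: projptM.
  - by rewrite rmorphM /= eq_f eq_g !tofracM mulf_div.
have [t' [e' [_ Pt' Jtw]]] := (stalk_idealE iJ hw (homog_varX v d4.-1) (@Pvd _) eq_g).1 Jg.
by apply: Pt'; apply: ndiv.
Qed.

End Geometry.

(** * The resolution *)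

Section Resolution.
Variable K : fieldType.
Local Notation R := {mpoly K[4]}.
Implicit Types (p q : R) (d e : int).

Lemma ord4P (T : 'I_4 -> Prop) : T ix -> T iy -> T iz -> T it -> forall i, T i.
Proof.
move=> Tx Ty Tz Tt [[|[|[|[|//]]]] lt4].
- by rewrite (_ : Ordinal lt4 = ix) //; exact: val_inj.
- by rewrite (_ : Ordinal lt4 = iy) //; exact: val_inj.
- by rewrite (_ : Ordinal lt4 = iz) //; exact: val_inj.
- by rewrite (_ : Ordinal lt4 = it) //; exact: val_inj.
Qed.

Lemma sum4 (T : nmodType) (f : 'I_4 -> T) : \sum_i f i = f ix + f iy + f iz + f it.
Proof.
rewrite !big_ord_recl big_ord0 addr0 !addrA.
by congr (f _ + f _ + f _ + f _); exact: val_inj.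
Qed.

Definition col4 (a b c d : R) : 'cV[R]_4 := \col_i [:: a; b; c; d]`_i.

Lemma eq_col4 (v w : 'cV[R]_4) : v ix 0 = w ix 0 -> v iy 0 = w iy 0 ->
  v iz 0 = w iz 0 -> v it 0 = w it 0 -> v = w.
Proof. by move=> *; apply/matrixP; apply: ord4P => j; rewrite ord1. Qed.

Lemma in_degree0 d : in_degree d (0 : R).
Proof. by move=> m; rewrite msupp0. Qed.

Lemma in_degreeD d p q : in_degree d p -> in_degree d q -> in_degree d (p + q).
Proof. by move=> dp dq m /msuppD_le; rewrite mem_cat => /orP[/dp|/dq]. Qed.

Lemma in_degreeN d p : in_degree d p -> in_degree d (- p).
Proof. by move=> dp m; rewrite (perm_mem (msuppN p)) => /dp. Qed.

Lemma in_degreeM d e p q : in_degree d p -> in_degree e q -> in_degree (d + e) (p * q).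
Proof.
move=> dp dq m /msuppM_le/allpairsP[[m1 m2] [/= /dp em1 /dq em2 ->]].
by rewrite mdegD PoszD em1 em2.
Qed.

Lemma in_degree_homog (n : nat) d p : p \is n.-homog -> d = n -> in_degree d p.
Proof. by move=> /dhomogP hp -> m /hp <-. Qed.

Lemma graded_mapI m n (b : m.-tuple int) (a : n.-tuple int) (M : 'M[R]_(m, n)) :
  (forall i j, in_degree (tnth a j - tnth b i) (M i j)) -> graded_map b a M.
Proof.
move=> degM d v dv i; rewrite mxE.
elim/big_ind: _ => [||j _]; [exact: in_degree0 | by move=> *; apply: in_degreeD |].
have -> : d - tnth b i = tnth a j - tnth b i + (d - tnth a j) by ring.
exact: in_degreeM.
Qed.

Lemma minimal_mapI m n (M : 'M[R]_(m, n)) :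
  (forall i j, irrelevant (M i j)) -> minimal_map M.
Proof.
move=> irrM v i; rewrite mxE; apply: ideal_sum; first exact: idgen_ideal.
by move=> j _; apply: ideal_mulr; first exact: idgen_ideal.
Qed.

Lemma comp_homog n p (w : 4.-tuple R) : p \is n.-homog ->
  (forall i, tnth w i \is 1.-homog) -> p \mPo w \is n.-homog.
Proof.
move=> /dhomogP hp hw; rewrite comp_mpolyEX big_seq; apply: rpred_sum => m pm.
apply: rpredZ; rewrite comp_mpolyX -(hp m pm) /= mdegE.
elim/big_ind2: _ => [|a k b l|i _]; [exact: dhomog1 | exact: dhomogM |].
by have := dhomogMn (m i) (hw i); rewrite mul1n.
Qed.

Lemma comp_subst1_homog n p j : p \is n.-homog -> p \mPo subst1 K j \is n.-homog.
Proof.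
move=> hp; apply: comp_homog => // i; rewrite tnth_mktuple.
by case: eqP => _; [exact: dhomog0 | exact: homog_var].
Qed.

End Resolution.

Section ResolutionMaps.
Variable K : fieldType.
Local Notation R := {mpoly K[4]}.
Variables (x y A B F G h : R).
Hypothesis cfg : config x y A B F G h.
Local Notation U := (y * B + h * G).
Local Notation V := (x * A + h * F).
Local Notation g4 := (x * A * G + y * B * F + h * F * G).
Local Notation M1 := (mx_of_rows 1 4 [:: [:: x * y; x * V; y * U; g4]]).
Local Notation M2 := (mx_of_rows 4 4 [:: [:: V; U; A * G; B * F]; [:: - y; 0; 0; G];
                                         [:: 0; - x; F; 0]; [:: 0; 0; - y; - x]]).
Local Notation M3 := (mx_of_rows 4 1 [:: [:: G]; [:: - F]; [:: - x]; [:: y]]).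

Lemma resolution0 p : double_ideal x y A B F G h p <-> exists v : 'cV_4, M1 *m v = p%:M.
Proof.
split=> [/idgen4[a [b [c [d ->]]]]|[v /matrixP/(_ 0 0)]].
  exists (col4 a b c d); apply/matrixP => i j; rewrite !ord1 !mxE sum4 !mxE /=.
  by rewrite mulr1n; ring.
rewrite !mxE sum4 !mxE /= mulr1n => <-; apply/idgen4.
by exists (v ix 0), (v iy 0), (v iz 0), (v it 0); ring.
Qed.

Lemma resolution1 (v : 'cV_4) : M1 *m v = 0 <-> exists w, v = M2 *m w.
Proof.
split=> [/matrixP/(_ 0 0)|[w ->]].
  rewrite !mxE sum4 !mxE /= => syz.
  have [|w1 [w2 [w3 [w4 [e1 e2 e3 e4]]]]] := @syzygy1 _ _ _ _ _ _ _ _ cfg (v ix 0) (v iy 0) (v iz 0) (v it 0).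
    by rewrite -[RHS]syz; ring.
  exists (col4 w1 w2 w3 w4); apply: eq_col4; rewrite !mxE sum4 !mxE /=.
  - by rewrite e1; ring.
  - by rewrite e2; ring.
  - by rewrite e3; ring.
  - by rewrite e4; ring.
rewrite mulmxA; have -> : M1 *m M2 = 0; last by rewrite mul0mx.
apply/matrixP => i; apply: ord4P; rewrite !ord1 !mxE sum4 !mxE /=; ring.
Qed.

Lemma resolution2 (v : 'cV_4) : M2 *m v = 0 <-> exists w, v = M3 *m w.
Proof.
split=> [/matrixP eq_v|[w ->]].
  have := eq_v iy 0; have := eq_v iz 0; have := eq_v it 0.
  rewrite !mxE !sum4 !mxE /= => e3 e2 e1.
  have [|||q [q1 q2 q3 q4]] := @syzygy2 _ _ _ _ _ _ _ _ cfg (v ix 0) (v iy 0) (v iz 0) (v it 0).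
  - by rewrite -[RHS]e1; ring.
  - by rewrite -[RHS]e2; ring.
  - by rewrite -[RHS]e3; ring.
  exists (q%:M); apply: eq_col4; rewrite !mxE big_ord1 !mxE /= mulr1n //.
rewrite mulmxA; have -> : M2 *m M3 = 0; last by rewrite mul0mx.
by apply/matrixP => i j; move: i; apply: ord4P; rewrite !ord1 !mxE sum4 !mxE /=; ring.
Qed.

Lemma resolution3 (v : 'cV_1) : M3 *m v = 0 -> v = 0.
Proof.
move=> /matrixP/(_ it 0); rewrite !mxE big_ord1 !mxE /= => /eqP.
rewrite mulf_eq0 (negPf (cfg_y0 cfg)) => /eqP v0.
by apply/matrixP => i j; rewrite !ord1 mxE.
Qed.

End ResolutionMaps.

(** * Degrees of the data *)

Section Degrees.
Variable K : closedFieldType.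
Local Notation R := {mpoly K[4]}.
Implicit Types (A B F G h p q : R).

Lemma free_fixed1 i p : free_of i p -> fixed_off [:: i] p.
Proof. by move=> fp; apply: free_fixed => j; rewrite inE => /eqP->. Qed.

(** The summand h F is what is left of X_i A + h F when X_i is set to 0; hence both
    summands are homogeneous of the same degree, whichever of them vanishes. *)
Lemma side_degrees i h F A df : free_of i h -> free_of i F -> F \is df.-homog -> F != 0 ->
    h \is homog mdeg -> A \is homog mdeg ->
    'X_i ^+ 2 * A + 'X_i * h * F \is homog mdeg -> (h = 0 -> A != 0) ->
  exists dv, [/\ 'X_i * A + h * F \is dv.-homog, h * F \is dv.-homog &
    dv = if h == 0 then (1 + (msize A).-1)%N else ((msize h).-1 + df)%N].
Proof.
move=> hi Fi hF F0 hh hA /homogP[d hg] A0.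
have Xi0 := mpolyX_neq0 K i.
have hV : 'X_i * A + h * F \is (d.-1).-homog.
  apply: (homog_factor Xi0 (homog_var i)).
  by have -> : 'X_i * ('X_i * A + h * F) = 'X_i ^+ 2 * A + 'X_i * h * F by ring.
have hhF : h * F \is (d.-1).-homog.
  have := comp_subst1_homog i hV; rewrite rmorphD !rmorphM /= substX tnth_mktuple eqxx mul0r add0r.
  by rewrite (fixed_subst1 (free_fixed1 hi)) (fixed_subst1 (free_fixed1 Fi)).
exists d.-1; split=> //; case: eqP => [h0|/eqP h0].
  apply: (dhomog_uniq _ hV); rewrite h0 mul0r addr0; first by rewrite mulf_neq0 ?A0.
  by apply: dhomogM hA; apply: homog_var.
by apply: (dhomog_uniq _ hhF); [rewrite mulf_neq0 | apply: dhomogM].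
Qed.

Lemma nonconstant_neq0 F : (forall c : K, F <> c%:MP) -> F != 0.
Proof. by move=> Fc; apply/eqP => F0; apply: (@Fc 0); rewrite F0 mpolyC0. Qed.

Lemma degrees_h0 (dv du d4 df dg a : nat) : d4 = (dv + dg)%N -> d4 = (du + df)%N ->
    dv = (1 + a)%N -> let dh := a%:Z + 1 - df%:Z in
  [/\ dv%:Z = df%:Z + dh, du%:Z = dg%:Z + dh & d4%:Z = df%:Z + dg%:Z + dh].
Proof. by move=> e4 e4' ea; split; lia. Qed.

Lemma degrees_h (dv du d4 df dg e : nat) : d4 = (dv + dg)%N -> dv = (e + df)%N ->
    du = (e + dg)%N ->
  [/\ dv%:Z = df%:Z + e%:Z, du%:Z = dg%:Z + e%:Z & d4%:Z = df%:Z + dg%:Z + e%:Z].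
Proof. by move=> -> -> ->; split; lia. Qed.

Lemma curve_degrees h F G A B (dF dG dh : int) :
  free_of ix h -> free_of iy h -> free_of ix F -> free_of iy F ->
  free_of ix G -> free_of iy G -> free_of iy A -> free_of ix B ->
  h \is homog mdeg -> F \is homog mdeg -> G \is homog mdeg ->
  A \is homog mdeg -> B \is homog mdeg ->
  'X_ix ^+ 2 * A + 'X_ix * h * F \is homog mdeg ->
  'X_iy ^+ 2 * B + 'X_iy * h * G \is homog mdeg ->
  'X_ix * A * G + 'X_iy * B * F + h * F * G \is homog mdeg ->
  (forall c : K, F <> c%:MP) -> (forall c : K, G <> c%:MP) ->
  (h = 0 -> A * B <> 0) ->
  dF = deg F -> dG = deg G ->
  dh = (if h == 0 then deg A + 1 - dF else deg h) ->
  exists du dv df dg d4 : nat,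
    [/\ graded_config ix iy A B F G h du dv df dg d4,
        [/\ dF = df, dG = dg, dv = dF + dh :> int, du = dG + dh :> int & d4 = dF + dG + dh :> int],
        (0 < dv)%N /\ (0 < du)%N & A \is (dv.-1).-homog /\ B \is (du.-1).-homog].
Proof.
move=> hx hy Fx Fy Gx Gy Ay Bx hh hF hG hA hB hg2 hg3 hg4 Fc Gc AB eF eG eh.
have F0 := nonconstant_neq0 Fc; have G0 := nonconstant_neq0 Gc.
have A0 : h = 0 -> A != 0 by move=> /AB AB0; apply/eqP => A0; apply: AB0; rewrite A0 mul0r.
have B0 : h = 0 -> B != 0 by move=> /AB AB0; apply/eqP => B0; apply: AB0; rewrite B0 mulr0.
pose df := (msize F).-1; pose dg := (msize G).-1.
have hF' : F \is df.-homog by []. have hG' : G \is dg.-homog by [].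
have df0 : (0 < df)%N := homog_gt0 hF' Fc. have dg0 : (0 < dg)%N := homog_gt0 hG' Gc.
have [dv [hV hhF eq_dv]] := side_degrees hx Fx hF' F0 hh hA hg2 A0.
have [du [hU hhG eq_du]] := side_degrees hy Gy hG' G0 hh hB hg3 B0.
have /homogP[d4 h4] := hg4.
have x0 := mpolyX_neq0 K ix; have y0 := mpolyX_neq0 K iy.
have [fAy fBx] := (free_fixed1 Ay, free_fixed1 Bx).
have [[fhx fhy] [fFx fFy] [fGx fGy]] := And3 (free_fixed1 hx, free_fixed1 hy)
  (free_fixed1 Fx, free_fixed1 Fy) (free_fixed1 Gx, free_fixed1 Gy).
have hxA : 'X_ix * A \is dv.-homog.
  by rewrite -[X in X \is _](addrK (h * F)); apply: rpredB.
have hyB : 'X_iy * B \is du.-homog.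
  by rewrite -[X in X \is _](addrK (h * G)); apply: rpredB.
have xAfix : fixed_off [:: iy] ('X_ix * A) by apply: fixedM => //; apply: fixed_var.
have yBfix : fixed_off [:: ix] ('X_iy * B) by apply: fixedM => //; apply: fixed_var.
have xy : (ix == iy) = false by [].
have h4y : 'X_ix * A * G + h * F * G \is d4.-homog.
  have := comp_subst1_homog iy h4.
  have -> : 'X_ix * A * G + 'X_iy * B * F + h * F * G =
    ('X_ix * A) * G + 'X_iy * (B * F) + h * F * G by ring.
  rewrite 2!rmorphD !rmorphM /= !substX !tnth_mktuple eqxx xy mul0r addr0.
  by rewrite (fixed_subst1 fAy) (fixed_subst1 fhy) (fixed_subst1 fFy) (fixed_subst1 fGy).
have h4x : 'X_iy * B * F + h * F * G \is d4.-homog.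
  have := comp_subst1_homog ix h4.
  have -> : 'X_ix * A * G + 'X_iy * B * F + h * F * G =
    'X_ix * (A * G) + 'X_iy * B * F + h * F * G by ring.
  rewrite 2!rmorphD !rmorphM /= !substX !tnth_mktuple eqxx eq_sym xy mul0r add0r.
  by rewrite (fixed_subst1 fBx) (fixed_subst1 fhx) (fixed_subst1 fFx) (fixed_subst1 fGx).
have eqs : [/\ dv%:Z = dF + dh, du%:Z = dG + dh & d4%:Z = dF + dG + dh].
  move: eq_dv eq_du eh; rewrite eF eG /deg -/df -/dg; case: eqP => [h0|/eqP h0] eq_dv eq_du eh.
    have e4 : d4 = (dv + dg)%N.
      apply: (dhomog_uniq _ h4y); rewrite h0 !mul0r addr0; last exact: dhomogM.
      by rewrite !mulf_neq0 ?A0.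
    have e4' : d4 = (du + df)%N.
      apply: (dhomog_uniq _ h4x); rewrite h0 !mul0r addr0; last exact: dhomogM.
      by rewrite !mulf_neq0 ?B0.
    by rewrite eh; apply: degrees_h0 e4 e4' eq_dv.
  have e4 : d4 = (dv + dg)%N.
    have := comp_subst1_homog ix h4y; rewrite rmorphD !rmorphM /= substX tnth_mktuple eqxx !mul0r add0r.
    rewrite (fixed_subst1 fhx) (fixed_subst1 fFx) (fixed_subst1 fGx).
    by move=> hFG; apply: (dhomog_uniq _ hFG); [rewrite !mulf_neq0 | apply: dhomogM].
  by rewrite eh; apply: degrees_h e4 eq_dv eq_du.
have [edv edu ed4] := eqs.
have dv0 : (0 < dv)%N by rewrite eq_dv; case: eqP => _; rewrite ?addn_gt0 ?df0 ?orbT.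
have du0 : (0 < du)%N by rewrite eq_du; case: eqP => _; rewrite ?addn_gt0 ?dg0 ?orbT.
have V0 : 'X_ix * A + h * F != 0.
  apply/eqP => V0; have := congr1 (comp_mpoly (subst1 K ix)) V0.
  rewrite raddf0 rmorphD !rmorphM /= substX tnth_mktuple eqxx mul0r add0r.
  rewrite (fixed_subst1 fhx) (fixed_subst1 fFx).
  move/eqP; rewrite mulf_eq0 (negPf F0) orbF => /eqP h0.
  by move/eqP: V0; rewrite h0 mul0r addr0 mulf_eq0 (negPf x0) (negPf (A0 h0)).
have U0 : 'X_iy * B + h * G != 0.
  apply/eqP => U0; have := congr1 (comp_mpoly (subst1 K iy)) U0.
  rewrite raddf0 rmorphD !rmorphM /= substX tnth_mktuple eqxx mul0r add0r.
  rewrite (fixed_subst1 fhy) (fixed_subst1 fGy).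
  move/eqP; rewrite mulf_eq0 (negPf G0) orbF => /eqP h0.
  by move/eqP: U0; rewrite h0 mul0r addr0 mulf_eq0 (negPf y0) (negPf (B0 h0)).
have fyx : fixed_off [:: ix] ('X_iy : R) by apply: fixed_var.
have fxy : fixed_off [:: iy] ('X_ix : R) by apply: fixed_var.
have fU : fixed_off [:: ix] ('X_iy * B + h * G) by apply: fixedD yBfix _; apply: fixedM.
have fV : fixed_off [:: iy] ('X_ix * A + h * F) by apply: fixedD xAfix _; apply: fixedM.
exists du, dv, df, dg, d4; split=> //; last first.
  by split; [apply: (homog_factor x0 (homog_var ix)) | apply: (homog_factor y0 (homog_var iy))].
split=> //; split.
- exact: prime1.
- exact: prime1.
- exact: line_prime.
- by move/(fixed1_neq0 fyx)/eqP; rewrite (negPf y0).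
- by move/(fixed1_neq0 fxy)/eqP; rewrite (negPf x0).
- by move/(fixed1_neq0 fU)/eqP; rewrite (negPf U0).
- by move/(fixed1_neq0 fV)/eqP; rewrite (negPf V0).
- exact: fixed_line_neq0 (free_fixed_line Fx Fy) F0.
- exact: fixed_line_neq0 (free_fixed_line Gx Gy) G0.
Qed.

End Degrees.

(** * The degree *)

Lemma linear_poly_lead (D : nat) (c : rat) : (0 < D)%N ->
  let H := D%:R *: 'X + c%:P in (size H).-1`!%:R * lead_coef H = D%:R.
Proof.
move=> D0 H; have HD : D%:R != 0 :> rat by rewrite Num.Theory.pnatr_eq0 -lt0n.
have szH : size H = 2.
  rewrite /H -mul_polyC size_MXaddC polyC_eq0 (negPf HD) /= size_polyC HD.
  by [].
by rewrite lead_coefE szH (_ : 1`! = 1%N) ?mul1r // coefD coefZ coefX coefC /= mulr1 addr0.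
Qed.

Section Degree.
Variable K : closedFieldType.

Lemma double_degree (A B F G h : {mpoly K[4]}) du dv df dg d4 : (0 < du + dv)%N ->
  graded_config ix iy A B F G h du dv df dg d4 ->
  proj_degree (double_ideal 'X_ix 'X_iy A B F G h) (du + dv)%N.
Proof.
move=> D0 gc; have [c [n0 hfJ]] := hf_ev_double gc.
exists ((du + dv)%:R *: 'X + c%:P); last exact: linear_poly_lead.
exists n0 => n le_n; exists (hf (double_ideal 'X_ix 'X_iy A B F G h) n).
  by apply: hilbert_fun_hf; apply: idgen_ideal.
by rewrite hfJ // hornerD hornerZ hornerX hornerC.
Qed.

End Degree.

Theorem lemma2p2 (K : closedFieldType) (h F G A B : {mpoly K[4]})
    (dF dG dh : int) :
  let x : {mpoly K[4]} := 'X_ix in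
  let y : {mpoly K[4]} := 'X_iy in
  let g1 := x * y in
  let g2 := x ^+ 2 * A + x * h * F in
  let g3 := y ^+ 2 * B + y * h * G in
  let g4 := x * A * G + y * B * F + h * F * G in
  let J := idgen [:: g1; g2; g3; g4] in
  free_of ix h -> free_of iy h -> free_of ix F -> free_of iy F ->
  free_of ix G -> free_of iy G -> free_of iy A -> free_of ix B ->
  h \is homog mdeg -> F \is homog mdeg -> G \is homog mdeg ->
  A \is homog mdeg -> B \is homog mdeg ->
  g2 \is homog mdeg -> g3 \is homog mdeg -> g4 \is homog mdeg ->
  (forall c : K, F <> c%:MP) -> (forall c : K, G <> c%:MP) ->
  (h = 0 -> A * B <> 0) ->
  dF = deg F -> dG = deg G ->
  dh = (if h == 0 then deg A + 1 - dF else deg h) ->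
  [/\ proj_dim J 1 /\ proj_degree J (2 * dh + dF + dG),
      minimal_free_graded_resolution J
        [tuple 2; dF + dh + 1; dG + dh + 1; dF + dG + dh]
        [tuple dF + dh + 2; dG + dh + 2; dF + dG + dh + 1; dF + dG + dh + 1]
        [tuple dF + dG + dh + 2]
        (mx_of_rows 1 4 [:: [:: g1; g2; g3; g4]])
        (mx_of_rows 4 4 [:: [:: x * A + h * F; y * B + h * G; A * G; B * F];
                            [:: - y; 0; 0; G];
                            [:: 0; - x; F; 0];
                            [:: 0; 0; - y; - x]])
        (mx_of_rows 4 1 [:: [:: G]; [:: - F]; [:: - x]; [:: y]]) &
      is_curve J <-> regular_seq (@zero_ideal _) [:: x; y; F; G]].
Proof.
move=> x y g1 g2 g3 g4 J hx hy Fx Fy Gx Gy Ay Bx hh hF hG hA hB hg2 hg3 hg4 Fc Gc AB eF eG eh.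
have [du [dv [df [dg [d4 [gc [edF edG edv edu ed4] [dv0 du0] [hA' hB']]]]]]] :=
  curve_degrees hx hy Fx Fy Gx Gy Ay Bx hh hF hG hA hB hg2 hg3 hg4 Fc Gc AB eF eG eh.
have cfg := gc_cfg gc; have df0 := homog_gt0 (gc_F gc) Fc; have dg0 := homog_gt0 (gc_G gc) Gc.
have eg2 : g2 = x * (x * A + h * F) by rewrite /g2; ring.
have eg3 : g3 = y * (y * B + h * G) by rewrite /g3; ring.
have -> : J = double_ideal x y A B F G h by rewrite /J eg2 eg3.
rewrite eg2 eg3.
have edv1 : (dv.-1)%:Z = dF + dh - 1 by rewrite -edv -{2}(prednK dv0) -addn1 PoszD addrK.
have edu1 : (du.-1)%:Z = dG + dh - 1 by rewrite -edu -{2}(prednK du0) -addn1 PoszD addrK.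
have [hx1 hy1] : x \is 1.-homog /\ y \is 1.-homog by split; apply: homog_var.
have [hF1 hG1 hU hV] := And4 (gc_F gc) (gc_G gc) (gc_U gc) (gc_V gc).
have [irrF irrG] := (irrelevant_homog hF1 df0, irrelevant_homog hG1 dg0).
have [irrx irry] := (irrelevant_var K ix, irrelevant_var K iy).
have [irr0 irrD irrM] : is_ideal (@irrelevant K) := idgen_ideal _.
have irrN p : @irrelevant K p -> irrelevant (- p).
  by apply: ideal_opp; apply: idgen_ideal.
split.
- split; first exact: (double_proj_dim gc).
  have -> : 2 * dh + dF + dG = (du + dv)%N :> int.
    by rewrite PoszD edu edv; ring.
  by apply: double_degree gc; rewrite addn_gt0 du0.
- split.
  + split; apply: graded_mapI.
    * move=> i; apply: ord4P; rewrite ord1 !(tnth_nth 0) !mxE /=.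
      - by apply: (in_degree_homog (dhomogM hx1 hy1)); ring.
      - by apply: (in_degree_homog (dhomogM hx1 hV)); rewrite PoszD edv; ring.
      - by apply: (in_degree_homog (dhomogM hy1 hU)); rewrite PoszD edu; ring.
      - by apply: (in_degree_homog (gc_last gc)); rewrite ed4; ring.
    * apply: ord4P; apply: ord4P; rewrite !(tnth_nth 0) !mxE /=; try exact: in_degree0.
      - by apply: (in_degree_homog hV); rewrite edv; ring.
      - by apply: (in_degree_homog hU); rewrite edu; ring.
      - by apply: (in_degree_homog (dhomogM hA' hG1)); rewrite PoszD edv1 edG; ring.
      - by apply: (in_degree_homog (dhomogM hB' hF1)); rewrite PoszD edu1 edF; ring.
      - by apply: in_degreeN; apply: (in_degree_homog hy1); ring.
      - by apply: (in_degree_homog hG1); rewrite -edG; ring.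
      - by apply: in_degreeN; apply: (in_degree_homog hx1); ring.
      - by apply: (in_degree_homog hF1); rewrite -edF; ring.
      - by apply: in_degreeN; apply: (in_degree_homog hy1); ring.
      - by apply: in_degreeN; apply: (in_degree_homog hx1); ring.
    * move=> + j; apply: ord4P; rewrite ord1 !(tnth_nth 0) !mxE /=.
      - by apply: (in_degree_homog hG1); rewrite -edG; ring.
      - by apply: in_degreeN; apply: (in_degree_homog hF1); rewrite -edF; ring.
      - by apply: in_degreeN; apply: (in_degree_homog hx1); ring.
      - by apply: (in_degree_homog hy1); ring.
  + split.
    * by move=> p; apply: resolution0.
    * by move=> v; apply: (resolution1 cfg).
    * by move=> v; apply: (resolution2 cfg).
    * by move=> v; apply: (resolution3 cfg).
  + split; apply: minimal_mapI.
    * have irrC p q : @irrelevant K p -> irrelevant (p * q).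
        by apply: ideal_mulr; apply: idgen_ideal.
      apply: ord4P; apply: ord4P; rewrite !mxE /=; try exact: irr0; try exact: irrN.
      - by apply: irrD; [apply: irrC | apply: irrM].
      - by apply: irrD; [apply: irrC | apply: irrM].
      - exact: irrM.
      - exact: irrM.
      - exact: irrG.
      - exact: irrF.
    * move=> + j; apply: ord4P; rewrite ord1 !mxE /=;
        [exact: irrG | exact: irrN | exact: irrN | exact: irry].
- split=> [[_ cmJ]|reg].
    apply: (no_common_root_regular Fx Fy hF1 hG1 Fc Gc) => u u0 uF uG.
    exact: (common_root_not_cohen_macaulay gc Fx Fy Gx Gy u0 uF uG cmJ).
  split; first exact: (double_pure gc).
  apply: (double_locally_cohen_macaulay gc) => P projP [Px Py PF PG].
  have [u u0 [uF uG]] := common_root Fx Fy Gx Gy hF1 hG1 Fc Gc projP Px Py PF PG.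
  exact: (regular_no_common_root Fx Fy Gx Gy Fc reg u0 uF uG).
Qed.
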